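(* Let $\{\xi_j\}_{j\in\mathbb{Z}_+}$ be i.i.d. random variables with common distribution $m$ such that $\xi_j\ge c>0$ and $m[c,c+\varepsilon)>0$ for every $\varepsilon>0$. Given $\{\xi_j\}$, let the weights $X(i,j)$ be independent with $X(i,j)$ exponential of rate $\xi_j$, and let $\Psi_G$ be the corresponding last-passage time constant. Then: Case 1: if $\int_{[c,\infty)}(\xi-c)^{-2}m(d\xi)<\infty$, there exists $\alpha_0>0$ such that $$\Psi_G(1,\alpha)=c^{-1}+\alpha\int_{[c,\infty)}\frac{1}{\xi-c}\,m(d\xi)\quad\text{for }\alpha\in[0,\alpha_0].$$ Case 2: suppose there exist $\nu\in[-1,1]$ and $\kappa>0$ with $\lim_{\xi\searrow c}m[c,\xi)/(\xi-c)^{\nu+1}=\kappa$. Then as $\alpha\searrow0$: if $\nu\in(0,1]$, $\Psi_G(1,\alpha)=c^{-1}+\alpha\int_{[c,\infty)}\frac{1}{\xi-c}m(d\xi)+o(\alpha)$; if $\nu=0$, $\Psi_G(1,\alpha)=c^{-1}-\kappa\alpha\log\alpha+o(\alpha\log\alpha)$; if $\nu\in[-1,0)$, $\Psi_G(1,\alpha)=c^{-1}+B\alpha^{\frac1{1-\nu}}+o(\alpha^{\frac1{1-\nu}})$, where $$A_\nu=\sum_{k=0}^\infty\binom{\nu+1}{k}\frac{(-1)^k}{k-\nu+1},\quad A_{\nu,2}=\sum_{k=0}^\infty\binom{\nu+1}{k}\frac{(-1)^k}{k-\nu},$$ $$B_0=(2\kappa c^2A_\nu)^{\frac1{1-\nu}},\qquad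 B=B_0c^{-2}+\kappa B_0^{\nu}A_{\nu,2}.$$
   Context: For $z=(k,\ell)\in\mathbb{Z}_+^2$, $T(z)=\max_\pi\sum_{w\in\pi}X(w)$ over nearest-neighbor paths from $(0,0)$ to $(k,\ell)$ with steps $(1,0)$ or $(0,1)$; $\Psi_G(x,y)=\lim_{n\to\infty}n^{-1}T(\lfloor nx\rfloor,\lfloor ny\rfloor)$ (almost sure limit). Row $j$ uses the exponential distribution $G_j(x)=1-e^{-\xi_jx}$.
   Formalization: Case 1 is stated for α in (0, α_0] rather than [0, α_0]: at α = 0 the almost sure limit of T(n,0)/n is the random value 1/ξ_0, not c^{-1}, so Ψ_G(1,0) is not given by the stated definition (it equals c^{-1} only by continuous extension). *)

(* Defs.v *)
From HB Require Import structures.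
From mathcomp Require Import all_boot all_order all_algebra.
From mathcomp Require Import all_classical all_reals all_analysis.
Set Implicit Arguments. Unset Strict Implicit. Unset Printing Implicit Defensive.
Import Order.TTheory GRing.Theory Num.Theory Num.Def.
Import numFieldNormedType.Exports.
Local Open Scope classical_set_scope.
Local Open Scope ring_scope.

Section LPP.
Variable R : realType.

(* An up-right path from (0,0) is encoded by its sequence of steps:
   true = step (1,0), false = step (0,1). *)
Definition lpp_step (z : nat * nat) (b : bool) : nat * nat :=
  if b then (z.1.+1, z.2) else (z.1, z.2.+1).

Definition lpp_vertices (s : seq bool) : seq (nat * nat) :=
  (0%N, 0%N) :: scanl lpp_step (0%N, 0%N) s.

Definition lpp_path (k l : nat) (s : seq bool) : Prop :=
  size s = (k + l)%N /\ count id s = k.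

Definition path_weight (X : nat -> nat -> R) (s : seq bool) : R :=
  \sum_(w <- lpp_vertices s) X w.1 w.2.

(* last-passage time T(k,l) = max over paths of the total weight
   (the set is finite and nonempty, so the supremum is a maximum) *)
Definition lpp_time (X : nat -> nat -> R) (k l : nat) : R :=
  sup [set path_weight X s | s in lpp_path k l].

Definition gbinom (a : R) (k : nat) : R :=
  (\prod_(i < k) (a - i%:R)) / (k`!)%:R.

Definition A_nu (nu : R) : R :=
  \big[+%R/0%R]_(0 <= k <oo) (gbinom (nu + 1) k * (-1) ^+ k / (k%:R - nu + 1)).

Definition A_nu2 (nu : R) : R :=
  \big[+%R/0%R]_(0 <= k <oo) (gbinom (nu + 1) k * (-1) ^+ k / (k%:R - nu)).

Definition inv_shift (c x : R) : \bar R :=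
  if x == c then +oo%E else ((x - c)^-1)%:E.

Definition inv_shift2 (c x : R) : \bar R :=
  if x == c then +oo%E else (((x - c) ^+ 2)^-1)%:E.

Definition is_littleo (F : set_system R) (f h : R -> R) : Prop :=
  forall e : R, 0 < e -> \forall x \near F, `|f x| <= e * `|h x|.

End LPP.

(* Main.v *)
(** For [0 < z < c] put independent weights on the axes: exponential of rate [z] on
the horizontal one, and exponential of rate [xi_j - z] at height [j] on the vertical
one. By Burke's property the horizontal increments along every row are again i.i.d.
exponential of rate [z], so this stationary model grows at speed
[z^-1 + a * M z], where [M z] is the integral of [(x - z)^-1] against [m]. All these
models live on the given probability space, the boundary weights being multiples of
the original ones. As they dominate the original ones, [Psi 1 a <= z^-1 + a * M z].
Conversely, at a critical point [z] of the speed the stationary geodesic leaves the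
axes after [o(n)] steps, since otherwise a slightly different [z] would give a faster
model than it should; and if the speed decreases on all of [(0, c)], the event
[xi_0 < c + e], of positive probability, makes the horizontal boundary nearly equal to
the original weights. Hence [Psi 1 a] is the infimum of [z^-1 + a * M z].

The expansions follow from the behaviour of [M] at [c], read off from
[u * M (c - u) = \int_0^1 m [c, c + u (1 - y) / y) dy]. For [nu < 0] the binomial
series of [(1 - y) ^ (nu + 1)] produces [kappa * A_nu2 nu], and the identity
[2 * A_nu nu = - nu * A_nu2 nu] says that [B0] minimises
[w / c ^+ 2 + kappa * A_nu2 nu * w `^ nu]. *)
Require Import Defs.
From HB Require Import structures.
From mathcomp Require Import all_boot all_order all_algebra.
From mathcomp Require Import all_classical all_reals all_analysis.
From mathcomp Require Import measurable_realfun ring lra.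
Import Order.TTheory GRing.Theory Num.Theory Num.Def.
Import numFieldNormedType.Exports.
Local Open Scope classical_set_scope.
Local Open Scope ring_scope.

(** * Last passage percolation with boundary weights *)

(** Since [Psi] is given as an almost sure limit, laws of large numbers in probability suffice: a
    bound that holds, for all large n, on an event of probability at least p > 0 passes to the
    limit. This is why Chebyshev's inequality is enough, and why one may restrict to an event of
    positive probability such as xi_0 < c + e. The assumed joint law speaks of constant thresholds,
    while the boundary weights are the original ones multiplied by functions of the rates; the law
    has to be extended to thresholds that depend on the rates. No estimate is made simultaneously
    over all exit points of the geodesic. If it follows an axis beyond s n steps, the same path in a
    model with larger weights on that axis gains at least the sum of the differences over those s n
    steps, so one comparison excludes all late exits. At a critical point the speed varies only
    quadratically in z while this gain is linear, so s can be taken arbitrarily small. *)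

Section BoundaryGrowth.
Context {R : realType}.
Implicit Types (U V : nat -> R) (Y : nat -> nat -> R).

(* Last-passage time of the bulk weights [Y i j] placed at [(i.+1, j.+1)], with
   [U i] at [(i.+1, 0)], [V j] at [(0, j.+1)] and zero weight at the origin. *)
Fixpoint growth U V Y (l : nat) : nat -> R :=
  if l is l'.+1 then
    fix row (k : nat) : R :=
      if k is k'.+1 then Y k' l' + Num.max (row k') (growth U V Y l' k'.+1)
      else \sum_(j < l'.+1) V j
  else fun k => \sum_(i < k) U i.

Lemma growth0l U V Y l : growth U V Y l 0 = \sum_(j < l) V j.
Proof. by case: l => //=; rewrite !big_ord0. Qed.

Lemma growthk0 U V Y k : growth U V Y 0 k = \sum_(i < k) U i.
Proof. by []. Qed.

Lemma growthSS U V Y k l : growth U V Y l.+1 k.+1 =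
  Y k l + Num.max (growth U V Y l.+1 k) (growth U V Y l k.+1).
Proof. by []. Qed.

(** [I] holds the horizontal increments of the row below, [v] the vertical increment on the left
    edge, [y] the weights of the new row. This is Lindley's recursion: a vertex turns (I, J, X) into
    (X + (I - J)^+, X + (J - I)^+). *)
Fixpoint vertical_incr (I : nat -> R) (v : R) (y : nat -> R) (i : nat) : R :=
  if i is i'.+1 then y i' + Num.max 0 (vertical_incr I v y i' - I i') else v.

Definition horizontal_incr (I : nat -> R) (v : R) (y : nat -> R) (i : nat) : R :=
  y i + Num.max 0 (I i - vertical_incr I v y i).

Fixpoint row_incr U V Y (l : nat) : nat -> R :=
  if l is l'.+1 then horizontal_incr (row_incr U V Y l') (V l') (Y^~ l') else U.

(** The increments are summed up the left edge and then along row [l]. The induction on [k] must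
    also carry the vertical increments, because the new row is computed from them. *)
Lemma growth_incr U V Y l k :
  growth U V Y l k = \sum_(j < l) V j + \sum_(i < k) row_incr U V Y l i.
Proof.
elim: l k => [|l IHl] k; first by rewrite growthk0 big_ord0 add0r.
suff: growth U V Y l.+1 k = growth U V Y l k +
        vertical_incr (row_incr U V Y l) (V l) (Y^~ l) k /\
      growth U V Y l.+1 k =
        \sum_(j < l.+1) V j + \sum_(i < k) row_incr U V Y l.+1 i by case.
elim: k => [|k [IHk1 IHk2]].
  by rewrite !growth0l !big_ord0 /= addr0 big_ord_recr.
have GI : growth U V Y l k.+1 = growth U V Y l k + row_incr U V Y l k.
  by rewrite !IHl big_ord_recr /= addrA.
rewrite growthSS; split.
  rewrite IHk1 GI /= /Num.max.
  by do 2 case: ifPn; rewrite -?leNgt; lra.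
rewrite [\sum_(i < k.+1) row_incr _ _ _ _ _]big_ord_recr addrA -IHk2 IHk1 GI.
rewrite [row_incr _ _ _ _.+1 _]/= /horizontal_incr /= /Num.max.
by do 2 case: ifPn; rewrite -?leNgt; lra.
Qed.

(* The geodesic leaves the boundary at [s]; the part of it after the exit is a
   competitor for every other choice of boundary weights. *)
Lemma growth_exit U V Y k l : exists W,
  (exists s, [/\ (s <= k)%N, growth U V Y l k = \sum_(i < s) U i + W &
     forall U' V', \sum_(i < s) U' i + W <= growth U' V' Y l k]) \/
  (exists t, [/\ (t <= l)%N, growth U V Y l k = \sum_(j < t) V j + W &
     forall U' V', \sum_(j < t) V' j + W <= growth U' V' Y l k]).
Proof.
elim: l k => [|l IHl] k.
  by exists 0; left; exists k; split => // *; rewrite !growthk0 addr0.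
elim: k => [|k [W IHk]].
  by exists 0; right; exists l.+1; split => // *; rewrite !growth0l addr0.
have GE U' V' : Y k l + growth U' V' Y l.+1 k <= growth U' V' Y l.+1 k.+1 /\
                Y k l + growth U' V' Y l k.+1 <= growth U' V' Y l.+1 k.+1.
  by rewrite growthSS !lerD2l !le_max !lexx orbT.
have [hle|hlt] := leP (growth U V Y l k.+1) (growth U V Y l.+1 k).
  exists (W + Y k l); case: IHk => -[s [sk sE sU]]; [left|right]; exists s.
    split; [exact: leqW| |].
      by rewrite growthSS max_l// sE; ring.
    by move=> U' V'; rewrite addrA addrC; have [+ _] := GE U' V'; have := sU U' V'; lra.
  split => //.
    by rewrite growthSS max_l// sE; ring.
  by move=> U' V'; rewrite addrA addrC; have [+ _] := GE U' V'; have := sU U' V'; lra.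
have [W' IH'] := IHl k.+1.
exists (W' + Y k l); case: IH' => -[s [sk sE sU]]; [left|right]; exists s.
  split => //.
    by rewrite growthSS max_r ?ltW// sE; ring.
  by move=> U' V'; rewrite addrA addrC; have [_ +] := GE U' V'; have := sU U' V'; lra.
split; [exact: leqW| |].
  by rewrite growthSS max_r ?ltW// sE; ring.
by move=> U' V'; rewrite addrA addrC; have [_ +] := GE U' V'; have := sU U' V'; lra.
Qed.

Lemma ler_sum_prefix (u : nat -> R) (p q : nat) :
  (forall i, 0 <= u i) -> (p <= q)%N -> \sum_(i < p) u i <= \sum_(i < q) u i.
Proof.
move=> u0 pq; rewrite -!(big_mkord xpredT u) (big_cat_nat (leq0n p) pq) /=.
by rewrite lerDl sumr_ge0.
Qed.

Lemma ler_growth U V U' V' Y k l : (forall i, U i <= U' i) ->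
  (forall j, V j <= V' j) -> growth U V Y l k <= growth U' V' Y l k.
Proof.
move=> UU' VV'; elim: l k => [|l IHl] k; first by rewrite !growthk0 ler_sum.
elim: k => [|k IHk]; first by rewrite !growth0l ler_sum.
by rewrite !growthSS lerD2l ge_max !le_max IHk IHl orbT.
Qed.

(** An exit within the first [s0] or [t0] steps costs at most the boundary sum over these steps.
    After a later exit, the same path read in the model with [U1] or [V2] is larger by at least the
    accumulated difference on the axis it follows. Only that axis is compared: [V1] and [U2] are
    arbitrary, and in the application they lie below [V] and [U]. *)
Lemma growth_exit_cases U V U0 V0 U1 V1 U2 V2 Y k l (s0 t0 : nat) :
  (forall i, 0 <= U i) -> (forall i, 0 <= V i) ->
  (forall i, 0 <= U0 i) -> (forall i, 0 <= V0 i) ->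
  (forall i, U i <= U1 i) -> (forall j, V j <= V2 j) ->
  [\/ growth U V Y l k <= \sum_(i < s0) U i + growth U0 V0 Y l k,
      growth U V Y l k <= growth U1 V1 Y l k - \sum_(i < s0) (U1 i - U i),
      growth U V Y l k <= \sum_(j < t0) V j + growth U0 V0 Y l k |
      growth U V Y l k <= growth U2 V2 Y l k - \sum_(j < t0) (V2 j - V j)].
Proof.
move=> U_ge0 V_ge0 U0_ge0 V0_ge0 UU1 VV2.
have [W [[s [sk sE sU]]|[t [tl tE tV]]]] := growth_exit U V Y k l.
  have [ss0|s0s] := leqP s s0.
    apply: Or41; have := ler_sum_prefix _ _ _ U_ge0 ss0; have := sU U0 V0.
    have : 0 <= \sum_(i < s) U0 i by exact: sumr_ge0.
    by rewrite sE; lra.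
  apply: Or42.
  have d0 i : 0 <= U1 i - U i by rewrite subr_ge0.
  have := ler_sum_prefix _ _ _ d0 (ltnW s0s); have := sU U1 V1.
  by rewrite sE !sumrB; lra.
have [tt0|t0t] := leqP t t0.
  apply: Or43; have := ler_sum_prefix _ _ _ V_ge0 tt0; have := tV U0 V0.
  have : 0 <= \sum_(i < t) V0 i by exact: sumr_ge0.
  by rewrite tE; lra.
apply: Or44.
have d0 i : 0 <= V2 i - V i by rewrite subr_ge0.
have := ler_sum_prefix _ _ _ d0 (ltnW t0t); have := tV U2 V2.
by rewrite tE !sumrB; lra.
Qed.

(** Variant for a horizontal boundary [U] only slightly above the weights [U0]: whatever the
    horizontal exit point, replacing [U] by [U0] loses at most the sum of all the gaps on the
    row. *)
Lemma growth_exit_cases_dominated U V U0 V0 U2 V2 Y k l (t0 : nat) :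
  (forall i, 0 <= V i) -> (forall i, 0 <= V0 i) ->
  (forall i, U0 i <= U i) -> (forall j, V j <= V2 j) ->
  [\/ growth U V Y l k <= growth U0 V0 Y l k + \sum_(i < k) (U i - U0 i),
      growth U V Y l k <= \sum_(j < t0) V j + growth U0 V0 Y l k |
      growth U V Y l k <= growth U2 V2 Y l k - \sum_(j < t0) (V2 j - V j)].
Proof.
move=> V_ge0 V0_ge0 U0U VV2.
have [W [[s [sk sE sU]]|[t [tl tE tV]]]] := growth_exit U V Y k l.
  apply: Or31.
  have d0 i : 0 <= U i - U0 i by rewrite subr_ge0.
  have := ler_sum_prefix _ _ _ d0 sk; have := sU U0 V0.
  by rewrite sE !sumrB; lra.
have [tt0|t0t] := leqP t t0.
  apply: Or32; have := ler_sum_prefix _ _ _ V_ge0 tt0; have := tV U0 V0.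
  have : 0 <= \sum_(i < t) V0 i by exact: sumr_ge0.
  by rewrite tE; lra.
apply: Or33.
have d0 i : 0 <= V2 i - V i by rewrite subr_ge0.
have := ler_sum_prefix _ _ _ d0 (ltnW t0t); have := tV U2 V2.
by rewrite tE !sumrB; lra.
Qed.

End BoundaryGrowth.

(** * Maximal path weights as a growth process *)

Section LppGrowth.
Context {R : realType}.
Implicit Types X : nat -> nat -> R.

(** The weights on the two axes serve as boundary weights and the origin is added separately.
    [growth] takes the row index first, hence the exchange of [k] and [l]. *)
Definition lpp_rec X (k l : nat) : R :=
  X 0 0 + growth (fun i => X i.+1 0) (fun j => X 0 j.+1)
                 (fun i j => X i.+1 j.+1) l k.

Lemma lpp_rec_step X k l b :
  let z := lpp_step (k, l) b in lpp_rec X k l + X z.1 z.2 <= lpp_rec X z.1 z.2.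
Proof.
rewrite /lpp_rec; case: b => /=.
  case: l => [|l]; first by rewrite !growthk0 big_ord_recr /= addrA.
  rewrite -addrA lerD2l [leRHS]growthSS addrC lerD2l.
  by rewrite le_max lexx.
case: k => [|k]; first by rewrite !growth0l big_ord_recr /= addrA.
by rewrite -addrA lerD2l [leRHS]growthSS addrC lerD2l le_max lexx orbT.
Qed.

Lemma path_weight_rcons X s b : path_weight X (rcons s b) =
  path_weight X s + X (foldl lpp_step (0%N, 0%N) (rcons s b)).1
                      (foldl lpp_step (0%N, 0%N) (rcons s b)).2.
Proof.
rewrite /path_weight /lpp_vertices !big_cons -addrA; congr (_ + _).
move: (0%N, 0%N) => z0; elim: s z0 => [|a s IHs] z0.
  by rewrite /= big_seq1 big_nil add0r.
by rewrite /= !big_cons IHs addrA.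
Qed.

Lemma foldl_lpp_step s :
  foldl lpp_step (0%N, 0%N) s = (count id s, (size s - count id s)%N).
Proof.
elim/last_ind: s => [//|s b IHs].
rewrite foldl_rcons IHs size_rcons -cats1 count_cat /= addn0 /lpp_step.
have cs := count_size id s.
by case: b => /=; rewrite ?addn1 ?addn0 ?subSS// subSn.
Qed.

Lemma path_weight_le X s :
  path_weight X s <= lpp_rec X (count id s) (size s - count id s).
Proof.
suff: path_weight X s <= lpp_rec X (foldl lpp_step (0%N, 0%N) s).1
                                   (foldl lpp_step (0%N, 0%N) s).2.
  by rewrite foldl_lpp_step.
elim/last_ind: s => [|s b IHs].
  by rewrite /path_weight /lpp_rec /= big_seq1 big_ord0 addr0.
rewrite path_weight_rcons foldl_rcons.
case: (foldl _ _ s) IHs => k l /= IHs.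
by apply: le_trans (lpp_rec_step X k l b); rewrite lerD2r.
Qed.

Lemma lpp_rec_path X k l : exists2 s, lpp_path k l s & path_weight X s = lpp_rec X k l.
Proof.
have extend s b i j : lpp_path i j s ->
    path_weight X (rcons s b) = path_weight X s +
      X (lpp_step (i, j) b).1 (lpp_step (i, j) b).2 /\
    lpp_path (lpp_step (i, j) b).1 (lpp_step (i, j) b).2 (rcons s b).
  move=> [sz ct]; split.
    by rewrite path_weight_rcons foldl_rcons foldl_lpp_step sz ct addKn.
  rewrite /lpp_path size_rcons sz -cats1 count_cat ct /=.
  by case: b; rewrite /= ?addn0 ?addn1 ?addSn ?addnS.
elim: l k => [|l IHl].
  elim=> [|k [s ps sE]].
    by exists [::] => //; rewrite /path_weight /lpp_rec /= big_seq1 big_ord0 addr0.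
  have [/= wE ps'] := extend _ true _ _ ps; exists (rcons s true) => //.
  by rewrite wE sE /lpp_rec !growthk0 big_ord_recr /= addrA.
elim=> [|k [s ps sE]].
  have [s ps sE] := IHl 0%N.
  have [/= wE ps'] := extend _ false _ _ ps; exists (rcons s false) => //.
  by rewrite wE sE /lpp_rec !growth0l big_ord_recr /= addrA.
rewrite /lpp_rec growthSS.
set g1 := growth _ _ _ l.+1 k; set g2 := growth _ _ _ l k.+1.
have [hle|hlt] := leP g2 g1.
  have [/= wE ps'] := extend _ true _ _ ps; exists (rcons s true) => //.
  by rewrite wE sE /lpp_rec -/g1 -addrA (addrC g1).
have [s' ps2 sE2] := IHl k.+1.
have [/= wE ps'] := extend _ false _ _ ps2; exists (rcons s' false) => //.
by rewrite wE sE2 /lpp_rec -/g2 -addrA (addrC g2).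
Qed.

Lemma lpp_timeE X k l : lpp_time X k l = lpp_rec X k l.
Proof.
rewrite /lpp_time.
have ub : ubound [set path_weight X s | s in lpp_path k l] (lpp_rec X k l).
  move=> _ [s [sz ct] <-]; rewrite (le_trans (path_weight_le _ _))//.
  by rewrite sz ct addKn.
have [s ps sE] := lpp_rec_path X k l.
apply/eqP; rewrite eq_le; apply/andP; split.
  by apply: ge_sup => //; exists (path_weight X s), s.
rewrite -sE; apply: ub_le_sup; last by exists s.
by exists (lpp_rec X k l).
Qed.

End LppGrowth.

(** * Burke property *)

Section PreimageUnique.
Context {R : realType} {d : measure_display} {Omega : measurableType d}.
Variable P : probability Omega R.

Lemma preimage_measurable {d' : measure_display} {T : measurableType d'}
    {f : Omega -> T} {A} : measurable_fun setT f -> measurable A -> measurable (f @^-1` A).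
Proof. by move=> mf mA; rewrite -[X in measurable X]setTI; exact: mf. Qed.

(** Uniqueness of finite measures agreeing on a pi-system, for the images of [P] restricted to [F]
    and to [F']. Allowing two different events is what lets laws under two different conditionings
    be compared. *)
Lemma preimage_measure_unique {d' : measure_display} {T : measurableType d'}
    (G : set (set T)) (g : nat -> set T) (F F' : set Omega) (f f' : Omega -> T) :
  measurable F -> measurable F' -> measurable_fun setT f -> measurable_fun setT f' ->
  measurable = <<s G >> -> setI_closed G -> (forall n, G (g n)) ->
  \bigcup_n g n = setT ->
  (forall A, G A -> P (f @^-1` A `&` F) = P (f' @^-1` A `&` F')) ->
  forall A, measurable A -> P (f @^-1` A `&` F) = P (f' @^-1` A `&` F').
Proof.
move=> mF mF' mf mf' mG GI Gg gT GE A mA.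
pose mu : {measure set Omega -> \bar R} := mrestr P mF.
pose mu' : {measure set Omega -> \bar R} := mrestr P mF'.
pose fM : {mfun Omega >-> T} := mfun_Sub (mem_set mf).
pose fM' : {mfun Omega >-> T} := mfun_Sub (mem_set mf').
have fin k : (pushforward mu fM (g k) < +oo)%E.
  apply: (@le_lt_trans _ _ (P setT)); last by rewrite probability_setT ltry.
  change (P (f @^-1` g k `&` F) <= P setT)%E.
  apply: le_measure; rewrite ?inE//; apply: measurableI => //.
  by apply: (preimage_measurable mf); rewrite mG; exact: sub_sigma_algebra.
exact: (@measure_unique _ R T G g mG GI Gg gT (pushforward mu fM)
  (pushforward mu' fM') GE fin A mA).
Qed.

Lemma preimage_unique_tail (F F' : set Omega) (f f' : Omega -> R) :
  measurable F -> measurable F' -> measurable_fun setT f -> measurable_fun setT f' ->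
  (forall a, P ([set w | a < f w] `&` F) = P ([set w | a < f' w] `&` F')) ->
  forall A, measurable A -> P (f @^-1` A `&` F) = P (f' @^-1` A `&` F').
Proof.
move=> mF mF' mf mf' tail.
move=> A mA.
have mE : @measurable _ R = <<s @measurable_realfun.RGenOInfty.G R >> by exact: measurable_realfun.RGenOInfty.measurableE.
refine (@preimage_measure_unique _ _ (@measurable_realfun.RGenOInfty.G R)
  (fun n => `](- n%:R), +oo[%classic) F F' f f' mF mF' mf mf' mE _ _ _ _ A mA).
- move=> _ _ [x ->] [y ->]; exists (Num.max x y).
  apply/seteqP; split => r /=; rewrite !in_itv /= !andbT gt_max.
    by case=> -> ->.
  by move=> /andP[].
- by move=> n; exists (- n%:R).
- rewrite -subTset => r _; exists (truncn `|r|).+1 => //=.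
  rewrite in_itv /= andbT ltrNl (le_lt_trans (ler_norm _))// normrN.
  exact: truncnS_gt.
- move=> _ [x ->]; rewrite !preimage_itvoy; exact: tail.
Qed.


(** The set [A] is absorbed into the conditioning event, after which tails settle the second
    coordinate; rectangles then determine the joint law. *)
Lemma preimage_unique_pair (F F' : set Omega) (f f' g g' : Omega -> R) :
  measurable F -> measurable F' -> measurable_fun setT f -> measurable_fun setT f' ->
  measurable_fun setT g -> measurable_fun setT g' ->
  (forall A a, measurable A -> P ([set w | A (f w) /\ a < g w] `&` F) =
                               P ([set w | A (f' w) /\ a < g' w] `&` F')) ->
  forall S : set (R * R), measurable S ->
  P ((fun w => (f w, g w)) @^-1` S `&` F) = P ((fun w => (f' w, g' w)) @^-1` S `&` F').
Proof.
move=> mF mF' mf mf' mg mg' tail S mS.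
refine (@preimage_measure_unique _ _ [set A `*` B | A in measurable & B in measurable]
  (fun=> setT) F F' _ _ mF mF' _ _ (measurable_prod_measurableType _ _) _ _ _ _ S mS).
- exact: measurable_fun_pair.
- exact: measurable_fun_pair.
- move=> _ _ [A1 mA1 [B1 mB1 <-]] [A2 mA2 [B2 mB2 <-]]; rewrite -setXI.
  by exists (A1 `&` A2); [exact: measurableI|exists (B1 `&` B2) => //; exact: measurableI].
- by move=> _; exists setT => //; exists setT => //; rewrite setXTT.
- by rewrite -subTset => x _; exists 0%N.
move=> _ [A mA [B mB <-]].
have mFA : measurable (F `&` f @^-1` A).
  by apply: measurableI => //; exact: preimage_measurable.
have mFA' : measurable (F' `&` f' @^-1` A).
  by apply: measurableI => //; exact: preimage_measurable.
have /(_ _ B mB) := preimage_unique_tail _ _ _ _ mFA mFA' mg mg'.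
have setE (h k : Omega -> R) C E : k @^-1` C `&` (E `&` h @^-1` A) =
    (fun w => (h w, k w)) @^-1` (A `*` C) `&` E.
  by apply/seteqP; split => w /=; tauto.
rewrite !setE; apply=> a.
have := tail A a mA; congr (P _ = P _); apply/seteqP; split => w /=; tauto.
Qed.

Lemma measurable_fun_lt_set {d' : measure_display} {T : measurableType d'} (f g : T -> R) :
  measurable_fun setT f -> measurable_fun setT g -> measurable [set w | f w < g w].
Proof.
move=> mf mg; have : measurable_fun setT (fun w => f w < g w).
  exact: measurable_fun_ltr.
by move=> /(_ measurableT [set true]); rewrite setTI; exact.
Qed.

Lemma preimage_unique_tails (F F' : set Omega) (f f' g g' : Omega -> R) :
  measurable F -> measurable F' -> measurable_fun setT f -> measurable_fun setT f' ->
  measurable_fun setT g -> measurable_fun setT g' ->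
  (forall a b, P ([set w | a < f w /\ b < g w] `&` F) =
               P ([set w | a < f' w /\ b < g' w] `&` F')) ->
  forall S : set (R * R), measurable S ->
  P ((fun w => (f w, g w)) @^-1` S `&` F) = P ((fun w => (f' w, g' w)) @^-1` S `&` F').
Proof.
move=> mF mF' mf mf' mg mg' tail; apply: preimage_unique_pair => // A b mA.
have mFA : measurable (F `&` [set w | b < g w]).
  by apply: measurableI => //; exact: measurable_fun_lt_set.
have mFA' : measurable (F' `&` [set w | b < g' w]).
  by apply: measurableI => //; exact: measurable_fun_lt_set.
have /(_ _ A mA) := preimage_unique_tail _ _ _ _ mFA mFA' mf mf'.
have setE (h k : Omega -> R) E : h @^-1` A `&` (E `&` [set w | b < k w]) =
    [set w | A (h w) /\ b < k w] `&` E.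
  by apply/seteqP; split => w /=; tauto.
rewrite !setE; apply=> a.
have := tail a b; congr (P _ = P _); apply/seteqP; split => w /=; tauto.
Qed.

(* Memorylessness in tail form says that, on [F], the difference [D = I - J] has
   the same joint law with [X] as with [min I J]; now
   [I = min I J + D^+], [J = min I J + D^-]. *)
Lemma vertex_burke (F : set Omega) (I J X : Omega -> R) :
  measurable F -> measurable_fun setT I -> measurable_fun setT J ->
  measurable_fun setT X ->
  (forall w, F w -> [/\ 0 < I w, 0 < J w & 0 < X w]) ->
  (forall a b c, 0 <= a -> 0 <= b -> 0 <= c ->
    P ([set w | [/\ a < I w, b < J w & c < X w]] `&` F) =
    P ([set w | a + c < I w /\ b + c < J w] `&` F)) ->
  forall a b, P ([set w | a < X w + Num.max 0 (I w - J w) /\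
                          b < X w + Num.max 0 (J w - I w)] `&` F) =
              P ([set w | a < I w /\ b < J w] `&` F).
Proof.
move=> mF mI mJ mX pos mem a b.
pose D w := I w - J w.
have mD : measurable_fun setT D by exact: measurable_funB.
pose M w := Num.min (I w) (J w).
have mM : measurable_fun setT M by exact: measurable_minr.
pose S : set (R * R) := [set p | a < p.2 + Num.max 0 p.1 /\ b < p.2 + Num.max 0 (- p.1)].
have mS : measurable S.
  have mmax (h : R * R -> R) : measurable_fun setT h ->
      measurable_fun setT (fun p : R * R => p.2 + Num.max 0 (h p)).
    by move=> mh; apply: measurable_funD => //; exact: measurable_maxr.
  have mN : measurable_fun setT (fun p : R * R => - p.1) by exact: measurable_funN.
  by apply: measurableI; apply: measurable_fun_lt_set => //; exact: mmax.
have := preimage_unique_pair F F D D X M mF mF mD mD mX mM _ S mS.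
have -> : (fun w => (D w, X w)) @^-1` S =
    [set w | a < X w + Num.max 0 (I w - J w) /\ b < X w + Num.max 0 (J w - I w)].
  by apply/seteqP; split => w; rewrite /S /D /= opprB.
have -> : (fun w => (D w, M w)) @^-1` S = [set w | a < I w /\ b < J w].
  have e w : M w + Num.max 0 (D w) = I w /\ M w + Num.max 0 (- D w) = J w.
    by rewrite /M /D /Num.max /Num.min; split; do 2 case: ifPn; rewrite -?leNgt; lra.
  by apply/seteqP; split => w; rewrite /S /=; have [-> ->] := e w.
apply=> A c mA.
(* On [F] both [X] and [M] are positive, so a negative threshold can be raised to 0. *)
wlog c0 : c / 0 <= c.
  move=> /(_ (Num.max c 0)); rewrite le_max lexx orbT => /(_ isT).
  congr (P _ = P _); apply/seteqP; split => w /= [[? h] Fw]; split => //; split => //;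
    have [? ? ?] := pos _ Fw; move: h; rewrite gt_max.
  - by case/andP.
  - by move=> ->.
  - by case/andP.
  - by move=> -> /=; rewrite /M lt_min; apply/andP.
have mFX : measurable (F `&` [set w | c < X w]).
  by apply: measurableI => //; exact: measurable_fun_lt_set.
have mFM : measurable (F `&` [set w | c < M w]).
  by apply: measurableI => //; exact: measurable_fun_lt_set.
(* Subtracting c from both variables leaves their difference unchanged, and by [mem] the shifted
   pair on {M > c} has the same tails as (I, J) on {X > c}. *)
pose Ic w := I w - c; pose Jc w := J w - c.
have mIc : measurable_fun setT Ic by exact: measurable_funB.
have mJc : measurable_fun setT Jc by exact: measurable_funB.
pose S' : set (R * R) := [set p | A (p.1 - p.2)].
have mS' : measurable S'.
  have mB : measurable_fun setT (fun p : R * R => p.1 - p.2) by exact: measurable_funB.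
  by have := mB measurableT A mA; rewrite setTI.
have := preimage_unique_tails _ _ I Ic J Jc mFX mFM mI mIc mJ mJc _ S' mS'.
have -> : (fun w => (I w, J w)) @^-1` S' `&` (F `&` [set w | c < X w]) =
    [set w | A (D w) /\ c < X w] `&` F.
  by apply/seteqP; split => w /=; rewrite /S' /D /=; tauto.
have -> : (fun w => (Ic w, Jc w)) @^-1` S' `&` (F `&` [set w | c < M w]) =
    [set w | A (D w) /\ c < M w] `&` F.
  have e w : Ic w - Jc w = D w by rewrite /Ic /Jc /D; ring.
  by apply/seteqP; split => w /=; rewrite /S' /= e; tauto.
apply=> x y.
wlog [x0 y0] : x y / 0 <= x /\ 0 <= y.
  move=> /(_ (Num.max x 0) (Num.max y 0)); rewrite !le_max !lexx !orbT => /(_ (conj isT isT)).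
  congr (P _ = P _); apply/seteqP; split => w /=; rewrite !gt_max.
  - by move=> [[/andP[-> _] /andP[-> _]] []].
  - by move=> [[-> ->] [Fw ->]]; have [-> -> _] := pos _ Fw.
  - by move=> [[/andP[-> _] /andP[-> _]] []].
  - move=> [[-> ->] [Fw]]; rewrite /M lt_min => /andP[hI hJ].
    by rewrite /Ic /Jc !subr_gt0 hI hJ.
have -> : [set w | x < I w /\ y < J w] `&` (F `&` [set w | c < X w]) =
    [set w | [/\ x < I w, y < J w & c < X w]] `&` F.
  by apply/seteqP; split => w /= [] [] *; repeat split; intuition.
rewrite mem//; congr (P _); apply/seteqP; split => w /=.
  move=> [[h1 h2] Fw]; rewrite /Ic /Jc /M lt_min !ltrBrDr h1 h2; split => //; split => //.
  by apply/andP; split; lra.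
by move=> [[+ +] [Fw _]]; rewrite /Ic /Jc !ltrBrDr.
Qed.

End PreimageUnique.

(** * Burke's property along a row and from row to row *)

Section RowBurke.
Context {R : realType} {d : measure_display} {Omega : measurableType d}.
Variables (P : probability Omega R) (m : probability R R) (z : R).

Lemma integral_probability_cst (r : R) : (\int[m]_x r%:E = r%:E)%E.
Proof.
rewrite integral_cst// [X in (_ * X)%E](_ : _ = 1%E) ?mule1//.
exact: probability_setT.
Qed.

Lemma measurable_EFin_expRN {d' : measure_display} {T : measurableType d'} (D : set T)
    (f : T -> R) : measurable_fun D f -> measurable_fun D (fun x => (expR (- f x))%:E).
Proof.
move=> mf; apply/measurable_EFinP; apply: measurableT_comp => //.
exact: measurableT_comp.
Qed.

Lemma vertical_incr_shift (I : nat -> R) v y i : vertical_incr I v y i.+1 =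
  vertical_incr (fun i => I i.+1) (y 0%N + Num.max 0 (v - I 0%N)) (fun i => y i.+1) i.
Proof. by elim: i => [//|i IHi] /=; rewrite -IHi. Qed.

Lemma horizontal_incr_shift (I : nat -> R) v y i : horizontal_incr I v y i.+1 =
  horizontal_incr (fun i => I i.+1) (y 0%N + Num.max 0 (v - I 0%N)) (fun i => y i.+1) i.
Proof. by rewrite /horizontal_incr vertical_incr_shift. Qed.

Lemma measurable_vertical_incr (V : Omega -> R) (I X : nat -> Omega -> R) :
  measurable_fun setT V -> (forall i, measurable_fun setT (I i)) ->
  (forall i, measurable_fun setT (X i)) ->
  forall i, measurable_fun setT (fun w => vertical_incr (I^~ w) (V w) (X^~ w) i).
Proof.
move=> mV mI mX; elim=> [//|i IHi] /=; apply: measurable_funD => //.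
by apply: measurable_maxr => //; exact: measurable_funB.
Qed.

Lemma measurable_horizontal_incr (V : Omega -> R) (I X : nat -> Omega -> R) :
  measurable_fun setT V -> (forall i, measurable_fun setT (I i)) ->
  (forall i, measurable_fun setT (X i)) ->
  forall i, measurable_fun setT (fun w => horizontal_incr (I^~ w) (V w) (X^~ w) i).
Proof.
move=> mV mI mX i; apply: measurable_funD => //; apply: measurable_maxr => //.
by apply: measurable_funB => //; exact: measurable_vertical_incr.
Qed.

Lemma measurable_forall_lt (K : nat) (S : nat -> set Omega) :
  (forall i, measurable (S i)) -> measurable [set w | forall i, (i < K)%N -> S i w].
Proof.
move=> mS; rewrite [X in measurable X](_ : _ = \bigcap_(i in `I_K) S i).
  by apply: bigcap_measurableType => i _.
by apply/seteqP; split => w /= h i; exact: h.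
Qed.

(** Given the rate x of the row, drawn from [m], the incoming [I], [V], [X] are independent
    exponentials of rates z, x - z and x. The event [E] is the past; [C] and [q] record its weight,
    namely the factor of the other rows and the exponent of the outgoing increments already
    treated. *)
Definition row_law (C : \bar R) (q : R) (E : set Omega) (K : nat)
    (xi V : Omega -> R) (I X : nat -> Omega -> R) : Prop :=
  forall (A : set R) (v : R) (s t : nat -> R), measurable A -> 0 <= v ->
    (forall i, 0 <= s i) -> (forall i, 0 <= t i) ->
  P ([set w | [/\ A (xi w), v < V w &
              forall i, (i < K)%N -> s i < I i w /\ t i < X i w]] `&` E) =
  (C * \int[m]_(x in A) (expR (- (q + z * \sum_(i < K) s i + (x - z) * v +
                                  x * \sum_(i < K) t i)))%:E)%E.

(** The row is swept from left to right: [vertex_burke] applies with the event describing the rest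
    of the row as [F], the outgoing horizontal increment joins the past [E], and the outgoing
    vertical one becomes the new [V]. At the end nothing depends on x any more, so the rate of the
    row integrates out. *)
Lemma row_burke (K : nat) (C : \bar R) (q : R) (E : set Omega)
    (xi V : Omega -> R) (I X : nat -> Omega -> R) :
  measurable E -> measurable_fun setT xi -> measurable_fun setT V ->
  (forall i, measurable_fun setT (I i)) -> (forall i, measurable_fun setT (X i)) ->
  (forall w, E w -> 0 < V w) -> (forall w i, E w -> 0 < I i w) ->
  (forall w i, E w -> 0 < X i w) ->
  row_law C q E K xi V I X ->
  forall s, (forall i, 0 <= s i) ->
  P ([set w | forall i, (i < K)%N -> s i < horizontal_incr (I^~ w) (V w) (X^~ w) i] `&` E)
  = (C * (expR (- (q + z * \sum_(i < K) s i)))%:E)%E.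
Proof.
elim: K C q E V I X => [|K IHK] C q E V I X mE mxi mV mI mX V0 I0 X0 law s s0.
  have := law setT 0 (fun=> 0) (fun=> 0) measurableT (lexx _) (fun=> lexx _) (fun=> lexx _).
  rewrite !big_ord0 !mulr0 !addr0.
  under eq_integral do rewrite !mulr0 !addr0.
  rewrite integral_probability_cst => <-; congr (P _).
  by apply/seteqP; split => w /= [_ Ew]; split => //; split => //; exact: V0.
pose I0' w := X 0%N w + Num.max 0 (I 0%N w - V w).
pose V' w := X 0%N w + Num.max 0 (V w - I 0%N w).
have mI0' : measurable_fun setT I0'.
  by apply: measurable_funD => //; apply: measurable_maxr => //; exact: measurable_funB.
have mV' : measurable_fun setT V'.
  by apply: measurable_funD => //; apply: measurable_maxr => //; exact: measurable_funB.
pose E' := E `&` [set w | s 0%N < I0' w].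
have mE' : measurable E' by apply: measurableI => //; exact: measurable_fun_lt_set.
have law' : row_law C (q + z * s 0%N) E' K xi V' (fun i => I i.+1) (fun i => X i.+1).
  move=> A v s' t' mA v0 s'0 t'0.
  pose F := [set w | A (xi w) /\ forall i, (i < K)%N -> s' i < I i.+1 w /\ t' i < X i.+1 w] `&` E.
  have mF : measurable F.
    apply: measurableI => //; apply: measurableI; first exact: preimage_measurable.
    apply: (measurable_forall_lt K (fun i => [set w | s' i < I i.+1 w /\ t' i < X i.+1 w])) => i.
    by apply: measurableI; exact: measurable_fun_lt_set.
  pose cons a (u : nat -> R) i := if i is i'.+1 then u i' else a.
  have cons0 a u : 0 <= a -> (forall i, 0 <= u i) -> forall i, 0 <= cons a u i.
    by move=> ? ? [].
  have sumcons a u : \sum_(i < K.+1) cons a u i = a + \sum_(i < K) u i.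
    by rewrite big_ord_recl.
  have lawF a b e : 0 <= a -> 0 <= b -> 0 <= e ->
      P ([set w | [/\ a < I 0%N w, b < V w & e < X 0%N w]] `&` F) =
      (C * \int[m]_(x in A) (expR (- (q + z * (a + \sum_(i < K) s' i) + (x - z) * b +
                                  x * (e + \sum_(i < K) t' i))))%:E)%E.
    move=> a0 b0 e0; rewrite -!sumcons.
    rewrite -(law A b (cons a s') (cons e t') mA b0 (cons0 _ _ a0 s'0) (cons0 _ _ e0 t'0)).
    congr (P _); apply/seteqP; split => w /=.
      move=> [[h1 h2 h3] [[h4 h5] h6]]; split => //; split => //.
      by case=> [|i] /= iK; [split|exact: h5].
    move=> [[h1 h2 h3] h4]; have [h5 h6] := h3 0%N isT; split => //; split => //.
    by split => // i iK; exact: (h3 i.+1).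
  have posF w : F w -> [/\ 0 < I 0%N w, 0 < V w & 0 < X 0%N w].
    by move=> [_ Ew]; split; [exact: I0|exact: V0|exact: X0].
  have lawF2 a b : 0 <= a -> 0 <= b -> P ([set w | a < I 0%N w /\ b < V w] `&` F) =
      (C * \int[m]_(x in A) (expR (- (q + z * (a + \sum_(i < K) s' i) + (x - z) * b +
                                  x * (0 + \sum_(i < K) t' i))))%:E)%E.
    move=> a0 b0; rewrite -lawF//; congr (P _); apply/seteqP; split => w /=.
      by move=> [[h1 h2] h3]; split => //; split => //; have [] := posF _ h3.
    by move=> [[h1 h2 _] h3].
  have := vertex_burke P F (I 0%N) V (X 0%N) mF (mI _) mV (mX _) posF _ (s 0%N) v.
  rewrite lawF2// add0r.
  have -> : [set w | s 0%N < X 0%N w + Num.max 0 (I 0%N w - V w) /\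
                     v < X 0%N w + Num.max 0 (V w - I 0%N w)] `&` F =
    [set w | [/\ A (xi w), v < V' w & forall i, (i < K)%N ->
       s' i < I i.+1 w /\ t' i < X i.+1 w]] `&` E'.
    by apply/seteqP; split => w /= ; [move=> [[? ?] [[? ?] ?]]|move=> [[? ? ?] [? ?]]].
  move=> ->; last first.
    (* The memoryless identity z a + (x - z) b + x e = z (a + e) + (x - z) (b + e): the rate of the
       weight is the sum of the two incoming rates. *)
    move=> a b e a0 b0 e0; 
    rewrite (lawF _ _ _ a0 b0 e0) (lawF2 _ _ (addr_ge0 a0 e0) (addr_ge0 b0 e0)).
    by apply: (congr1 (mule C)); apply: eq_integral => x _; congr ((expR _)%:E); ring.
  apply: (congr1 (mule C)).
  by apply: eq_integral => x _; congr ((expR _)%:E); ring.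
have V'0 w : E' w -> 0 < V' w.
  by move=> [Ew _]; rewrite ltr_pwDl ?X0// le_max lexx.
have := IHK C _ E' V' _ _ mE' mxi mV' (fun i => mI i.+1) (fun i => mX i.+1) V'0
  (fun w i (h : E' w) => I0 w i.+1 h.1) (fun w i (h : E' w) => X0 w i.+1 h.1) law'
  (fun i => s i.+1) (fun i => s0 i.+1).
rewrite big_ord_recl /= mulrDr addrA => <-; congr (P _); apply/seteqP; split => w /=.
  move=> [h Ew]; split; last by split => //; exact: (h 0%N isT).
  by move=> i iK; have := h i.+1 iK; rewrite horizontal_incr_shift.
move=> [h [Ew h0]]; split => // -[_|i iK]; first exact: h0.
by rewrite horizontal_incr_shift; exact: h.
Qed.

Lemma measurable_row_incr (U V : nat -> Omega -> R) (Y : nat -> nat -> Omega -> R) :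
  (forall i, measurable_fun setT (U i)) -> (forall i, measurable_fun setT (V i)) ->
  (forall i j, measurable_fun setT (Y i j)) ->
  forall l i, measurable_fun setT
    (fun w => row_incr (U^~ w) (V^~ w) (fun i j => Y i j w) l i).
Proof.
move=> mU mV mY; elim=> [|l IHl] i //=.
exact: (measurable_horizontal_incr (V l)
  (fun i w => row_incr (U^~ w) (V^~ w) (fun i j => Y i j w) l i) (fun i => Y i l)).
Qed.

Lemma horizontal_incr_gt0 (I : nat -> R) v y i : (forall i, 0 < y i) ->
  0 < horizontal_incr I v y i.
Proof. by move=> y0; rewrite ltr_pwDl// le_max lexx. Qed.

Lemma row_incr_gt0 (U V : nat -> R) Y l i : (forall i, 0 < U i) ->
  (forall i j, 0 < Y i j) -> 0 < row_incr U V Y l i.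
Proof. by move=> U0 Y0; case: l => [|l] //=; exact: horizontal_incr_gt0. Qed.

(** Tail form of the stationary model on a K by L block: [U] exponential of rate z and,
    independently for each j, a rate x with law [m] together with [V j] of rate x - z and row
    weights of rate x. *)
Definition boundary_law (E : set Omega) (K L : nat) (xi : nat -> Omega -> R)
    (U V : nat -> Omega -> R) (Y : nat -> nat -> Omega -> R) : Prop :=
  forall (A : nat -> set R) (s v : nat -> R) (t : nat -> nat -> R),
    (forall j, measurable (A j)) -> (forall i, 0 <= s i) -> (forall j, 0 <= v j) ->
    (forall i j, 0 <= t i j) ->
  P ([set w | (forall i, (i < K)%N -> s i < U i w) /\
              forall j, (j < L)%N -> [/\ A j (xi j w), v j < V j w &
                forall i, (i < K)%N -> t i j < Y i j w]] `&` E) =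
  ((expR (- (z * \sum_(i < K) s i)))%:E *
   \prod_(j < L) \int[m]_(x in A j)
     (expR (- ((x - z) * v j + x * \sum_(i < K) t i j)))%:E)%E.

(** The induction has to carry a joint law: the increments of row [l] together with the boundary and
    bulk weights of all the rows above it, which feed the later steps. *)
Lemma row_incr_burke (K L : nat) (E : set Omega) (xi : nat -> Omega -> R)
    (U V : nat -> Omega -> R) (Y : nat -> nat -> Omega -> R) :
  measurable E -> (forall j, measurable_fun setT (xi j)) ->
  (forall i, measurable_fun setT (U i)) -> (forall i, measurable_fun setT (V i)) ->
  (forall i j, measurable_fun setT (Y i j)) ->
  (forall w i, E w -> 0 < U i w) -> (forall w j, E w -> 0 < V j w) ->
  (forall w i j, E w -> 0 < Y i j w) ->
  boundary_law E K L xi U V Y ->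
  forall l s, (l <= L)%N -> (forall i, 0 <= s i) ->
  P ([set w | forall i, (i < K)%N ->
       s i < row_incr (U^~ w) (V^~ w) (fun i j => Y i j w) l i] `&` E) =
  (expR (- (z * \sum_(i < K) s i)))%:E.
Proof.
move=> mE mxi mU mV mY U0 V0 Y0 law.
pose I l i w := row_incr (U^~ w) (V^~ w) (fun i j => Y i j w) l i.
have mI l i : measurable_fun setT (I l i) by exact: measurable_row_incr.
suff stage l : (l <= L)%N -> forall (A : nat -> set R) (s v : nat -> R) (t : nat -> nat -> R),
    (forall j, measurable (A j)) -> (forall i, 0 <= s i) -> (forall j, 0 <= v j) ->
    (forall i j, 0 <= t i j) ->
  P ([set w | (forall i, (i < K)%N -> s i < I l i w) /\
              forall j, (l <= j < L)%N -> [/\ A j (xi j w), v j < V j w &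
                forall i, (i < K)%N -> t i j < Y i j w]] `&` E) =
  ((expR (- (z * \sum_(i < K) s i)))%:E *
   \prod_(l <= j < L) \int[m]_(x in A j)
     (expR (- ((x - z) * v j + x * \sum_(i < K) t i j)))%:E)%E.
  move=> l s lL s0.
  have := stage l lL (fun=> setT) s (fun=> 0) (fun _ _ => 0)
    (fun=> measurableT) s0 (fun=> lexx _) (fun _ _ => lexx _).
  rewrite [X in (_ * X)%E]big1 ?mule1 => [<-|j _]; last first.
    under eq_integral do rewrite big1// !mulr0 addr0 oppr0 expR0.
    exact: integral_probability_cst.
  congr (P _); apply/seteqP; split => w /=.
    move=> [h Ew]; split => //; split => // j _.
    by split => // [|i _]; [exact: V0|exact: Y0].
  by move=> [[h _] Ew].
elim: l => [_|l IHl lL] A s v t mA s0 v0 t0.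
  by rewrite big_mkord -law.
pose E' := [set w | forall j, (l.+1 <= j < L)%N -> [/\ A j (xi j w), v j < V j w &
                forall i, (i < K)%N -> t i j < Y i j w]] `&` E.
have mE' : measurable E'.
  apply: measurableI => //; rewrite [X in measurable X](_ : _ =
    [set w | forall j, (j < L)%N -> ([set w | (l < j)%N -> [/\ A j (xi j w), v j < V j w &
                forall i, (i < K)%N -> t i j < Y i j w]]) w]); last first.
    by apply/seteqP; split => w /= h j; [move=> jL lj|move=> /andP[lj jL]];
      apply: h; rewrite ?jL ?lj.
  apply: (measurable_forall_lt L (fun j => [set w | (l < j)%N -> [/\ A j (xi j w), v j < V j w &
                forall i, (i < K)%N -> t i j < Y i j w]])) => j.
  have [lj|lj] := boolP (l < j)%N; last first.
    by rewrite [X in measurable X](_ : _ = setT)//; apply/seteqP; split.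
  rewrite [X in measurable X](_ : _ = xi j @^-1` (A j) `&` [set w | v j < V j w] `&`
     [set w | forall i, (i < K)%N -> [set w | t i j < Y i j w] w]); last first.
    by apply/seteqP; split => w /=; [move=> /(_ isT)[]|move=> [[]]].
  apply: measurableI; first apply: measurableI.
  - exact: preimage_measurable.
  - exact: measurable_fun_lt_set.
  - apply: (measurable_forall_lt K (fun i => [set w | t i j < Y i j w])) => i.
    exact: measurable_fun_lt_set.
(* For the sweep of row [l] the rows above it count as past: they enter through [E'], with the
   constant factor [C]. *)
set C := (\prod_(l.+1 <= j < L) _)%E.
have rl : row_law C 0 E' K (xi l) (V l) (I l) (fun i => Y i l).
  move=> B v' s' t' mB v'0 s'0 t'0.
  pose upd (T : Type) (f : nat -> T) x j := if j == l then x else f j.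
  have := IHl (ltnW lL) (upd _ A B) s' (upd _ v v') (fun i => upd _ (t i) (t' i)).
  rewrite big_ltn// /upd eqxx.
  have -> : (\prod_(l.+1 <= j < L) \int[m]_(x in (if j == l then B else A j))
     (expR (- ((x - z) * (if j == l then v' else v j) + x * \sum_(i < K)
        (if j == l then t' i else t i j))))%:E = C)%E.
    by apply: eq_big_nat => j /andP[lj _]; rewrite (gtn_eqF lj).
  have -> : [set w | (forall i, (i < K)%N -> s' i < I l i w) /\
      (forall j, (l <= j < L)%N -> [/\ (if j == l then B else A j) (xi j w),
        (if j == l then v' else v j) < V j w & forall i, (i < K)%N ->
        (if j == l then t' i else t i j) < Y i j w])] `&` E =
    [set w | [/\ B (xi l w), v' < V l w & forall i, (i < K)%N ->
       s' i < I l i w /\ t' i < Y i l w]] `&` E'.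
    apply/seteqP; split => w /=.
      move=> [[h1 h2] Ew]; have := h2 l; rewrite leqnn lL eqxx => /(_ isT)[h3 h4 h5].
      split; first by split => // i iK; split; [exact: h1|exact: h5].
      split => // j /andP[lj jL]; have := h2 j; rewrite (gtn_eqF lj) (ltnW lj) jL.
      exact.
    move=> [[h1 h2 h3] [h4 Ew]]; split => //; split => [i iK|j].
      by have [] := h3 i iK.
    rewrite leq_eqVlt => /andP[/predU1P[<- _|lj jL]].
      by rewrite eqxx; split => // i iK; have [] := h3 i iK.
    by rewrite (gtn_eqF lj); apply: h4; rewrite lj.
  move=> ->//; last 3 first.
  - by move=> j; case: ifP.
  - by move=> j; case: ifP.
  - by move=> i j; case: ifP.
  rewrite muleA muleC; congr (_ * _)%E; rewrite -ge0_integralZl//.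
  - by apply: eq_integral => x _; rewrite -EFinM -expRD; congr ((expR _)%:E); ring.
  - apply: measurable_EFin_expRN; apply: measurable_funD.
      by apply: measurable_funM => //; exact: measurable_funB.
    exact: measurable_funM.
have Vl0 w : E' w -> 0 < V l w by move=> [_ ?]; exact: V0.
have Il0 w i : E' w -> 0 < I l i w.
  by move=> [_ Ew]; apply: row_incr_gt0 => *; [exact: U0|exact: Y0].
have Yl0 w i : E' w -> 0 < Y i l w by move=> [_ ?]; exact: Y0.
have := row_burke K C 0 E' (xi l) (V l) (I l) (fun i => Y i l) mE' (mxi l) (mV l)
  (mI l) (mY^~ l) Vl0 Il0 Yl0 rl s s0.
rewrite add0r muleC => <-; congr (P _); apply/seteqP; split => w /=.
  by move=> [[h1 h2] Ew].
by move=> [h1 [h2 Ew]].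
Qed.

End RowBurke.

(** * Random thresholds and the joint law *)

Section Staircase.
Context {R : realType}.

(** Dyadic approximation from strictly above, so that {tau < X} is the increasing union of the
    events {staircase tau N < X}. *)
Definition staircase (tau : R -> R) (N : nat) (x : R) : R :=
  (truncn (2 ^+ N * tau x)).+1%:R / 2 ^+ N.

Lemma staircase_gt (tau : R -> R) N x : tau x < staircase tau N x.
Proof. by rewrite /staircase ltr_pdivlMr ?exprn_gt0// mulrC; exact: truncnS_gt. Qed.

Lemma staircase_le (tau : R -> R) N x : 0 <= tau x -> staircase tau N x <= tau x + (2 ^+ N)^-1.
Proof.
move=> t0; have N0 : 0 < 2 ^+ N :> R by rewrite exprn_gt0.
have /andP[h _] := truncn_itv (mulr_ge0 (ltW N0) t0).
rewrite /staircase ler_pdivrMr// mulrDl mulVf ?gt_eqF// -natr1 lerD2r.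
by rewrite [leRHS]mulrC.
Qed.

Lemma staircase_nonincreasing (tau : R -> R) x : 0 <= tau x ->
  nonincreasing_seq (fun N => staircase tau N x).
Proof.
move=> t0; apply/nonincreasing_seqP => N.
have N0 : 0 < 2 ^+ N :> R by rewrite exprn_gt0.
rewrite /staircase exprS invfM mulrA ler_wpM2r ?invr_ge0 ?(ltW N0)//.
rewrite ler_pdivrMr// -natrM ler_nat muln2 -mulrA.
set y := 2 ^+ N * tau x; have y0 : 0 <= y by rewrite mulr_ge0// ltW.
rewrite truncn_lt_nat ?mulr_ge0//.
by rewrite -muln2 natrM mulrC ltr_pM2r//; exact: truncnS_gt.
Qed.

Lemma staircase_cvg (tau : R -> R) x : 0 <= tau x ->
  (fun N => staircase tau N x) @ \oo --> tau x.
Proof.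
move=> t0; apply: (@squeeze_cvgr _ _ _ _ (fun=> tau x) (fun N => tau x + (2 ^+ N)^-1)).
- by near=> N; rewrite ltW ?staircase_gt//= staircase_le.
- exact: cvg_cst.
rewrite -[X in _ --> X]addr0; apply: cvgD; first exact: cvg_cst.
have -> : (fun N => (2 ^+ N)^-1) = (fun N => (2^-1 : R) ^+ N).
  by apply/funext => N; rewrite exprVn.
by apply: cvg_expr; rewrite ger0_norm ?invf_lt1// ltrDl.
Unshelve. all: by end_near. Qed.

Definition stair_level (tau : R -> R) (N k : nat) : set R :=
  tau @^-1` `[k%:R / 2 ^+ N, k.+1%:R / 2 ^+ N[%classic.

Lemma stair_levelP (tau : R -> R) N k x : 0 <= tau x ->
  stair_level tau N k x <-> truncn (2 ^+ N * tau x) = k.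
Proof.
move=> t0; have N0 : 0 < 2 ^+ N :> R by rewrite exprn_gt0.
rewrite /stair_level /= in_itv /= ler_pdivrMr// ltr_pdivlMr// mulrC.
rewrite -truncn_eq ?mulr_ge0// ?(ltW N0)//.
by split => [/eqP|->].
Qed.

Lemma measurable_stair_level (tau : R -> R) N k : measurable_fun setT tau ->
  measurable (stair_level tau N k).
Proof. by move=> mt; rewrite -[X in measurable X]setTI; exact: mt. Qed.

Lemma bigcup_stair_level (tau : R -> R) N : (forall x, 0 <= tau x) ->
  \bigcup_k stair_level tau N k = setT.
Proof.
move=> t0; rewrite -subTset => x _; exists (truncn (2 ^+ N * tau x)) => //.
exact/stair_levelP.
Qed.

Lemma stair_level_inj (tau : R -> R) N i j x : 0 <= tau x ->
  stair_level tau N i x -> stair_level tau N j x -> i = j.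
Proof. by move=> t0 /(stair_levelP _ _ _ _ t0) <- /(stair_levelP _ _ _ _ t0) <-. Qed.

Lemma measurable_staircase (tau : R -> R) (N : nat) : (forall x, 0 <= tau x) ->
  measurable_fun setT tau -> measurable_fun setT (staircase tau N).
Proof.
move=> t0 mt; rewrite -(bigcup_stair_level tau N t0).
apply/measurable_fun_bigcup => k; first exact: measurable_stair_level.
apply: (@eq_measurable_fun _ _ R R _ (fun=> k.+1%:R / 2 ^+ N)) => //.
by move=> x; rewrite inE => /stair_levelP -/(_ (t0 _)); rewrite /staircase => ->.
Qed.

End Staircase.

Section ThresholdUpgrade.
Context {R : realType} {d : measure_display} {Omega : measurableType d}.
Variables (P : probability Omega R) (m : probability R R).

(** On a level set of the staircase the threshold is constant and the given law applies; the levels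
    are summed, and monotone limits in N are taken on both sides. [sigma] holds the other thresholds
    of the same row, which may already depend on x, and [C] the factors of the other rows. *)
Lemma threshold_upgrade (E : set Omega) (xi X : Omega -> R) (A : set R) (C : R)
    (sigma tau : R -> R) :
  measurable E -> measurable_fun setT xi -> measurable_fun setT X -> measurable A ->
  (forall x, A x -> 0 <= x) -> 0 <= C -> measurable_fun setT sigma ->
  measurable_fun setT tau -> (forall x, 0 <= tau x) ->
  (forall B t, measurable B -> 0 <= t ->
    P ([set w | B (xi w) /\ t < X w] `&` E) =
    (C%:E * \int[m]_(x in A `&` B) (expR (- (x * (t + sigma x))))%:E)%E) ->
  P ([set w | tau (xi w) < X w] `&` E) =
  (C%:E * \int[m]_(x in A) (expR (- (x * (tau x + sigma x))))%:E)%E.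
Proof.
move=> mE mxi mX mA A0 C0 msigma mtau tau0 law.
pose st := staircase tau.
have mst N : measurable_fun setT (st N) by exact: measurable_staircase.
pose f N x := (expR (- (x * (st N x + sigma x))))%:E.
have mf N : measurable_fun setT (f N).
  by apply: measurable_EFin_expRN; apply: measurable_funM => //; exact: measurable_funD.
pose G N := [set w | st N (xi w) < X w] `&` E.
have mG N : measurable (G N).
  apply: measurableI => //; apply: measurable_fun_lt_set => //.
  exact: (measurableT_comp (mst N)).
have step N : P (G N) = (C%:E * \int[m]_(x in A) f N x)%E.
  pose Gk k := [set w | stair_level tau N k (xi w) /\ k.+1%:R / 2 ^+ N < X w] `&` E.
  have mGk k : measurable (Gk k).
    apply: measurableI => //; apply: measurableI; last exact: measurable_fun_lt_set.
    by apply: preimage_measurable => //; exact: measurable_stair_level.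
  have GE : G N = \bigcup_k Gk k.
    apply/seteqP; split => [w [/= h Ew]|w [k _ [[/= h1 h2] Ew]]].
      exists (truncn (2 ^+ N * tau (xi w))) => //; split => //; split => //=.
      exact/stair_levelP.
    split => //=; rewrite /st /staircase.
    by move/stair_levelP : h1 => -> //.
  have tGk : trivIset setT Gk.
    apply/trivIsetP => i j _ _ ij; apply/seteqP; split => // w [[[/= h1 _] _] [[h2 _] _]].
    by move: ij; rewrite (stair_level_inj _ _ _ _ _ (tau0 _) h1 h2) eqxx.
  rewrite GE measure_semi_bigcup//; last exact: bigcupT_measurable.
  have AE : A = \bigcup_k (A `&` stair_level tau N k).
    by rewrite -setI_bigcupr bigcup_stair_level// setIT.
  rewrite [in RHS]AE ge0_integral_bigcup.
  - rewrite -nneseriesZl; last first.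
      by move=> k _; apply: integral_ge0 => x _; rewrite lee_fin expR_ge0.
    apply: eq_eseriesr => k _.
    have t0 : 0 <= k.+1%:R / 2 ^+ N :> R by rewrite divr_ge0 ?exprn_ge0.
    rewrite [LHS](law _ _ (measurable_stair_level tau N k mtau) t0).
    congr (_ * _)%E; apply: eq_integral => x; rewrite inE => -[Ax /stair_levelP h].
    by rewrite /f /st /staircase h.
  - by move=> k; apply: measurableI => //; exact: measurable_stair_level.
  - exact: measurable_funTS.
  - by move=> x _; rewrite lee_fin expR_ge0.
  - apply/trivIsetP => i j _ _ ij; apply/seteqP; split => // x [[_ h1] [_ h2]].
    by move: ij; rewrite (stair_level_inj _ _ _ _ _ (tau0 _) h1 h2) eqxx.
have GU : [set w | tau (xi w) < X w] `&` E = \bigcup_N G N.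
  apply/seteqP; split => [w [/= h Ew]|w [n _ [/= h Ew]]]; last first.
    by split => //=; exact: (lt_trans (staircase_gt _ _ _) h).
  have /cvgrPdist_lt/(_ (X w - tau (xi w))) := staircase_cvg tau (xi w) (tau0 _).
  rewrite subr_gt0 => /(_ h)[n _ /(_ n (leqnn _))].
  rewrite ltr0_norm ?subr_lt0 ?staircase_gt// opprB ltrD2r => hn.
  by exists n.
have cvgP : (P (G N) @[N --> \oo] --> P ([set w | tau (xi w) < X w] `&` E)).
  rewrite GU; apply: nondecreasing_cvg_mu => //; first exact: bigcupT_measurable.
  move=> N N' NN'; apply/subsetPset => w [/= h Ew]; split => //=.
  by apply: le_lt_trans h; exact: staircase_nonincreasing.
have cvgI : ((C%:E * \int[m]_(x in A) f N x)%E @[N --> \oo] -->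
   (C%:E * \int[m]_(x in A) (expR (- (x * (tau x + sigma x))))%:E)%E).
  apply: cvgeZl => //.
  have -> : (\int[m]_(x in A) (expR (- (x * (tau x + sigma x))))%:E =
             \int[m]_(x in A) limn (f^~ x))%E.
    apply: eq_integral => x _; apply/esym/cvg_lim => //.
    have h : (fun N => - (x * (st N x + sigma x))) @ \oo --> - (x * (tau x + sigma x)).
      apply: cvgN; apply: cvgMr; apply: cvgD; [exact: staircase_cvg|exact: cvg_cst].
    apply: cvg_EFin; first by near=> n.
    exact: (continuous_cvg _ (@continuous_expR R _) h).
  apply: cvg_monotone_convergence => //.
  - by move=> N; exact: measurable_funTS.
  - by move=> N x _; rewrite lee_fin expR_ge0.
  - move=> x Ax N N' NN'; rewrite lee_fin ler_expR lerN2 ler_wpM2l ?A0// lerD2r.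
    exact: staircase_nonincreasing.
have stepE : (fun N => P (G N)) = (fun N => C%:E * \int[m]_(x in A) f N x)%E.
  by apply/funext.
rewrite stepE in cvgP; exact: (cvg_unique _ cvgP cvgI).
Unshelve. all: by end_near. Qed.

End ThresholdUpgrade.

Section JointLaw.
Context {R : realType} {d : measure_display} {Omega : measurableType d}.
Variables (P : probability Omega R) (m : probability R R).

Definition joint_law (xi : nat -> Omega -> R) (X : nat -> nat -> Omega -> R) : Prop :=
  forall (n : nat) (A : nat -> set R) (t : nat -> nat -> R),
      (forall j, measurable (A j)) -> (forall i j, 0 <= t i j) ->
      P [set w | forall j, (j < n)%N ->
                   A j (xi j w) /\ forall i, (i < n)%N -> t i j < X i j w] =
      (\prod_(j < n) \int[m]_(x in A j)
           (expR (- (x * \sum_(i < n) t i j)))%:E)%E.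

Lemma integral_expRN_le1 (A : set R) (g : R -> R) : measurable A ->
  measurable_fun setT g -> (forall x, A x -> 0 <= g x) ->
  (\int[m]_(x in A) (expR (- g x))%:E <= 1)%E.
Proof.
move=> mA mg g0; apply: (@le_trans _ _ (\int[m]_(x in A) (1%:E))%E).
  apply: ge0_le_integral => //.
  - by apply: measurable_EFin_expRN; exact: measurable_funTS.
  - by move=> x Ax; rewrite lee_fin -expR0 ler_expR oppr_le0 g0.
by rewrite integral_cst// mul1e probability_le1.
Qed.

(** The n by n thresholds are made random one at a time, in the order of the index j n + i. The
    induction on [q] treats families whose thresholds are still constant from index [q] on,
    expressed by [tau i j x = tau i j 0]. *)
Lemma joint_law_fun (xi : nat -> Omega -> R) (X : nat -> nat -> Omega -> R) :
  (forall j, measurable_fun setT (xi j)) ->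
  (forall i j, measurable_fun setT (X i j)) -> joint_law xi X ->
  forall (n : nat) (A : nat -> set R) (tau : nat -> nat -> R -> R),
    (forall j, measurable (A j)) -> (forall j x, A j x -> 0 <= x) ->
    (forall i j, measurable_fun setT (tau i j)) -> (forall i j x, 0 <= tau i j x) ->
    P [set w | forall j, (j < n)%N -> A j (xi j w) /\
         forall i, (i < n)%N -> tau i j (xi j w) < X i j w] =
      (\prod_(j < n) \int[m]_(x in A j)
           (expR (- (x * \sum_(i < n) tau i j x)))%:E)%E.
Proof.
move=> mxi mX law n A tau mA A0 mtau tau0.
suff main q : (q <= n * n)%N -> forall (A : nat -> set R) (tau : nat -> nat -> R -> R),
    (forall j, measurable (A j)) -> (forall j x, A j x -> 0 <= x) ->
    (forall i j, measurable_fun setT (tau i j)) -> (forall i j x, 0 <= tau i j x) ->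
    (forall i j x, (i < n)%N -> (j < n)%N -> (q <= j * n + i)%N ->
       tau i j x = tau i j 0) ->
    P [set w | forall j, (j < n)%N -> A j (xi j w) /\
         forall i, (i < n)%N -> tau i j (xi j w) < X i j w] =
      (\prod_(j < n) \int[m]_(x in A j)
           (expR (- (x * \sum_(i < n) tau i j x)))%:E)%E.
  apply: (main (n * n)%N) => // i j x iN jN.
  rewrite leqNgt (@leq_trans (j.+1 * n))//; first by rewrite mulSn addnC ltn_add2r.
  by rewrite leq_mul2r jN orbT.
elim: q => [_|q IHq qn] {mA A0 mtau tau0 A tau} A tau mA A0 mtau tau0 cst.
  transitivity (P [set w | forall j, (j < n)%N ->
                   A j (xi j w) /\ forall i, (i < n)%N -> tau i j 0 < X i j w]).
    congr (P _); apply/seteqP; split => w /= h j jn; have [h1 h2] := h j jn;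
      by split => // i iN; have := h2 i iN; rewrite cst.
  rewrite (law n A (fun i j => tau i j 0))//; apply: eq_bigr => j _.
  apply: eq_integral => x _; congr ((expR (- (_ * _)))%:E).
  by apply: eq_bigr => i _; rewrite [RHS]cst.
have n0 : (0 < n)%N by case: n qn {IHq cst}.
have j0n : (q %/ n < n)%N by rewrite ltn_divLR.
have i0n : (q %% n < n)%N by rewrite ltn_mod.
set j0 := (q %/ n)%N in j0n; set i0 := (q %% n)%N in i0n.
have qE : q = (j0 * n + i0)%N by exact: divn_eq.
(* Everything except the threshold of the cell (i0, j0), which is upgraded now. *)
pose E := [set w | forall j, (j < n)%N -> A j (xi j w) /\
  forall i, (i < n)%N -> (i != i0) || (j != j0) -> tau i j (xi j w) < X i j w].
have mtx i j : measurable_fun setT (fun w => tau i j (xi j w)).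
  exact: (measurableT_comp (mtau i j)).
have mE : measurable E.
  apply: (measurable_forall_lt n (fun j => [set w | A j (xi j w) /\
    forall i, (i < n)%N -> (i != i0) || (j != j0) -> tau i j (xi j w) < X i j w])) => j.
  apply: measurableI; first exact: preimage_measurable.
  apply: (measurable_forall_lt n (fun i => [set w | (i != i0) || (j != j0) ->
     tau i j (xi j w) < X i j w])) => i.
  case: (_ || _); last first.
    by rewrite [X in measurable X](_ : _ = setT)//; apply/seteqP; split.
  rewrite [X in measurable X](_ : _ = [set w | tau i j (xi j w) < X i j w]).
    exact: measurable_fun_lt_set.
  by apply/seteqP; split => w /=; [apply|].
pose sigma x := \sum_(i < n | i != Ordinal i0n) tau i j0 x.
have msigma : measurable_fun setT sigma.
  rewrite /sigma; under eq_fun do rewrite big_mkcond.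
  by apply: measurable_sum => i; case: (i != Ordinal i0n).
pose C := (\prod_(j < n | j != Ordinal j0n) \int[m]_(x in A j)
           (expR (- (x * \sum_(i < n) tau i j x)))%:E)%E.
have Cge0 : (0 <= C)%E.
  by apply: prode_ge0 => j _; apply: integral_ge0 => x _; rewrite lee_fin expR_ge0.
have Cfin : C \is a fin_num.
  apply: prode_fin_num => j _; rewrite ge0_fin_numE; last first.
    by apply: integral_ge0 => x _; rewrite lee_fin expR_ge0.
  apply: (@le_lt_trans _ _ 1%E); last exact: ltry.
  apply: integral_expRN_le1 => //; first by apply: measurable_funM => //; exact: measurable_sum.
  by move=> x Ax; rewrite mulr_ge0 ?(A0 _ _ Ax) ?sumr_ge0.
have lawE B t : measurable B -> 0 <= t ->
    P ([set w | B (xi j0 w) /\ t < X i0 j0 w] `&` E) =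
    ((fine C)%:E * \int[m]_(x in A j0 `&` B) (expR (- (x * (t + sigma x))))%:E)%E.
  move=> mB t0.
  (* An extra event on the rate of row [j0] and a constant threshold in the cell (i0, j0) keep the
     family within the reach of the induction hypothesis. *)
  pose A' j := if j == j0 then A j0 `&` B else A j.
  pose tau' i j := if (i == i0) && (j == j0) then (fun=> t) else tau i j.
  have := IHq (ltnW qn) A' tau'.
  have -> : [set w | forall j, (j < n)%N -> A' j (xi j w) /\
         forall i, (i < n)%N -> tau' i j (xi j w) < X i j w] =
     [set w | B (xi j0 w) /\ t < X i0 j0 w] `&` E.
    apply/seteqP; split => w /=.
      move=> h; have := h j0 j0n; rewrite /A' /tau' eqxx => -[[h1 h2] /(_ i0 i0n)].
      rewrite eqxx /= => h3; split => // j jn; have := h j jn; rewrite /A' /tau'.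
      have [->|jj0] := eqVneq j j0.
        move=> [_ h5]; split => // i iN; rewrite orbF => ii0.
        by have := h5 i iN; rewrite (negbTE ii0).
      by move=> [h4 h5]; split => // i iN _; have := h5 i iN; rewrite andbF.
    move=> [[h1 h2] h] j jn; have [h3 h4] := h j jn; rewrite /A' /tau'; split.
      by case: eqP => // jj0; rewrite -jj0; split => //; rewrite jj0.
    move=> i iN; have := h4 i iN.
    by case: (eqVneq i i0) => [->|_] /=; case: (eqVneq j j0) => [->|_] //=; exact.
  move=> ->.
  - rewrite (bigD1 (Ordinal j0n))//= muleC; congr (_ * _)%E.
      rewrite fineK//; apply: eq_bigr => j; rewrite -val_eqE /= => jj0.
      rewrite /A' (negbTE jj0); apply: eq_integral => x _.
      congr ((expR (- (_ * _)))%:E); apply: eq_bigr => i _.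
      by rewrite /tau' (negbTE jj0) andbF.
    rewrite /A' eqxx; apply: eq_integral => x _; congr ((expR (- (_ * _)))%:E).
    rewrite (bigD1 (Ordinal i0n))//= /tau' !eqxx /=; congr (_ + _).
    by apply: eq_bigr => i; rewrite -val_eqE /= => ii0; rewrite (negbTE ii0).
  - by move=> j; rewrite /A'; case: ifP => // _; exact: measurableI.
  - by move=> j x; rewrite /A'; case: ifP => [_ [Ax _]|_ Ax]; exact: A0 Ax.
  - by move=> i j; rewrite /tau'; case: ifP.
  - by move=> i j x; rewrite /tau'; case: ifP.
  - move=> i j x iN jn; rewrite /tau' leq_eqVlt => /predU1P[qij|]; last first.
      by case: ifP => // _; exact: cst.
    have -> : i = i0 by rewrite /i0 qij modnMDl modn_small.
    have -> : j = j0 by rewrite /j0 qij divnMDl// divn_small// addn0.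
    by rewrite !eqxx.
have sC0 : 0 <= fine C by rewrite fine_ge0.
have := threshold_upgrade P m E (xi j0) (X i0 j0) (A j0) (fine C) sigma (tau i0 j0)
  mE (mxi _) (mX _ _) (mA _) (A0 _) sC0 msigma (mtau _ _) (tau0 _ _) lawE.
rewrite fineK// => h; rewrite (bigD1 (Ordinal j0n))//= muleC.
rewrite [X in (_ * X)%E](_ : _ = \int[m]_(x in A j0) (expR (- (x * (tau i0 j0 x + sigma x))))%:E)%E; last first.
  apply: eq_integral => x _; congr ((expR (- (_ * _)))%:E).
  by rewrite (bigD1 (Ordinal i0n)).
rewrite -[RHS]h; congr (P _); apply/seteqP; split => w /=.
  move=> hw; have [h1 h2] := hw j0 j0n; split; first exact: h2.
  by move=> j jn; have [h3 h4] := hw j jn; split => // i iN _; exact: h4.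
move=> [h1 h2] j jn; have [h3 h4] := h2 j jn; split => // i iN.
have := h4 i iN.
by case: (eqVneq i i0) => [->|_] /=; case: (eqVneq j j0) => [->|_] //=; exact.
Qed.

End JointLaw.

Lemma measurable_funV {R : realType} {d : measure_display} {T : measurableType d}
    (D : set T) (f : T -> R) : measurable_fun D f -> measurable_fun D (fun x => (f x)^-1).
Proof.
move=> mf; suff mV : measurable_fun setT (fun x : R => x^-1) by exact: measurableT_comp.
(* This expression agrees with the inverse also at 0, where the inverse is 0 by convention, and
   reduces the claim to real powers. *)
apply: (@eq_measurable_fun _ _ R R _ (fun x => x * (x ^+ 2) `^ (-1))).
  move=> x _; rewrite powR_inv1 ?sqr_ge0// expr2.
  by have [->|x0] := eqVneq x 0; rewrite ?mul0r ?invr0// invfM mulrA mulfV// mul1r.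
apply: measurable_funM => //; apply: (measurableT_comp (measurable_powR _)).
exact: measurable_funX.
Qed.

(** * The boundary weights on the given probability space *)

Section Environment.
Context {R : realType} {d : measure_display} {Omega : measurableType d}.
Variables (P : probability Omega R) (m : probability R R).
Variables (xi : nat -> Omega -> R) (X : nat -> nat -> Omega -> R) (c : R).
Hypothesis mxi : forall j, measurable_fun setT (xi j).
Hypothesis mX : forall i j, measurable_fun setT (X i j).
Hypothesis law : joint_law P m xi X.
Hypothesis c_gt0 : 0 < c.
Hypothesis m_supp : m (~` `[c, +oo[%classic) = 0%E.

Lemma integral_supp (A : set R) (f : R -> \bar R) : measurable A ->
  measurable_fun A f -> (forall x, A x -> 0 <= f x)%E ->
  (\int[m]_(x in A) f x = \int[m]_(x in A `&` `[c, +oo[) f x)%E.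
Proof.
move=> mA mf f0; rewrite (ge0_negligible_integral _ mA mf f0 m_supp).
  by congr (integral _ _ _); rewrite setDE setCK.
exact: measurableC.
Qed.

Lemma m_supp1 : m `[c, +oo[%classic = 1%E.
Proof.
have := @integral_supp setT (cst 1%E) measurableT.
rewrite setTI !integral_cst// !mul1e => <-//.
exact: probability_setT.
Qed.

(** A single almost sure event for all pathwise comparisons, so that no null set depends on n or
    z. *)
Definition typical : set Omega := [set w | forall i j, 0 < X i j w /\ c <= xi j w].

Let typical_upto (n : nat) := [set w | forall j, (j < n)%N ->
   `[c, +oo[%classic (xi j w) /\ forall i, (i < n)%N -> 0 < X i j w].

Let typicalE : typical = \bigcap_n typical_upto n.
Proof.
apply/seteqP; split => w /= h.
  move=> n _ j jn; split; last by move=> i _; have [] := h i j.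
  by rewrite /= in_itv /= andbT; have [] := h 0%N j.
move=> i j; have /(_ j) := h (maxn i j).+1 I; rewrite ltnS leq_maxr => /(_ isT)[].
rewrite /= in_itv /= andbT => -> /(_ i); rewrite ltnS leq_maxl => /(_ isT).
by [].
Qed.

Let measurable_typical_upto n : measurable (typical_upto n).
Proof.
apply: (measurable_forall_lt n (fun j => [set w | `[c, +oo[%classic (xi j w) /\
   forall i, (i < n)%N -> 0 < X i j w])) => j.
apply: measurableI; first exact: preimage_measurable.
apply: (measurable_forall_lt n (fun i => [set w | 0 < X i j w])) => i.
exact: measurable_fun_lt_set.
Qed.

Lemma measurable_typical : measurable typical.
Proof. by rewrite typicalE; exact: bigcapT_measurable. Qed.

Lemma probability_typical : P typical = 1%E.
Proof.
have Pn n : P (typical_upto n) = 1%E.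
  rewrite (law n (fun=> `[c, +oo[%classic) (fun _ _ => 0))// big1// => j _.
  under eq_integral do rewrite big1// mulr0 oppr0 expR0.
  by rewrite integral_cst// mul1e; exact: m_supp1.
have h : P (typical_upto n) @[n --> \oo] --> P typical.
  rewrite typicalE; apply: nonincreasing_cvg_mu => //.
  - by rewrite [ltLHS]Pn ltry.
  - exact: bigcapT_measurable.
  - move=> n n' nn'; apply/subsetPset => w hw j jn.
    have [h1 h2] := hw j (leq_trans jn nn'); split => // i iN.
    exact: h2 (leq_trans iN nn').
have E : (fun n => P (typical_upto n)) = (fun=> 1%E) by apply/funext.
by rewrite E in h; rewrite -(cvg_unique _ h (cvg_cst 1%E)).
Qed.

Lemma probability_setI_typical (S : set Omega) : measurable S -> P (S `&` typical) = P S.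
Proof.
move=> mS; have mt := measurable_typical.
rewrite [in RHS](_ : S = (S `&` typical) `|` (S `&` ~` typical)); last first.
  by rewrite -setIUr setUv setIT.
have mC : measurable (S `&` ~` typical) by apply: measurableI => //; exact: measurableC.
rewrite measureU//; [|exact: measurableI|by rewrite setIACA setICr setI0].
rewrite [X in (_ + X)%E](_ : _ = 0%E) ?adde0//.
apply/eqP; rewrite eq_le measure_ge0 andbT.
apply: (@le_trans _ _ (P (~` typical))); first by apply: le_measure; rewrite ?inE//; exact: measurableC.
by rewrite probability_setC// probability_typical subee.
Qed.

Definition xi_bulk (j : nat) : Omega -> R := xi j.+1.
Definition X_bulk (i j : nat) : Omega -> R := X i.+1 j.+1.
(** Multiplying an exponential of rate xi by xi / z gives rate z, so the law of the bottom row
    forgets its own rate; [V_bd] likewise turns the left edge into rate xi - z. For 0 < z < c both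
    factors exceed 1, hence the domination; [U_bd] decreases in z and [V_bd] increases. *)
Definition U_bd (z : R) (i : nat) (w : Omega) : R := xi 0%N w * X i.+1 0%N w / z.
Definition V_bd (z : R) (j : nat) (w : Omega) : R :=
  xi j.+1 w * X 0%N j.+1 w / (xi j.+1 w - z).

Lemma measurable_U_bd z i : measurable_fun setT (U_bd z i).
Proof. by apply: measurable_funM => //; exact: measurable_funM. Qed.

Lemma measurable_V_bd z j : measurable_fun setT (V_bd z j).
Proof.
apply: measurable_funM; first exact: measurable_funM.
by apply: measurable_funV; exact: measurable_funB.
Qed.

Lemma U_bd_gt0 z i w : 0 < z -> typical w -> 0 < U_bd z i w.
Proof.
move=> z0 Tw; have [x0 xc] := Tw i.+1 0%N.
by rewrite /U_bd divr_gt0// mulr_gt0// (lt_le_trans c_gt0).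
Qed.

Lemma V_bd_gt0 z i w : z < c -> typical w -> 0 < V_bd z i w.
Proof.
move=> zc Tw; have [x0 xc] := Tw 0%N i.+1.
by rewrite /V_bd divr_gt0 ?mulr_gt0 ?subr_gt0 ?(lt_le_trans zc)// (lt_le_trans c_gt0).
Qed.

(** The event s < xi X / z is z s / xi < X, with a threshold depending on the rate, so
    [joint_law_fun] yields the law. The block has [N.+1] rows and columns because the axes are
    included. *)
Lemma boundary_law_typical (N : nat) (z : R) : 0 < z < c ->
  boundary_law P m z typical N N xi_bulk (U_bd z) (V_bd z) X_bulk.
Proof.
move=> /andP[z0 zc] A s v t mA s0 v0 t0.
pose A' j := (if j is j'.+1 then A j' else setT) `&` `[c, +oo[%classic.
(* Index 0 is an axis. The absolute values make the thresholds nonnegative for every x, and change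
   nothing for x >= c. *)
pose tau i j x : R := match i, j with
  | 0%N, 0%N => 0 | i'.+1, 0%N => `|z * s i' / x|
  | 0%N, j'.+1 => `|v j' * (x - z) / x| | i'.+1, j'.+1 => t i' j' end.
have mA' j : measurable (A' j) by apply: measurableI => //; case: j => [|j] //.
have A'0 j x : A' j x -> 0 <= x.
  by move=> [_]; rewrite /= in_itv /= andbT => /(le_trans (ltW c_gt0)).
have mtau i j : measurable_fun setT (tau i j).
  have mn (f : R -> R) : measurable_fun setT f -> measurable_fun setT (fun x => `|f x / x|).
    move=> mf; apply: measurableT_comp => //; apply: measurable_funM => //.
    exact: measurable_funV.
  case: i j => [|i] [|j] /=.
  - exact: measurable_cst.
  - by apply: mn; apply: measurable_funM => //; exact: measurable_funB.
  - exact: mn.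
  - exact: measurable_cst.
have tau0 i j x : 0 <= tau i j x by case: i j => [|i] [|j] //=.
have := joint_law_fun P m xi X mxi mX law N.+1 A' tau mA' A'0 mtau tau0.
set S1 := [set w | _].
have -> : [set w | (forall i, (i < N)%N -> s i < U_bd z i w) /\
    (forall j, (j < N)%N -> [/\ A j (xi_bulk j w), v j < V_bd z j w &
      forall i, (i < N)%N -> t i j < X_bulk i j w])] `&` typical = S1 `&` typical.
  have Ui i w : typical w -> (s i < U_bd z i w) = (tau i.+1 0%N (xi 0%N w) < X i.+1 0%N w).
    move=> Tw; have [x0 xc] := Tw i.+1 0%N.
    have x0' : 0 < xi 0%N w by exact: lt_le_trans xc.
    rewrite /U_bd /= ger0_norm; last by rewrite divr_ge0 ?mulr_ge0// ltW.
    by rewrite ltr_pdivlMr// ltr_pdivrMr// mulrC (mulrC (xi _ _)).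
  have Vj j w : typical w -> (v j < V_bd z j w) = (tau 0%N j.+1 (xi j.+1 w) < X 0%N j.+1 w).
    move=> Tw; have [x0 xc] := Tw 0%N j.+1.
    have x0' : 0 < xi j.+1 w by exact: lt_le_trans xc.
    have xz : 0 < xi j.+1 w - z by rewrite subr_gt0 (lt_le_trans zc).
    rewrite /V_bd /= ger0_norm; last by rewrite divr_ge0 ?mulr_ge0// ltW.
    by rewrite ltr_pdivlMr// ltr_pdivrMr// (mulrC (xi _ _)).
  have inC j w : typical w -> (`[c, +oo[%classic (xi j w)).
    by move=> Tw; have [_ ?] := Tw 0%N j; rewrite /= in_itv /= andbT.
  apply/seteqP; split => w /= [h Tw]; split => //.
    case: h => h1 h2 [_|j jN].
      split; first by split => //; exact: inC.
      case=> [_|i iN]; first by have [] := Tw 0%N 0%N.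
      by have := h1 i iN; rewrite Ui.
    have [h3 h4 h5] := h2 j jN; split; first by split => //; exact: inC.
    by case=> [_|i iN]; [rewrite -Vj|exact: h5].
  split=> [i iN|j jN].
    by have [_ h2] := h 0%N isT; rewrite Ui//; exact: h2.
  have [[h1 _] h2] := h j.+1 jN; split => //.
    by rewrite Vj//; exact: (h2 0%N).
  by move=> i iN; exact: (h2 i.+1).
move=> h; rewrite probability_setI_typical; last first.
  apply: (measurable_forall_lt N.+1 (fun j => [set w | A' j (xi j w) /\
    forall i, (i < N.+1)%N -> tau i j (xi j w) < X i j w])) => j.
  apply: measurableI; first exact: preimage_measurable.
  apply: (measurable_forall_lt N.+1 (fun i => [set w | tau i j (xi j w) < X i j w])) => i.
  by apply: measurable_fun_lt_set => //; exact: (measurableT_comp (mtau i j)).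
rewrite h big_ord_recl; congr (_ * _)%E.
  rewrite -[RHS](integral_probability_cst m) [RHS]integral_supp//.
  apply: eq_integral => x; rewrite inE => -[_]; rewrite /= in_itv /= andbT => cx.
  have x0 : 0 < x by exact: lt_le_trans cx.
  congr ((expR (- _))%:E); rewrite big_ord_recl /= add0r !mulr_sumr.
  apply: eq_bigr => i _; rewrite /bump /= ger0_norm; last by rewrite divr_ge0 ?mulr_ge0// ltW.
  by rewrite mulrC divfK// gt_eqF.
apply: eq_bigr => j _; rewrite [RHS]integral_supp//; last first.
  apply: measurable_EFin_expRN; apply: measurable_funTS; apply: measurable_funD.
    by apply: measurable_funM => //; exact: measurable_funB.
  exact: measurable_funM.
apply: eq_integral => x; rewrite inE => -[_]; rewrite /= in_itv /= andbT => cx.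
have x0 : 0 < x by exact: lt_le_trans cx.
congr ((expR (- _))%:E); rewrite big_ord_recl /= mulrDr; congr (_ + _).
rewrite ger0_norm; last by rewrite divr_ge0 ?mulr_ge0 ?subr_ge0 ?(ltW (lt_le_trans zc _))// ltW.
by rewrite mulrC divfK ?gt_eqF// mulrC.
Qed.

End Environment.

(** * Weak laws of large numbers *)

Section LayerCake.
Context {R : realType} {d : measure_display} {T : measurableType d}.
Variable mu : {sigma_finite_measure set T -> \bar R}.
Local Open Scope ereal_scope.

(** Tonelli's theorem on the region 0 <= b < g x. Measurability in b is returned as well, because
    the result is integrated again in iterated tails. *)
Lemma layer_cake (D : set T) (F : T -> \bar R) (g : T -> R) : measurable D ->
  measurable_fun setT F -> (forall x, D x -> 0 <= F x) -> measurable_fun setT g ->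
  (forall x, D x -> 0 <= g x)%R ->
  \int[mu]_(x in D) (F x * (g x)%:E) =
    \int[lebesgue_measure]_(b in `[0%R, +oo[) \int[mu]_(x in D `&` [set x | (b < g x)%R]) F x /\
  measurable_fun setT (fun b : R => (fun b => \int[mu]_(x in D `&` [set x | (b < g x)%R]) F x)
     \_ `[0%R, +oo[%classic b).
Proof.
move=> mD mF F0 mg g0.
pose S : set (T * R) := [set p | D p.1 /\ (0 <= p.2 < g p.1)%R].
have mS : measurable S.
  rewrite [X in measurable X](_ : _ = fst @^-1` D `&` (snd @^-1` `[0%R, +oo[%classic `&`
     [set p : T * R | (p.2 < g p.1)%R])); last first.
    apply/seteqP; split => p; rewrite /S /= in_itv /= andbT.
      by move=> [Dp /andP[]].
    by move=> [Dp [p0 pg]]; split => //; apply/andP.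
  apply: measurableI; last apply: measurableI.
  - exact: (preimage_measurable measurable_fst).
  - exact: (preimage_measurable measurable_snd).
  - by apply: measurable_fun_lt_set => //; exact: measurableT_comp.
pose Phi (p : T * R) := F p.1 * (\1_S p)%:E.
have Phi0 p : 0 <= Phi p.
  rewrite /Phi indicE; case: (boolP (p \in S)) => [|_]; rewrite ?mule0//.
  by rewrite inE => -[/F0 ? _]; rewrite mule1.
have mPhi : measurable_fun setT Phi.
  apply: emeasurable_funM; first exact: measurableT_comp.
  by apply/measurable_EFinP; exact: measurable_indic.
have inner b : \int[mu]_x Phi (x, b) =
    ((fun b => \int[mu]_(x in D `&` [set x | (b < g x)%R]) F x) \_ `[0%R, +oo[%classic) b.
  rewrite patchE; case: ifPn; rewrite ?inE /= ?notin_setE /= in_itv /= andbT => b0.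
    rewrite [RHS]integral_mkcond; apply: eq_integral => x _.
    rewrite /Phi patchE indicE; case: ifPn; rewrite ?inE ?notin_setE /=.
      by move=> [Dx bg]; rewrite mem_set ?mule1//; split => //=; rewrite b0.
    by move=> h; rewrite memNset ?mule0//; move=> [Dx /andP[_ ?]]; apply: h.
  apply: integral0_eq => x _; rewrite /Phi indicE memNset ?mule0//.
  by move=> [_ /andP[]].
split; last first.
  have := @measurable_fun_fubini_tonelli_G _ _ T R R mu Phi mPhi Phi0.
  by apply: eq_measurable_fun => b _; rewrite /fubini_G inner.
rewrite [RHS]integral_mkcond.
under [RHS]eq_integral do rewrite -inner.
rewrite -(@fubini_tonelli _ _ T (measurableTypeR R) R mu lebesgue_measure Phi mPhi Phi0) integral_mkcond.
apply: eq_integral => x _; rewrite patchE /Phi; case: ifPn.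
  rewrite inE => Dx.
  transitivity (\int[lebesgue_measure]_b (F x * (fun b => (\1_S (x, b))%:E) b)); last by [].
  rewrite ge0_integralZl ?F0//.
  - congr (_ * _).
    rewrite (_ : (fun b => (\1_S (x, b))%:E) = (fun b => (\1_`[0%R, g x[%classic b)%:E)).
      rewrite integral_indic// setIT [RHS]lebesgue_measure_itv /= lte_fin.
      case: ltP => [_|gx0]; first by rewrite oppr0 adde0.
      by congr EFin; apply/eqP; rewrite eq_le gx0 g0.
    apply/funext => b; rewrite !indicE; congr (_%:R%:E); congr nat_of_bool.
    apply/idP/idP; rewrite !inE /= in_itv /=; first by case.
    by move=> h; split.
  - apply/measurable_EFinP.
    have h : measurable_fun setT (\1_S : T * R -> R) by exact: measurable_indic.
    by apply: (measurableT_comp h); exact: measurable_fun_pair.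
rewrite notin_setE => Dx; apply/esym/integral0_eq => b _.
by rewrite indicE memNset ?mule0//; case.
Qed.

End LayerCake.

Lemma integral_expRN_0y {R : realType} (gamma : R) : 0 < gamma ->
  (\int[lebesgue_measure]_(a in `[0%R, +oo[) (expR (- (gamma * a)))%:E = (gamma^-1)%:E)%E.
Proof.
move=> g0; have := @integral_exponential_pdf R gamma g0.
have -> : (\int[lebesgue_measure]_x (exponential_pdf gamma x)%:E =
   \int[lebesgue_measure]_(x in `[0%R, +oo[) (gamma%:E * (expR (- (gamma * x)))%:E))%E.
  rewrite [RHS]integral_mkcond; apply: eq_integral => x _.
  rewrite patchE /exponential_pdf patchE; case: ifP => // _.
  by rewrite -EFinM -mulNr.
rewrite ge0_integralZl//; last 2 first.
- apply: measurable_EFin_expRN; apply: measurable_funTS; exact: measurable_funM.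
- by rewrite lee_fin ltW.
set J := (integral _ _ _) => h.
have Jfin : J \is a fin_num.
  rewrite ge0_fin_numE; last by apply: integral_ge0 => x _; rewrite lee_fin expR_ge0.
  by rewrite ltey; apply/eqP => Joo; move: h; rewrite Joo gt0_muley ?lte_fin.
rewrite -(fineK Jfin); move: h; rewrite -{1}(fineK Jfin).
rewrite -EFinM => -[h]; congr EFin.
by rewrite -[RHS]mulr1 -h mulrA mulVf ?gt_eqF// mul1r.
Qed.

Section Moments.
Context {R : realType} {d : measure_display} {Omega : measurableType d}.
Variable P : probability Omega R.
Local Open Scope ereal_scope.
Local Notation leb := (@lebesgue_measure R).

Lemma integral_tail (E : set Omega) (f : Omega -> R) : measurable E -> measurable_fun setT f ->
  (forall w, E w -> 0 <= f w)%R ->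
  \int[P]_(w in E) (f w)%:E =
    \int[leb]_(a in `[0%R, +oo[) P ([set w | (a < f w)%R] `&` E) /\
  measurable_fun (`[0%R, +oo[%classic : set R) (fun a : R => P ([set w | (a < f w)%R] `&` E)).
Proof.
move=> mE mf f0.
have [] := @layer_cake R _ Omega P E (cst 1) f mE _ _ mf f0 => //.
under eq_integral do rewrite mul1e.
have e b : \int[P]_(x in E `&` [set x | (b < f x)%R]) cst 1 x =
    P ([set w | (b < f w)%R] `&` E).
  rewrite integral_cst; last by apply: measurableI => //; exact: measurable_fun_lt_set.
  by rewrite mul1e setIC.
move=> -> h; split; first by apply: eq_integral => b _; rewrite e.
have := (measurable_restrictT _ _).2 h.
by move=> /(_ (measurable_itv _)); apply: eq_measurable_fun => b _; rewrite e.
Qed.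

Variable E : set Omega.
Hypothesis mE : measurable E.

Lemma integral_mul_tail (f g : Omega -> R) : measurable_fun setT f ->
  measurable_fun setT g -> (forall w, E w -> 0 <= f w)%R -> (forall w, E w -> 0 <= g w)%R ->
  \int[P]_(w in E) (f w * g w)%:E =
    \int[leb]_(b in `[0%R, +oo[) \int[leb]_(a in `[0%R, +oo[)
      P ([set w | (a < f w)%R /\ (b < g w)%R] `&` E) /\
  measurable_fun (`[0%R, +oo[%classic : set R) (fun b : R =>
    \int[leb]_(a in `[0%R, +oo[) P ([set w | (a < f w)%R /\ (b < g w)%R] `&` E)).
Proof.
move=> mf mg f0 g0.
have mEf : measurable_fun setT (fun w => (f w)%:E) by exact/measurable_EFinP.
have Ef0 w : E w -> 0 <= (f w)%:E by move=> Ew; rewrite lee_fin f0.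
have [] := @layer_cake R _ Omega P E (fun w => (f w)%:E) g mE mEf Ef0 mg g0.
have e b : \int[P]_(x in E `&` [set x | (b < g x)%R]) (f x)%:E =
    \int[leb]_(a in `[0%R, +oo[) P ([set w | (a < f w)%R /\ (b < g w)%R] `&` E).
  have mEg : measurable (E `&` [set x | (b < g x)%R]).
    by apply: measurableI => //; exact: measurable_fun_lt_set.
  have [-> _] := integral_tail _ f mEg mf (fun w h => f0 w h.1).
  apply: eq_integral => a _; congr (P _); apply/seteqP; split => w /=; tauto.
under eq_integral do rewrite -EFinM.
move=> -> h; split; first by apply: eq_integral => b _; rewrite e.
have := (measurable_restrictT _ _).2 h.
by move=> /(_ (measurable_itv _)); apply: eq_measurable_fun => b _; rewrite e.
Qed.

(** The double tail of f at (a, b) is its tail at max a b, and exp(-gamma max a b) <= exp(-gamma a /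
    2) exp(-gamma b / 2); the product integrates to (2 / gamma)^2. *)
Lemma integral_sqr_le (f : Omega -> R) (gamma : R) : (0 < gamma)%R ->
  measurable_fun setT f -> (forall w, E w -> 0 <= f w)%R ->
  (forall a, (0 <= a)%R ->
    P ([set w | (a < f w)%R] `&` E) <= (expR (- (gamma * a)))%:E) ->
  \int[P]_(w in E) (f w * f w)%:E <= (4 / gamma ^+ 2)%:E.
Proof.
move=> gam0 mf f0 tail; have [-> mh] := integral_mul_tail f f mf mf f0 f0.
have g2 : (0 < gamma / 2)%R by rewrite divr_gt0.
have mexp (C : R) : measurable_fun (`[0%R, +oo[%classic : set R)
    (fun a => C%:E * (expR (- (gamma / 2 * a)))%:E).
  apply: emeasurable_funM => //; apply: measurable_EFin_expRN.
  by apply: measurable_funTS; exact: measurable_funM.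
have itv0 : measurable (`[0%R, +oo[%classic : set R) by [].
have key (x y : R) : (- (gamma * Num.max x y) <= - (gamma / 2 * y) + - (gamma / 2 * x))%R.
  have hx : (x <= Num.max x y)%R by rewrite le_max lexx.
  have hy : (y <= Num.max x y)%R by rewrite le_max lexx orbT.
  by have := ler_wpM2l (ltW g2) hx; have := ler_wpM2l (ltW g2) hy; lra.
have inner b : (0 <= b)%R ->
    \int[leb]_(a in `[0%R, +oo[) P ([set w | (a < f w)%R /\ (b < f w)%R] `&` E) <=
    ((gamma / 2)^-1)%:E * (expR (- (gamma / 2 * b)))%:E.
  move=> b0.
  apply: (@le_trans _ _ (\int[leb]_(a in `[0%R, +oo[)
    ((expR (- (gamma / 2 * b)))%:E * (expR (- (gamma / 2 * a)))%:E))).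
    apply: ge0_le_integral => //.
    - have mEg : measurable (E `&` [set x | (b < f x)%R]).
        by apply: measurableI => //; exact: measurable_fun_lt_set.
      have [_] := integral_tail _ f mEg mf (fun w h => f0 w h.1).
      apply: eq_measurable_fun => a _; congr (P _); apply/seteqP; split => w /=; tauto.
    - exact: mexp.
    move=> a; rewrite /= in_itv /= andbT => a0.
    have m0 : (0 <= Num.max a b)%R by rewrite le_max a0.
    apply: (@le_trans _ _ (P ([set w | (Num.max a b < f w)%R] `&` E))).
      apply: le_measure; rewrite ?inE.
      + by apply: measurableI => //; apply: measurableI; exact: measurable_fun_lt_set.
      + by apply: measurableI => //; exact: measurable_fun_lt_set.
      + by move=> w [[/= h1 h2] Ew]; split => //=; rewrite gt_max h1 h2.
    apply: (le_trans (tail _ m0)); rewrite -EFinM lee_fin -expRD ler_expR.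
    exact: key.
  rewrite ge0_integralZl//; last first.
    by apply: measurable_EFin_expRN; apply: measurable_funTS; exact: measurable_funM.
  by rewrite integral_expRN_0y// muleC.
apply: (@le_trans _ _ (\int[leb]_(b in `[0%R, +oo[)
    (((gamma / 2)^-1)%:E * (expR (- (gamma / 2 * b)))%:E))).
  apply: ge0_le_integral => //.
  - by move=> b _; apply: integral_ge0.
  - exact: mexp.
  - by move=> b; rewrite /= in_itv /= andbT; exact: inner.
rewrite ge0_integralZl//; last 2 first.
- by apply: measurable_EFin_expRN; apply: measurable_funTS; exact: measurable_funM.
- by rewrite lee_fin invr_ge0 ltW.
rewrite integral_expRN_0y// -EFinM lee_fin le_eqVlt; apply/orP; left; apply/eqP.
by field; rewrite gt_eqF.
Qed.

Lemma integral_mul_indep (f g : Omega -> R) (psi : R -> R) (mu : R) :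
  measurable_fun setT f -> measurable_fun setT g ->
  (forall w, E w -> 0 <= f w)%R -> (forall w, E w -> 0 <= g w)%R ->
  measurable_fun setT psi -> (forall a, (0 <= a)%R -> (0 <= psi a)%R) ->
  \int[leb]_(a in `[0%R, +oo[) (psi a)%:E = mu%:E ->
  (forall a b, (0 <= a)%R -> (0 <= b)%R ->
    P ([set w | (a < f w)%R /\ (b < g w)%R] `&` E) = (psi a * psi b)%:E) ->
  \int[P]_(w in E) (f w * g w)%:E = (mu * mu)%:E.
Proof.
move=> mf mg f0 g0 mpsi psi0 psiE tail; have [-> _] := integral_mul_tail f g mf mg f0 g0.
have mpsiE : measurable_fun (`[0%R, +oo[%classic : set R) (fun a => (psi a)%:E).
  by apply/measurable_EFinP; exact: measurable_funTS.
have psi0E (x : R) : (`[0%R, +oo[%classic : set R) x -> 0 <= (psi x)%:E.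
  by rewrite /= in_itv /= andbT lee_fin; exact: psi0.
have mu0 : 0 <= mu%:E by rewrite -psiE; exact: integral_ge0.
transitivity (\int[leb]_(b in `[0%R, +oo[) (mu%:E * (psi b)%:E)).
  apply: eq_integral => b; rewrite inE /= in_itv /= andbT => b0.
  transitivity (\int[leb]_(a in `[0%R, +oo[) ((psi b)%:E * (psi a)%:E)).
    apply: eq_integral => a; rewrite inE /= in_itv /= andbT => a0.
    by rewrite tail// mulrC EFinM.
  have pb : 0 <= (psi b)%:E by rewrite lee_fin psi0.
  by rewrite (ge0_integralZl leb (measurable_itv _) mpsiE psi0E pb)// psiE muleC.
by rewrite (ge0_integralZl leb (measurable_itv _) mpsiE psi0E mu0)// psiE.
Qed.

(** Chebyshev's inequality for variables with a common tail function [psi]: pairwise factorisation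
    of the tails controls the variance, and each square contributes at most 4 / gamma^2. *)
Lemma weak_lln (Y : nat -> Omega -> R) (k : nat) (psi : R -> R) (mu gamma r : R) :
  P E = 1 -> (0 < gamma)%R -> (0 < r)%R ->
  (forall i, measurable_fun setT (Y i)) -> (forall i w, E w -> 0 <= Y i w)%R ->
  measurable_fun setT psi -> (forall a, (0 <= a)%R -> (0 <= psi a <= expR (- (gamma * a)))%R) ->
  \int[leb]_(a in `[0%R, +oo[) (psi a)%:E = mu%:E ->
  (forall i a, (i < k)%N -> (0 <= a)%R -> P ([set w | (a < Y i w)%R] `&` E) = (psi a)%:E) ->
  (forall i j a b, (i < k)%N -> (j < k)%N -> i != j -> (0 <= a)%R -> (0 <= b)%R ->
    P ([set w | (a < Y i w)%R /\ (b < Y j w)%R] `&` E) = (psi a * psi b)%:E) ->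
  P ([set w | (r <= `|\sum_(i < k) Y i w - k%:R * mu|)%R] `&` E) <=
    (k%:R * (4 / gamma ^+ 2) / r ^+ 2)%:E.
Proof.
move=> PE gam0 r0 mY Y0 mpsi psiB psiE tail1 tail2.
pose S w := (\sum_(i < k) Y i w)%R.
have mS : measurable_fun setT S by exact: measurable_sum.
have S0 w : E w -> (0 <= S w)%R by move=> Ew; apply: sumr_ge0 => i _; exact: Y0.
have psi0 a : (0 <= a)%R -> (0 <= psi a)%R by move=> /psiB/andP[].
have mu0 : (0 <= mu)%R.
  rewrite -lee_fin -psiE; apply: integral_ge0 => a; rewrite /= in_itv /= andbT.
  by rewrite lee_fin; exact: psi0.
have I1 (i : 'I_k) : \int[P]_(w in E) (Y i w)%:E = mu%:E.
  have [-> _] := integral_tail _ (Y i) mE (mY i) (Y0 i); rewrite -psiE.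
  by apply: eq_integral => a; rewrite inE /= in_itv /= andbT => a0; rewrite tail1.
have IS : \int[P]_(w in E) (S w)%:E = (k%:R * mu)%:E.
  under eq_integral do rewrite /S -sumEFin.
  rewrite ge0_integral_sum//.
  - under eq_bigr do rewrite I1.
    by rewrite sumEFin sumr_const card_ord mulr_natl.
  - by move=> i; apply/measurable_EFinP; exact: measurable_funTS.
  - by move=> i w Ew; rewrite lee_fin Y0.
have IYY (i j : 'I_k) : \int[P]_(w in E) (Y i w * Y j w)%:E <=
    ((if i == j then 4 / gamma ^+ 2 else 0) + mu * mu)%:E.
  case: eqVneq => [->|ij].
    apply: (@le_trans _ _ (4 / gamma ^+ 2)%:E); last by rewrite lee_fin lerDl mulr_ge0.
    apply: integral_sqr_le => //; first exact: Y0.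
    by move=> a a0; rewrite tail1// lee_fin; have /andP[] := psiB a a0.
  rewrite (integral_mul_indep _ _ psi mu)// ?add0r//; try exact: Y0.
  by move=> a b a0 b0; rewrite tail2.
have ISS : \int[P]_(w in E) (S w ^+ 2)%:E <= (k%:R * (4 / gamma ^+ 2) + (k%:R * mu) ^+ 2)%:E.
  have SE w : (S w ^+ 2)%:E = \sum_(i < k) \sum_(j < k) (Y i w * Y j w)%:E.
    rewrite expr2 /S mulr_suml -sumEFin; apply: eq_bigr => i _.
    by rewrite mulr_sumr -sumEFin.
  have mYY (i j : 'I_k) : measurable_fun E (fun w => (Y i w * Y j w)%:E).
    by apply/measurable_EFinP; apply: measurable_funTS; exact: measurable_funM.
  have YY0 (i j : 'I_k) w : E w -> 0 <= (Y i w * Y j w)%:E.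
    by move=> Ew; rewrite lee_fin mulr_ge0 ?Y0.
  under eq_integral do rewrite SE.
  rewrite ge0_integral_sum//; last 2 first.
  - by move=> i; exact: emeasurable_sum.
  - by move=> i w Ew; apply: sume_ge0 => j _; exact: YY0.
  apply: (@le_trans _ _ (\sum_(i < k) \sum_(j < k)
      ((if i == j then 4 / gamma ^+ 2 else 0) + mu * mu)%:E)).
    apply: lee_sum => i _; rewrite ge0_integral_sum//; last exact: YY0.
    by apply: lee_sum => j _; exact: IYY.
  rewrite (eq_bigr (fun i : 'I_k => (4 / gamma ^+ 2 + k%:R * (mu * mu))%:E)); last first.
    move=> i _; rewrite sumEFin; congr EFin; rewrite big_split /= -big_mkcond /=.
    rewrite (big_pred1 i); last by move=> j; rewrite /= eq_sym.
    by congr (_ + _)%R; rewrite sumr_const card_ord mulr_natl.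
  rewrite sumEFin sumr_const card_ord -mulr_natl lee_fin le_eqVlt; apply/orP; left.
  by apply/eqP; ring.
have IV : \int[P]_(w in E) ((S w - k%:R * mu) ^+ 2)%:E <= (k%:R * (4 / gamma ^+ 2))%:E.
  pose K := (k%:R * mu)%R.
  have K0 : (0 <= K)%R by rewrite mulr_ge0.
  have mSK : measurable_fun E (fun w => ((S w - K) ^+ 2)%:E).
    apply/measurable_EFinP; apply: measurable_funTS; apply: measurable_funX.
    exact: measurable_funB.
  have mSE : measurable_fun E (fun w => (S w)%:E).
    by apply/measurable_EFinP; exact: measurable_funTS.
  have mS2 : measurable_fun E (fun w => (S w ^+ 2)%:E).
    by apply/measurable_EFinP; apply: measurable_funTS; exact: measurable_funX.
  (* The cross term stands on the left so that all integrands are nonnegative and linearity holds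
     without integrability conditions. *)
  have : \int[P]_(w in E) ((S w - K) ^+ 2)%:E + (2 * K)%:E * \int[P]_(w in E) (S w)%:E =
         \int[P]_(w in E) (S w ^+ 2)%:E + \int[P]_(w in E) (K ^+ 2)%:E.
    rewrite -ge0_integralZl//; last by rewrite lee_fin mulr_ge0.
    rewrite -!ge0_integralD//.
    - by apply: eq_integral => w _; rewrite -EFinM -!EFinD; congr EFin; ring.
    - by move=> w _; rewrite lee_fin sqr_ge0.
    - by move=> w _; rewrite lee_fin sqr_ge0.
    - by move=> w _; rewrite lee_fin sqr_ge0.
    - by move=> w Ew; rewrite -EFinM lee_fin mulr_ge0 ?S0// mulr_ge0.
    - exact: emeasurable_funM.
  rewrite IS integral_cst// -EFinM => h.
  have hK : (K ^+ 2)%:E * P E = (K ^+ 2)%:E by rewrite PE mule1.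
  rewrite -(@leeD2rE _ (2 * K * K)%:E)// h hK.
  apply: (le_trans (leeD ISS (lexx _))); rewrite -!EFinD lee_fin le_eqVlt.
  by apply/orP; left; apply/eqP; rewrite /K; ring.
set B := _ `&` E.
have mB : measurable B.
  apply: measurableI => //; rewrite [X in measurable X](_ : _ =
     ~` [set w | (`|S w - k%:R * mu| < r)%R]).
    apply: measurableC; apply: measurable_fun_lt_set => //.
    by apply: measurableT_comp => //; exact: measurable_funB.
  by apply/seteqP; split => w /=; rewrite leNgt => /negP.
have r20 : (0 < r ^+ 2)%R by rewrite exprn_gt0.
rewrite EFinM lee_pdivlMr// muleC; apply: le_trans IV.
rewrite -integral_cst//; apply: (@le_trans _ _ (\int[P]_(w in B) ((S w - k%:R * mu) ^+ 2)%:E)).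
  apply: ge0_le_integral => //.
  - by move=> w _; rewrite lee_fin ltW.
  - apply/measurable_EFinP; apply: measurable_funTS; apply: measurable_funX.
    exact: measurable_funB.
  - move=> w [/= hw _]; rewrite lee_fin -[leRHS]real_normK ?num_real//.
    by rewrite lerXn2r ?nnegrE ?(ltW r0).
apply: ge0_subset_integral => //.
- apply/measurable_EFinP; apply: measurable_funTS; apply: measurable_funX.
  exact: measurable_funB.
- by move=> w _; rewrite lee_fin sqr_ge0.
- by move=> w [].
Qed.

End Moments.

(** Setting the other thresholds to 0, where [psi] equals 1, gives the single and pairwise tails.
    The block size [N] is kept apart from the number [k] of summands because a square block must
    also contain all the rows crossed. *)
Lemma weak_lln_prod {R : realType} {d : measure_display} {Omega : measurableType d}
    (P : probability Omega R) (E : set Omega) (Y : nat -> Omega -> R) (N k : nat)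
    (psi : R -> R) (mu gamma r : R) :
  measurable E -> P E = 1%E -> 0 < gamma -> 0 < r -> (k <= N)%N ->
  (forall i, measurable_fun setT (Y i)) -> (forall i w, E w -> 0 < Y i w) ->
  measurable_fun setT psi -> psi 0 = 1 ->
  (forall a, 0 <= a -> 0 <= psi a <= expR (- (gamma * a))) ->
  (\int[lebesgue_measure]_(a in `[0%R, +oo[) (psi a)%:E = mu%:E)%E ->
  (forall v, (forall i, 0 <= v i) ->
    P ([set w | forall i, (i < N)%N -> v i < Y i w] `&` E) =
    (\prod_(i < N) psi (v i))%:E) ->
  (P ([set w | (r <= `|\sum_(i < k) Y i w - k%:R * mu|)%R] `&` E) <=
    (k%:R * (4 / gamma ^+ 2) / r ^+ 2)%:E)%E.
Proof.
move=> mE PE gam0 r0 kN mY Y0 mpsi psi_0 psiB psiE tail.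
apply: (weak_lln P E mE Y k psi mu gamma r) => //.
- by move=> i w Ew; exact/ltW/Y0.
- move=> i a ik a0; have iN := leq_trans ik kN.
  have := tail (fun j => if j == i then a else 0).
  rewrite (bigD1 (Ordinal iN))//= eqxx big1 => [|j]; last first.
    by rewrite -val_eqE /= => /negbTE ->.
  rewrite mulr1 => <- //; last by move=> j; case: ifP.
  congr (P _); apply/seteqP; split => w /= [h Ew]; split => //.
    by move=> j _; case: eqP => [->//|_]; exact: Y0.
  by have := h i iN; rewrite eqxx.
- move=> i j a b ik jk ij a0 b0; have iN := leq_trans ik kN; have jN := leq_trans jk kN.
  have := tail (fun l => if l == i then a else if l == j then b else 0).
  rewrite (bigD1 (Ordinal iN))//= eqxx (bigD1 (Ordinal jN))/=; last first.
    by rewrite -val_eqE /= eq_sym.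
  rewrite (eq_sym j i) (negbTE ij) eqxx big1 => [|l]; last first.
    by rewrite -!val_eqE /= => /andP[/negbTE -> /negbTE ->].
  rewrite mulr1 => <- //; last by move=> l; case: ifP => // _; case: ifP.
  congr (P _); apply/seteqP; split => w /= [h Ew]; split => //.
    move=> l _; case: eqP => [->|_]; first by case: h.
    by case: eqP => [->|_]; [case: h|exact: Y0].
  have := h i iN; have := h j jN; rewrite !eqxx.
  by rewrite (eq_sym j i) (negbTE ij).
Qed.

(** * Laws of large numbers for the stationary model *)

Section StationaryLLN.
Context {R : realType} {d : measure_display} {Omega : measurableType d}.
Variables (P : probability Omega R) (m : probability R R).
Variables (xi : nat -> Omega -> R) (X : nat -> nat -> Omega -> R) (c : R).
Hypothesis mxi : forall j, measurable_fun setT (xi j).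
Hypothesis mX : forall i j, measurable_fun setT (X i j).
Hypothesis law : joint_law P m xi X.
Hypothesis c_gt0 : 0 < c.
Hypothesis m_supp : m (~` `[c, +oo[%classic) = 0%E.

Let typical := typical xi X c.
Let mtyp : measurable typical := measurable_typical xi X c mxi mX.
Let Ptyp : P typical = 1%E :=
  probability_typical P m xi X c mxi mX law m_supp.

Definition growth_bd (z : R) (l k : nat) (w : Omega) : R :=
  growth (U_bd xi X z ^~ w) (V_bd xi X z ^~ w) (fun i j => X_bulk X i j w) l k.

Definition mean_inv (z : R) : R := \int[m]_(x in `[c, +oo[%classic) (x - z)^-1.

Lemma row_incr_lln (z r : R) (k l : nat) : 0 < z < c -> 0 < r ->
  (P ([set w | (r <= `|\sum_(i < k) row_incr (U_bd xi X z ^~ w) (V_bd xi X z ^~ w)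
           (fun i j => X_bulk X i j w) l i - k%:R * z^-1|)%R] `&` typical) <=
    (k%:R * (4 / z ^+ 2) / r ^+ 2)%:E)%E.
Proof.
move=> /[dup] zc /andP[z0 z_c] r0.
pose N := maxn k l.
have mU i := measurable_U_bd xi X mxi mX z i.
have mV i := measurable_V_bd xi X mxi mX z i.
have mY i j : measurable_fun setT (X_bulk X i j) by exact: mX.
have blaw := boundary_law_typical P m xi X c mxi mX law c_gt0 m_supp N z zc.
pose Y i w := row_incr (U_bd xi X z ^~ w) (V_bd xi X z ^~ w) (fun i j => X_bulk X i j w) l i.
apply: (weak_lln_prod P typical Y N k (fun a => expR (- (z * a)))) => //.
- exact: leq_maxl.
- by move=> i; exact: measurable_row_incr.
- move=> i w Tw; apply: row_incr_gt0 => [j|j j'].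
    exact: (U_bd_gt0 xi X c c_gt0).
  by have [] := Tw j.+1 j'.+1.
- apply: measurableT_comp => //; apply: measurableT_comp => //; exact: measurable_funM.
- by rewrite mulr0 oppr0 expR0.
- by move=> a _; rewrite expR_ge0 lexx.
- exact: integral_expRN_0y.
- move=> v v0.
  have := row_incr_burke P m z N N typical (xi_bulk xi) (U_bd xi X z) (V_bd xi X z)
    (X_bulk X) mtyp _ mU mV mY _ _ _ blaw l v (leq_maxr _ _) v0.
  move=> ->.
  + by rewrite mulr_sumr -sumrN expR_sum.
  + by move=> j; exact: mxi.
  + by move=> w i Tw; exact: (U_bd_gt0 xi X c c_gt0).
  + by move=> w j Tw; exact: (V_bd_gt0 xi X c c_gt0).
  + by move=> w i j Tw; have [] := Tw i.+1 j.+1.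
Qed.

Lemma integrable_bounded (f : R -> R) (K : R) : measurable_fun setT f ->
  (forall x, c <= x -> `|f x| <= K) -> m.-integrable `[c, +oo[%classic (EFin \o f).
Proof.
move=> mf fK; apply: measurable_bounded_integrable => //.
- by rewrite (le_lt_trans (probability_le1 _ _))// ltry.
- exact: measurable_funTS.
exists K; split => [|K' KK' x /=]; first exact: num_real.
rewrite in_itv /= andbT => cx.
exact: le_trans (fK x cx) (ltW KK').
Qed.

Lemma integrable_inv z : z < c -> m.-integrable `[c, +oo[%classic (EFin \o (fun x => (x - z)^-1)).
Proof.
move=> zc; apply: (@integrable_bounded _ (c - z)^-1).
  by apply: measurable_funV; exact: measurable_funB.
move=> x cx; have xz : 0 < c - z by rewrite subr_gt0.
have xz' : 0 < x - z by lra.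
by rewrite ger0_norm ?invr_ge0 ?(ltW xz')// lef_pV2 ?posrE//; lra.
Qed.

(** Tail function of the vertical boundary weights: the tail of an exponential of rate x - z
    averaged over [m]. Its integral over v is their mean, [mean_inv z]. *)
Definition psiV (z v : R) : R := \int[m]_(x in `[c, +oo[%classic) expR (- ((x - z) * v)).

Lemma psiVE z v : z < c -> 0 <= v ->
  (psiV z v)%:E = (\int[m]_(x in `[c, +oo[) (expR (- ((x - z) * v)))%:E)%E.
Proof.
move=> zc v0; rewrite /psiV /Rintegral fineK//.
apply: integrable_fin_num => //.
apply: (@integrable_bounded (fun x => expR (- ((x - z) * v))) 1).
  apply/measurable_EFinP/measurable_EFin_expRN; apply: measurable_funM => //.
  exact: measurable_funB.
move=> x cx; rewrite ger0_norm ?expR_ge0// -expR0 ler_expR oppr_le0 mulr_ge0//.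
by lra.
Qed.

Lemma measurable_integrand_psiV z : measurable_fun setT
  (fun p : R * R => (expR (- ((p.1 - z) * p.2)) *
       \1_(`[c, +oo[%classic `*` `[0, +oo[%classic) p)%:E).
Proof.
apply/measurable_EFinP; apply: measurable_funM.
  apply/measurable_EFinP/measurable_EFin_expRN; apply: measurable_funM => //.
  exact: measurable_funB.
by apply: measurable_indic; exact: measurableX.
Qed.

Lemma integral_psiV z : z < c ->
  (\int[lebesgue_measure]_(v in `[0%R, +oo[) (psiV z v)%:E = (mean_inv z)%:E)%E.
Proof.
move=> zc; rewrite /mean_inv /Rintegral fineK; last first.
  by apply: integrable_fin_num => //; exact: integrable_inv.
pose Phi (p : R * R) := (expR (- ((p.1 - z) * p.2)) *
       \1_(`[c, +oo[%classic `*` `[0, +oo[%classic) p)%:E.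
have Phi0 p : (0 <= Phi p)%E by rewrite lee_fin mulr_ge0 ?expR_ge0// indicE.
have mPhi : measurable_fun setT Phi by exact: measurable_integrand_psiV.
have := @fubini_tonelli _ _ R (measurableTypeR R) R m lebesgue_measure Phi mPhi Phi0.
have PhiE x v : Phi (x, v) = (if (c <= x) && (0 <= v) then (expR (- ((x - z) * v)))%:E else 0%E).
  rewrite /Phi /= indicE in_setX !mem_setE /= !in_itv /= !andbT.
  by case: ifP => _; rewrite ?mulr1 ?mulr0.
have -> : (\int[m]_x \int[lebesgue_measure]_v Phi (x, v) =
   \int[m]_(x in `[c, +oo[) ((x - z)^-1)%:E)%E.
  rewrite [RHS]integral_mkcond; apply: eq_integral => x _; rewrite patchE mem_setE /= in_itv /= andbT.
  case: ifPn => cx.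
    have xz : 0 < x - z by rewrite subr_gt0 (lt_le_trans zc).
    rewrite -(integral_expRN_0y _ xz) [RHS]integral_mkcond; apply: eq_integral => v _.
    by rewrite PhiE patchE mem_setE /= in_itv /= andbT cx.
  by apply: integral0_eq => v _; rewrite PhiE (negbTE cx).
move=> ->; rewrite integral_mkcond; apply: eq_integral => v _.
rewrite patchE mem_setE /= in_itv /= andbT; case: ifPn => v0.
  rewrite psiVE// integral_mkcond; apply: eq_integral => x _.
  by rewrite PhiE patchE mem_setE /= in_itv /= v0 !andbT.
by apply/esym/integral0_eq => x _; rewrite PhiE (negbTE v0) andbF.
Qed.

(** For v < 0 the defining integral may diverge; the value 0 chosen there matches the indicator in
    the Fubini integrand. *)
Lemma measurable_psiV z : z < c ->
  measurable_fun setT (fun v : R => if 0 <= v then psiV z v else 0).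
Proof.
move=> zc.
pose Phi (p : R * R) := (expR (- ((p.1 - z) * p.2)) *
       \1_(`[c, +oo[%classic `*` `[0, +oo[%classic) p)%:E.
have Phi0 p : (0 <= Phi p)%E by rewrite lee_fin mulr_ge0 ?expR_ge0// indicE.
have mPhi : measurable_fun setT Phi by exact: measurable_integrand_psiV.
have := @measurable_fun_fubini_tonelli_G _ _ R R R m Phi mPhi Phi0.
move=> h; apply/measurable_EFinP; apply: eq_measurable_fun h => v _ /=.
rewrite /fubini_G; case: ifPn => v0.
  rewrite psiVE// [RHS]integral_mkcond; apply: eq_integral => x _.
  rewrite /Phi /= indicE in_setX patchE !mem_setE /= !in_itv /= !andbT v0 andbT.
  by case: ifP => _; rewrite ?mulr1 ?mulr0.
apply: integral0_eq => x _.
rewrite /Phi /= indicE in_setX !mem_setE /= !in_itv /= !andbT (negbTE v0) andbF.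
by rewrite mulr0.
Qed.

Lemma V_bd_lln (z r : R) (l : nat) : 0 < z < c -> 0 < r ->
  (P ([set w | (r <= `|\sum_(j < l) V_bd xi X z j w - l%:R * mean_inv z|)%R] `&` typical) <=
    (l%:R * (4 / (c - z) ^+ 2) / r ^+ 2)%:E)%E.
Proof.
move=> /[dup] zc /andP[z0 z_c] r0.
have cz : 0 < c - z by rewrite subr_gt0.
have mV i := measurable_V_bd xi X mxi mX z i.
have blaw := boundary_law_typical P m xi X c mxi mX law c_gt0 m_supp l z zc.
apply: (weak_lln_prod P typical (V_bd xi X z) l l
   (fun v : R => if 0 <= v then psiV z v else 0)) => //.
- by move=> i w Tw; exact: (V_bd_gt0 xi X c c_gt0).
- exact: measurable_psiV.
- rewrite lexx; apply: EFin_inj; rewrite psiVE//.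
  under eq_integral do rewrite mulr0 oppr0 expR0.
  by rewrite integral_cst// mul1e; exact: m_supp1.
- move=> v v0; rewrite v0; apply/andP; split.
    by rewrite -lee_fin psiVE//; apply: integral_ge0 => x _; rewrite lee_fin expR_ge0.
  (* The rate x - z is at least c - z, which gives the exponential decay required of the tail. *)
  rewrite -lee_fin psiVE//.
  apply: (@le_trans _ _ (\int[m]_(x in `[c, +oo[) (expR (- ((c - z) * v)))%:E)%E).
    apply: ge0_le_integral => //.
    + apply: measurable_EFin_expRN; apply: measurable_funTS; apply: measurable_funM => //.
      exact: measurable_funB.
    + move=> x; rewrite /= in_itv /= andbT => cx.
      by rewrite lee_fin ler_expR lerN2 ler_wpM2r// lerD2r.
  rewrite integral_cst//.
  by rewrite [X in (_ * X)%E](_ : _ = 1%E) ?mule1//; exact: m_supp1.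
- rewrite -(integral_psiV _ z_c); apply: eq_integral => v.
  by rewrite inE /= in_itv /= andbT => ->.
- move=> v v0.
  have := blaw (fun=> setT) (fun=> 0) v (fun _ _ => 0) (fun=> measurableT)
    (fun=> lexx _) v0 (fun _ _ => lexx _).
  rewrite big1// mulr0 oppr0 expR0 mul1e.
  have -> : [set w | (forall i, (i < l)%N -> 0 < U_bd xi X z i w) /\
      (forall j, (j < l)%N -> [/\ [set: R] (xi_bulk xi j w), v j < V_bd xi X z j w &
         forall i, (i < l)%N -> 0 < X_bulk X i j w])] `&` typical =
     [set w | forall i, (i < l)%N -> v i < V_bd xi X z i w] `&` typical.
    apply/seteqP; split => w /= [h Tw]; split => //.
      by move=> j jl; have [_ /(_ j jl)[]] := h.
    split=> [i _|j jl]; first exact: (U_bd_gt0 xi X c c_gt0).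
    by split => //; [exact: h|move=> i _; have [] := Tw i.+1 j.+1].
  move=> ->; rewrite -prodEFin; apply: eq_bigr => j _; rewrite v0 psiVE//.
  rewrite (integral_supp m c m_supp)//; last first.
    apply: measurable_EFin_expRN; apply: measurable_funD.
      by apply: measurable_funM => //; exact: measurable_funB.
    exact: measurable_funM.
  by rewrite setTI; apply: eq_integral => x _; rewrite mulr0 addr0.
Qed.

End StationaryLLN.

(** * Bounds on the time constant *)

Section HighProbability.
Context {R : realType} {d : measure_display} {Omega : measurableType d}.
Variables (P : probability Omega R) (E : set Omega).

(** Failure has probability O(1 / n), witnessed by measurable sets [B n]; measurability is asked of
    these sets and not of the events [Q n]. *)
Definition whp (Q : nat -> Omega -> Prop) : Prop :=
  exists (K : R) (B : nat -> set Omega), forall n, (0 < n)%N ->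
    [/\ measurable (B n), (P (B n) <= (K / n%:R)%:E)%E &
        forall w, E w -> ~ B n w -> Q n w].

Lemma whp_and Q1 Q2 : whp Q1 -> whp Q2 -> whp (fun n w => Q1 n w /\ Q2 n w).
Proof.
move=> [K1 [B1 h1]] [K2 [B2 h2]]; exists (K1 + K2), (fun n => B1 n `|` B2 n) => n n0.
have [mB1 PB1 Q1n] := h1 n n0; have [mB2 PB2 Q2n] := h2 n n0; split.
- exact: measurableU.
- rewrite mulrDl EFinD (le_trans _ (leeD PB1 PB2))//.
  exact: measureU2.
- by move=> w Ew /not_orP[? ?]; split; [exact: Q1n|exact: Q2n].
Qed.

Lemma whp_imp Q1 Q2 : (forall n w, (0 < n)%N -> E w -> Q1 n w -> Q2 n w) ->
  whp Q1 -> whp Q2.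
Proof.
move=> Q12 [K [B h]]; exists K, B => n n0; have [mB PB Q1n] := h n n0; split => //.
by move=> w Ew nB; apply: Q12 => //; exact: Q1n.
Qed.

Lemma whp_chebyshev (S : nat -> Omega -> R) (D eta : R) : 0 < eta ->
  (forall n, measurable_fun setT (S n)) -> measurable E ->
  (forall n r, 0 < r -> (P ([set w | (r <= `|S n w|)%R] `&` E) <=
     (D * n%:R / r ^+ 2)%:E)%E) ->
  whp (fun n w => `|S n w| < eta * n%:R).
Proof.
move=> eta0 mS mE h.
exists (D / eta ^+ 2), (fun n => [set w | eta * n%:R <= `|S n w|] `&` E) => n n0.
have n0' : 0 < n%:R :> R by rewrite ltr0n.
split.
- apply: measurableI => //; rewrite [X in measurable X](_ : _ =
     ~` [set w | (`|S n w| < eta * n%:R)%R]).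
    by apply: measurableC; apply: measurable_fun_lt_set => //; exact: measurableT_comp.
  by apply/seteqP; split => w /=; rewrite leNgt => /negP.
- apply: (le_trans (h n _ (mulr_gt0 eta0 n0'))); rewrite lee_fin le_eqVlt.
  apply/orP; left; apply/eqP; field; rewrite !gt_eqF//.
- move=> w Ew nB; rewrite ltNge; apply/negP => hw; exact: nB.
Qed.

(** Events of probability at least p occur infinitely often with probability at least p, so some
    outcome lies in infinitely many of them and also has the almost sure limit. *)
Lemma as_limit_le (u : nat -> Omega -> R) (L v p : R) (A : nat -> set Omega) (n0 : nat) :
  {ae P, forall w, (fun n => u n w) @ \oo --> L} ->
  (forall n, measurable (A n)) -> 0 < p ->
  (forall n, (n0 <= n)%N -> (p%:E <= P (A n))%E /\ forall w, A n w -> u n w <= v) ->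
  L <= v.
Proof.
move=> aeL mA p0 hA.
have Plim : (p%:E <= P (lim_sup_set A))%E.
  have cA : P (\bigcup_(k >= n) A k) @[n --> \oo] --> P (lim_sup_set A).
    apply: lim_sup_set_cvg => //; apply: (le_lt_trans (probability_le1 _ _)).
      exact: bigcup_measurable.
    exact: ltry.
  rewrite -(cvg_lim _ cA)//; apply: lime_ge; first by apply/cvg_ex; exists (P (lim_sup_set A)).
  near=> n; have n0n : (n0 <= n)%N by near: n; exists n0.
  apply: (le_trans (hA n n0n).1); apply: le_measure; rewrite ?inE//.
    exact: bigcup_measurable.
  by move=> w Aw; exists n => /=.
have [N [mN PN subN]] := aeL.
have [w [Aw Nw]] : exists w, lim_sup_set A w /\ ~ N w.
  apply: contrapT => /forallNP h.
  have : (P (lim_sup_set A) <= P N)%E.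
    apply: le_measure; rewrite ?inE//.
      by apply: bigcap_measurable => // k _; exact: bigcup_measurable.
    by move=> w Aw; apply: contrapT => Nw; apply: (h w).
  by rewrite PN leNgt (lt_le_trans _ Plim)// lte_fin.
have cw : (fun n => u n w) @ \oo --> L.
  by apply: contrapT => h; apply: Nw; apply: subN.
rewrite leNgt; apply/negP => vL.
have /cvgrPdist_lt/(_ (L - v)) := cw; rewrite subr_gt0 => /(_ vL)[n1 _ hn1].
have [n /= mn An] := Aw (maxn n0 n1) Logic.I.
have /= := hn1 n (leq_trans (leq_maxr _ _) mn).
have := (hA n (leq_trans (leq_maxl _ _) mn)).2 w An.
move=> h1; rewrite ltr_norml => /andP[_]; lra.
Unshelve. all: by end_near. Qed.

(** Exceptional sets of probability K / n cannot exhaust a fixed event [F] of positive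
    probability. *)
Lemma whp_limit_le (u : nat -> Omega -> R) (L v : R) (F : set Omega)
    (Q : nat -> Omega -> Prop) (n0 : nat) :
  {ae P, forall w, (fun n => u n w) @ \oo --> L} -> measurable E -> P E = 1%E ->
  measurable F -> (0 < P F)%E -> whp Q ->
  (forall n w, (n0 <= n)%N -> F w -> E w -> Q n w -> u n w <= v) ->
  L <= v.
Proof.
move=> aeL mE PE mF PF [K [B hB]] hQ.
pose A n := if (0 < n)%N then (F `&` E) `\` B n else set0.
have PFfin : P F \is a fin_num by rewrite fin_num_measure.
pose p := fine (P F); have p0 : 0 < p by rewrite fine_gt0// PF ltey_eq PFfin.
have PFE : P (F `&` E) = p%:E.
  rewrite /p fineK//; apply/eqP; rewrite eq_le; apply/andP; split.
    by apply: le_measure; rewrite ?inE//; exact: measurableI.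
  have PEC : P (~` E) = 0%E by rewrite probability_setC// PE subee.
  rewrite -[leRHS]adde0 -PEC; apply: (@le_trans _ _ (P ((F `&` E) `|` ~` E))); last first.
    by apply: measureU2 => //; [exact: measurableI|exact: measurableC].
  apply: le_measure; rewrite ?inE//.
    by apply: measurableU; [exact: measurableI|exact: measurableC].
  by move=> w Fw; have [Ew|Ew] := pselect (E w); [left|right].
(* Beyond [n1] the exceptional probability is at most p / 2, which leaves p / 2 of [F]. *)
pose n1 := (maxn (maxn n0 1) (truncn (2 * K / p)).+1).
apply: (as_limit_le u L v (p / 2) A n1) => //.
- rewrite /A => n; case: ifP => // n_gt0; apply: measurableD; first exact: measurableI.
  by have [] := hB n n_gt0.
- by rewrite divr_gt0.
move=> n n1n.
have n0n : (n0 <= n)%N by rewrite (leq_trans _ n1n)// /n1 !leq_max leqnn.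
have n_gt0 : (0 < n)%N by rewrite (leq_trans _ n1n)// /n1 !leq_max leqnn orbT.
have nK : 2 * K / p < n%:R.
  rewrite (lt_le_trans (truncnS_gt _))// ler_nat (leq_trans _ n1n)// /n1 !leq_max.
  by rewrite leqnn !orbT.
have [mB PB hBQ] := hB n n_gt0.
rewrite /A n_gt0; split; last by move=> w [[Fw Ew] nB]; apply: hQ => //; exact: hBQ.
have : (P (F `&` E) <= P ((F `&` E) `\` B n) + P (B n))%E.
  apply: (@le_trans _ _ (P (((F `&` E) `\` B n) `|` B n))).
    apply: le_measure; rewrite ?inE//; first exact: measurableI.
      by apply: measurableU => //; apply: measurableD => //; exact: measurableI.
    by move=> w h; have [Bw|Bw] := pselect (B n w); [right|left].
  by apply: measureU2 => //; apply: measurableD => //; exact: measurableI.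
have fA : P ((F `&` E) `\` B n) \is a fin_num.
  by rewrite fin_num_measure//; apply: measurableD => //; exact: measurableI.
rewrite PFE -(fineK fA) => h.
have := le_trans h (leeD (lexx _) PB); rewrite -EFinD !lee_fin.
have n0' : 0 < n%:R :> R by rewrite ltr0n.
have : K / n%:R <= p / 2.
  rewrite ler_pdivrMr//; move: nK; rewrite ltr_pdivrMr// => /ltW; lra.
lra.
Qed.

Lemma whp_limit_ge (u : nat -> Omega -> R) (L v : R) (F : set Omega)
    (Q : nat -> Omega -> Prop) (n0 : nat) :
  {ae P, forall w, (fun n => u n w) @ \oo --> L} -> measurable E -> P E = 1%E ->
  measurable F -> (0 < P F)%E -> whp Q ->
  (forall n w, (n0 <= n)%N -> F w -> E w -> Q n w -> v <= u n w) ->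
  v <= L.
Proof.
move=> aeL mE PE mF PF hQ h; rewrite -lerN2.
apply: (whp_limit_le (fun n w => - u n w) (- L) (- v) F Q n0) => //.
  by apply: filterS aeL => w; exact: cvgN.
by move=> n w n0n Fw Ew Qw; rewrite lerN2; exact: h.
Qed.

End HighProbability.

Section TimeConstantBounds.
Context {R : realType} {d : measure_display} {Omega : measurableType d}.
Variables (P : probability Omega R) (m : probability R R).
Variables (xi : nat -> Omega -> R) (X : nat -> nat -> Omega -> R) (c : R).
Hypothesis mxi : forall j, measurable_fun setT (xi j).
Hypothesis mX : forall i j, measurable_fun setT (X i j).
Hypothesis law : joint_law P m xi X.
Hypothesis c_gt0 : 0 < c.
Hypothesis m_supp : m (~` `[c, +oo[%classic) = 0%E.

Let typ := typical xi X c.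
Let mtyp : measurable typ := measurable_typical xi X c mxi mX.
Let Ptyp : P typ = 1%E :=
  probability_typical P m xi X c mxi mX law m_supp.
Let M := mean_inv m c.
Let U := U_bd xi X.
Let V := V_bd xi X.
Let whp := whp P typ.

Let mU z i : measurable_fun setT (U z i) := measurable_U_bd xi X mxi mX z i.
Let mV z i : measurable_fun setT (V z i) := measurable_V_bd xi X mxi mX z i.
Let mB i j : measurable_fun setT (X_bulk X i j). Proof. exact: mX. Qed.

Lemma mean_inv_ge0 (z : R) : z < c -> 0 <= M z.
Proof.
move=> zc; apply: Rintegral_ge0 => x /=; rewrite in_itv /= andbT => cx.
by rewrite invr_ge0; lra.
Qed.

Lemma whp_row_incr (z eta D : R) (k l : nat -> nat) : 0 < z < c -> 0 < eta ->
  (forall n, (k n)%:R <= D * n%:R) ->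
  whp (fun n w => `|\sum_(i < k n) row_incr (U z ^~ w) (V z ^~ w)
         (fun i j => X_bulk X i j w) (l n) i - (k n)%:R * z^-1| < eta * n%:R).
Proof.
move=> zc eta0 kD; apply: (@whp_chebyshev _ _ _ _ _ _ (D * (4 / z ^+ 2))) => //.
  move=> n; apply: measurable_funB => //; apply: measurable_sum => i.
  exact: measurable_row_incr.
move=> n r r0.
have h := row_incr_lln P m xi X c mxi mX law c_gt0 m_supp z r (k n) (l n) zc r0.
apply: (le_trans h); rewrite lee_fin ler_pM2r ?invr_gt0 ?exprn_gt0//.
rewrite [leRHS]mulrAC ler_pM2r// divr_gt0// exprn_gt0//.
by case/andP: zc.
Qed.

Lemma whp_V_bd (z eta D : R) (l : nat -> nat) : 0 < z < c -> 0 < eta ->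
  (forall n, (l n)%:R <= D * n%:R) ->
  whp (fun n w => `|\sum_(j < l n) V z j w - (l n)%:R * M z| < eta * n%:R).
Proof.
move=> zc eta0 kD; apply: (@whp_chebyshev _ _ _ _ _ _ (D * (4 / (c - z) ^+ 2))) => //.
  by move=> n; apply: measurable_funB => //; exact: measurable_sum.
move=> n r r0.
have h := V_bd_lln P m xi X c mxi mX law c_gt0 m_supp z r (l n) zc r0.
apply: (le_trans h); rewrite lee_fin ler_pM2r ?invr_gt0 ?exprn_gt0//.
rewrite [leRHS]mulrAC ler_pM2r// divr_gt0// exprn_gt0//.
by rewrite subr_gt0; case/andP: zc.
Qed.

Lemma truncn_mul_near (n : nat) (s : R) : 0 <= s ->
  (truncn (n%:R * s))%:R <= s * n%:R /\ n%:R * s - 1 <= (truncn (n%:R * s))%:R.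
Proof.
move=> s0; have /andP[h1 h2] : (truncn (n%:R * s))%:R <= n%:R * s < (truncn (n%:R * s)).+1%:R.
  by apply: truncn_itv; rewrite mulr_ge0.
by split; [rewrite [leRHS]mulrC|move: h2; rewrite -natr1; lra].
Qed.

Lemma truncn_mul_dist (n : nat) (s b : R) : 0 <= s -> 0 <= b ->
  `|(truncn (n%:R * s))%:R * b - n%:R * (s * b)| <= b.
Proof.
move=> s0 b0; have [h1 h2] := truncn_mul_near n s s0.
rewrite ler_norml; apply/andP; split.
  by have := ler_wpM2r b0 h2; lra.
by have := ler_wpM2r b0 h1; lra.
Qed.

Lemma whp_U_prefix (z eta s : R) : 0 < z < c -> 0 < eta -> 0 <= s ->
  whp (fun n w => `|\sum_(i < truncn (n%:R * s)) U z i w - n%:R * (s * z^-1)| <=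
                  eta * n%:R + z^-1).
Proof.
move=> zc eta0 s0.
have := @whp_row_incr z eta s (fun n => truncn (n%:R * s)) (fun=> 0%N) zc eta0
  (fun n => (truncn_mul_near n s s0).1).
apply: whp_imp => n w _ _ /= h.
have z0 : 0 <= z^-1 by rewrite invr_ge0 ltW//; case/andP: zc.
have := truncn_mul_dist n s _ s0 z0.
move: h; rewrite ltr_norml !ler_norml => /andP[? ?] /andP[? ?].
by apply/andP; split; lra.
Qed.

Lemma whp_V_prefix (z eta s : R) : 0 < z < c -> 0 < eta -> 0 <= s ->
  whp (fun n w => `|\sum_(i < truncn (n%:R * s)) V z i w - n%:R * (s * M z)| <=
                  eta * n%:R + M z).
Proof.
move=> zc eta0 s0.
have := @whp_V_bd z eta s (fun n => truncn (n%:R * s)) zc eta0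
  (fun n => (truncn_mul_near n s s0).1).
apply: whp_imp => n w _ _ /= h.
have z0 : 0 <= M z by apply: mean_inv_ge0; case/andP: zc.
have := truncn_mul_dist n s _ s0 z0.
move: h; rewrite ltr_norml !ler_norml => /andP[? ?] /andP[? ?].
by apply/andP; split; lra.
Qed.

Definition stationary_speed (a z : R) : R := z^-1 + a * M z.

(** By [growth_incr] the time is the sum up the left edge, a M z per unit of n, plus n increments
    along the top row, which Burke's property makes i.i.d. of rate z. The constant M z absorbs the
    rounding of n a. *)
Lemma whp_growth (z eta a : R) : 0 < z < c -> 0 < eta -> 0 <= a ->
  whp (fun n w => `|growth_bd xi X z (truncn (n%:R * a)) n w -
         n%:R * stationary_speed a z| <= 2 * eta * n%:R + M z).
Proof.
move=> zc eta0 a0.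
have kD n : (id n)%:R <= 1 * n%:R :> R by rewrite mul1r.
have h1 := @whp_row_incr z eta 1 id (fun n => truncn (n%:R * a)) zc eta0 kD.
have h2 := @whp_V_bd z eta a (fun n => truncn (n%:R * a)) zc eta0
  (fun n => (truncn_mul_near n a a0).1).
apply: whp_imp (whp_and _ _ _ _ h1 h2) => n w _ _ /= [].
have z0 : 0 <= M z by apply: mean_inv_ge0; case/andP: zc.
have := truncn_mul_dist n a _ a0 z0.
rewrite /growth_bd growth_incr /stationary_speed.
rewrite !ltr_norml !ler_norml => /andP[? ?] /andP[? ?] /andP[? ?].
by apply/andP; split; lra.
Qed.

Lemma whp_origin (eta : R) : 0 < eta -> whp (fun n w => X 0%N 0%N w <= eta * n%:R).
Proof.
move=> eta0.
exists (c * eta)^-1, (fun n => [set w | eta * n%:R < X 0%N 0%N w]) => n n0.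
have n0' : 0 < n%:R :> R by rewrite ltr0n.
have en0 : 0 < eta * n%:R by rewrite mulr_gt0.
split; first exact: measurable_fun_lt_set; last by move=> w _ /negP; rewrite -leNgt.
have := law 1 (fun=> setT) (fun _ _ => eta * n%:R) (fun=> measurableT) (fun _ _ => ltW en0).
rewrite big_ord_recl big_ord0 mule1.
have -> : [set w | forall j, (j < 1)%N -> [set: R] (xi j w) /\
   (forall i, (i < 1)%N -> eta * n%:R < X i j w)] = [set w | eta * n%:R < X 0%N 0%N w].
  apply/seteqP; split => w /= h; first by have [_ /(_ 0%N isT)] := h 0%N isT.
  by case=> // _; split => // -[].
move=> ->; rewrite (integral_supp m c m_supp)// ?setTI; last first.
  by apply: measurable_EFin_expRN; exact: measurable_funM.
apply: (@le_trans _ _ (\int[m]_(x in `[c, +oo[) ((c * eta)^-1 / n%:R)%:E)%E).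
  apply: ge0_le_integral => //.
  - by apply: measurable_EFin_expRN; apply: measurable_funTS; exact: measurable_funM.
  - move=> x; rewrite /= in_itv /= andbT => cx; rewrite lee_fin big_ord_recl big_ord0 addr0.
    (* From y <= exp y with y = x eta n, and x >= c. *)
    rewrite expRN -invfM lef_pV2 ?posrE ?expR_gt0 ?mulr_gt0//.
    apply: (@le_trans _ _ (x * (eta * n%:R))); first by rewrite -mulrA ler_wpM2r// ltW.
    by apply: le_trans (expR_ge1Dx _); rewrite lerDr.
rewrite integral_cst//.
by rewrite [X in (_ * X)%E](_ : _ = 1%E) ?mule1//; exact: m_supp1.
Qed.

Variables (a L : R).
Hypothesis a_gt0 : 0 < a.
Hypothesis limL : {ae P, forall w, (fun n : nat =>
         n%:R^-1 * lpp_time (fun i j => X i j w)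
                     (truncn (n%:R * (1 : R))) (truncn (n%:R * a))) @ \oo --> L}.

Let G0 (n : nat) w := growth (fun i => X i.+1 0%N w) (fun j => X 0%N j.+1 w)
  (fun i j => X_bulk X i j w) (truncn (n%:R * a)) n.
Let G z n w := growth_bd xi X z (truncn (n%:R * a)) n w.

Let lppE n w : lpp_time (fun i j => X i j w) (truncn (n%:R * (1 : R))) (truncn (n%:R * a)) =
  X 0%N 0%N w + G0 n w.
Proof. by rewrite lpp_timeE /lpp_rec mulr1 natrK. Qed.

Let typ_X i j w : typ w -> 0 < X i j w.
Proof. by move=> Tw; have [] := Tw i j. Qed.

Let typ_xi j w : typ w -> c <= xi j w.
Proof. by move=> Tw; have [] := Tw 0%N j. Qed.

Let U_ge z i w : 0 < z < c -> typ w -> X i.+1 0%N w <= U z i w.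
Proof.
move=> /andP[z0 zc] Tw; rewrite /U /U_bd ler_pdivlMr// mulrC.
by rewrite ler_wpM2r ?(ltW (typ_X _ _ _ Tw))// (le_trans (ltW zc))// typ_xi.
Qed.

Let V_ge z i w : 0 < z < c -> typ w -> X 0%N i.+1 w <= V z i w.
Proof.
move=> /andP[z0 zc] Tw; have h := typ_xi i.+1 w Tw.
rewrite /V /V_bd ler_pdivlMr; last by lra.
rewrite mulrC ler_wpM2r ?(ltW (typ_X _ _ _ Tw))//; lra.
Qed.

Let U_mono z y i w : 0 < y -> y <= z -> typ w -> U z i w <= U y i w.
Proof.
move=> y0 yz Tw; rewrite /U /U_bd ler_wpM2l ?lef_pV2 ?posrE//; last by lra.
by rewrite mulr_ge0 ?(ltW (typ_X _ _ _ Tw))// (le_trans (ltW c_gt0))// typ_xi.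
Qed.

Let V_mono z y i w : z <= y -> y < c -> typ w -> V z i w <= V y i w.
Proof.
move=> zy yc Tw; have h := typ_xi i.+1 w Tw.
rewrite /V /V_bd ler_wpM2l ?lef_pV2 ?posrE//; [|by lra|by lra|by lra].
by rewrite mulr_ge0 ?(ltW (typ_X _ _ _ Tw))// (le_trans (ltW c_gt0)).
Qed.

Lemma time_constant_le z : 0 < z < c -> L <= stationary_speed a z.
Proof.
move=> zc; apply/ler_addgt0Pr => e e0.
pose eta := e / 4; have eta0 : 0 < eta by rewrite divr_gt0.
have z0 : 0 <= M z by apply: mean_inv_ge0; case/andP: zc.
have W := whp_and _ _ _ _ (whp_growth z eta a zc eta0 (ltW a_gt0)) (whp_origin eta eta0).
apply: (whp_limit_le P typ _ L _ setT _ (truncn (M z / eta)).+1 limL mtyp Ptyp) W _ => //.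
  by rewrite probability_setT.
move=> n w nn _ Tw [hG hX]; rewrite lppE.
have n0 : 0 < n%:R :> R by rewrite ltr0n (leq_trans _ nn).
have nM : M z <= eta * n%:R.
  rewrite mulrC -ler_pdivrMr// ltW// (lt_le_trans (truncnS_gt _))// ler_nat//.
rewrite ler_pdivrMl//.
have GG : G0 n w <= G z n w.
  by apply: ler_growth => [i|j]; [exact: U_ge|exact: V_ge].
move: hG; rewrite ler_norml -/(G z n w) => /andP[_ hG].
have : 4 * eta = e by rewrite /eta mulrC divfK.
move=> <-; lra.
Qed.

Lemma growth_bd_boundary_ge0 z w : 0 < z < c -> typ w ->
  (forall i, 0 <= U z i w) /\ (forall j, 0 <= V z j w).
Proof.
move=> /andP[z0 zc] Tw; split => i; apply: ltW.
  exact: (U_bd_gt0 xi X c c_gt0).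
exact: (V_bd_gt0 xi X c c_gt0).
Qed.

(** The two gap hypotheses say that a geodesic of the model z spending s n steps on an axis would
    push the model z1 or z2 beyond its own speed. There remain the exits within s n steps, whose
    boundary part is worth at most s z^-1 or s M z per unit of n. *)
Lemma time_constant_ge z z1 z2 s : 0 < z1 -> z1 <= z -> z <= z2 -> z2 < c -> 0 <= s ->
  stationary_speed a z1 - s * (z1^-1 - z^-1) < stationary_speed a z ->
  stationary_speed a z2 - s * (M z2 - M z) < stationary_speed a z ->
  stationary_speed a z - s * (z^-1 + M z) <= L.
Proof.
move=> z1_gt0 z1z zz2 z2c s0 gap1 gap2.
have zc : 0 < z < c by apply/andP; split; lra.
have z1c : 0 < z1 < c by apply/andP; split; lra.
have z2c' : 0 < z2 < c by apply/andP; split; lra.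
have Mz : 0 <= M z by apply: mean_inv_ge0; lra.
have Mz1 : 0 <= M z1 by apply: mean_inv_ge0; lra.
have Mz2 : 0 <= M z2 by apply: mean_inv_ge0; lra.
have iz : 0 <= z^-1 by rewrite invr_ge0; lra.
have iz1 : 0 <= z1^-1 by rewrite invr_ge0; lra.
apply/ler_addgt0Pr => e e0; rewrite -lerBlDr.
pose g1 := stationary_speed a z - (stationary_speed a z1 - s * (z1^-1 - z^-1)).
pose g2 := stationary_speed a z - (stationary_speed a z2 - s * (M z2 - M z)).
have g10 : 0 < g1 by rewrite subr_gt0.
have g20 : 0 < g2 by rewrite subr_gt0.
(* The factor 20 leaves room for the sum of all the error terms, each a small multiple of eta n once
   K <= eta n. *)
pose eta := Num.min e (Num.min g1 g2) / 20.
have eta0 : 0 < eta by rewrite divr_gt0// !lt_min e0 g10 g20.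
have etaE : 20 * eta = Num.min e (Num.min g1 g2) by rewrite /eta mulrC divfK.
have eta_e : 20 * eta <= e by rewrite etaE ge_min lexx.
have eta_g1 : 20 * eta <= g1 by rewrite etaE !ge_min lexx orbT.
have eta_g2 : 20 * eta <= g2 by rewrite etaE !ge_min lexx !orbT.
pose K := M z + M z1 + M z2 + z^-1 + z1^-1.
have WG := whp_growth z eta a zc eta0 (ltW a_gt0).
have WG1 := whp_growth z1 eta a z1c eta0 (ltW a_gt0).
have WG2 := whp_growth z2 eta a z2c' eta0 (ltW a_gt0).
have WU := whp_U_prefix z eta s zc eta0 s0.
have WU1 := whp_U_prefix z1 eta s z1c eta0 s0.
have WV := whp_V_prefix z eta s zc eta0 s0.
have WV2 := whp_V_prefix z2 eta s z2c' eta0 s0.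
have W := whp_and _ _ _ _ (whp_and _ _ _ _ WG (whp_and _ _ _ _ WG1 WG2))
  (whp_and _ _ _ _ (whp_and _ _ _ _ WU WU1) (whp_and _ _ _ _ WV WV2)).
apply: (whp_limit_ge P typ _ L _ setT _ (truncn (K / eta)).+1 limL mtyp Ptyp) W _ => //.
  by rewrite probability_setT.
move=> n w nn _ Tw [[hG [hG1 hG2]] [[hU hU1] [hV hV2]]]; rewrite lppE.
have n0 : 0 < n%:R :> R by rewrite ltr0n (leq_trans _ nn).
have nK : K <= eta * n%:R.
  rewrite mulrC -ler_pdivrMr// ltW// (lt_le_trans (truncnS_gt _))// ler_nat//.
rewrite /K in nK.
rewrite ler_pdivlMl//.
have X00 := typ_X 0%N 0%N w Tw.
have [Uz Vz] := growth_bd_boundary_ge0 z w zc Tw.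
have ne := ler_wpM2l (ltW n0) eta_e.
have ng1 := ler_wpM2l (ltW n0) eta_g1; have ng2 := ler_wpM2l (ltW n0) eta_g2.
have en0 : 0 < eta * n%:R by rewrite mulr_gt0.
rewrite /g1 in ng1; rewrite /g2 in ng2.
have sz : 0 <= n%:R * (s * z^-1) by rewrite !mulr_ge0.
have sM : 0 <= n%:R * (s * M z) by rewrite !mulr_ge0.
move: hG hG1 hG2 hU hU1 hV hV2; rewrite -/(G z n w) -/(G z1 n w) -/(G z2 n w) !ler_norml.
move=> /andP[hG _] /andP[_ hG1] /andP[_ hG2] /andP[hU hU'] /andP[hU1 _] /andP[hV hV'] /andP[hV2 _].
have [] := growth_exit_cases (U z ^~ w) (V z ^~ w) (fun i => X i.+1 0%N w)
  (fun j => X 0%N j.+1 w) (U z1 ^~ w) (V z1 ^~ w) (U z2 ^~ w) (V z2 ^~ w)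
  (fun i j => X_bulk X i j w) n (truncn (n%:R * a)) (truncn (n%:R * s)) (truncn (n%:R * s))
  Uz Vz (fun i => ltW (typ_X _ _ _ Tw)) (fun i => ltW (typ_X _ _ _ Tw))
  (fun i => U_mono z z1 i w z1_gt0 z1z Tw) (fun i => V_mono z z2 i w zz2 z2c Tw).
- rewrite -/(G0 n w) -[X in X <= _ -> _]/(G z n w) => h.
  by clear - h hG hG1 hG2 hU hU' hU1 hV hV' hV2 ne ng1 ng2 en0 nK sz sM X00 Mz Mz1 Mz2 iz iz1; lra.
- rewrite sumrB -[X in X <= _ -> _]/(G z n w) -[growth _ _ _ _ _]/(G z1 n w) => h.
  by clear - h hG hG1 hG2 hU hU' hU1 hV hV' hV2 ne ng1 ng2 en0 nK sz sM X00 Mz Mz1 Mz2 iz iz1; lra.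
- rewrite -/(G0 n w) -[X in X <= _ -> _]/(G z n w) => h.
  by clear - h hG hG1 hG2 hU hU' hU1 hV hV' hV2 ne ng1 ng2 en0 nK sz sM X00 Mz Mz1 Mz2 iz iz1; lra.
- rewrite sumrB -[X in X <= _ -> _]/(G z n w) -[growth _ _ _ _ _]/(G z2 n w) => h.
  by clear - h hG hG1 hG2 hU hU' hU1 hV hV' hV2 ne ng1 ng2 en0 nK sz sM X00 Mz Mz1 Mz2 iz iz1; lra.
Qed.

(** Here the horizontal axis is not compared with another parameter: on the event xi_0 < c + e the
    boundary exceeds the original weights by a fraction of at most 1 - z / (c + e), so following the
    axis to any length loses at most that fraction of z^-1 per unit of n. *)
Lemma time_constant_ge_flat z z2 s e : 0 < z -> z <= z2 -> z2 < c -> 0 <= s -> 0 < e ->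
  (0 < m `[c, (c + e)%R[%classic)%E ->
  stationary_speed a z2 - s * (M z2 - M z) < stationary_speed a z ->
  stationary_speed a z - s * M z - (1 - z / (c + e)) * z^-1 <= L.
Proof.
move=> z_gt0 zz2 z2c s0 e_gt0 me gap2.
have zc : 0 < z < c by apply/andP; split; lra.
have z2c' : 0 < z2 < c by apply/andP; split; lra.
have Mz : 0 <= M z by apply: mean_inv_ge0; lra.
have Mz2 : 0 <= M z2 by apply: mean_inv_ge0; lra.
have iz : 0 <= z^-1 by rewrite invr_ge0; lra.
have ce0 : 0 < c + e by lra.
pose q := 1 - z / (c + e).
have q0 : 0 <= q by rewrite subr_ge0 ler_pdivrMr//; lra.
have q1 : q <= 1 by rewrite lerBlDl lerDr divr_ge0; lra.
apply/ler_addgt0Pr => e1 e10; rewrite -lerBlDr.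
pose g2 := stationary_speed a z - (stationary_speed a z2 - s * (M z2 - M z)).
have g20 : 0 < g2 by rewrite subr_gt0.
pose eta := Num.min e1 g2 / 20.
have eta0 : 0 < eta by rewrite divr_gt0// lt_min e10 g20.
have etaE : 20 * eta = Num.min e1 g2 by rewrite /eta mulrC divfK.
have eta_e : 20 * eta <= e1 by rewrite etaE ge_min lexx.
have eta_g2 : 20 * eta <= g2 by rewrite etaE ge_min lexx orbT.
pose K := M z + M z2 + z^-1.
have WG := whp_growth z eta a zc eta0 (ltW a_gt0).
have WG2 := whp_growth z2 eta a z2c' eta0 (ltW a_gt0).
have WU := whp_U_prefix z eta 1 zc eta0 ler01.
have WV := whp_V_prefix z eta s zc eta0 s0.
have WV2 := whp_V_prefix z2 eta s z2c' eta0 s0.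
have W := whp_and _ _ _ _ (whp_and _ _ _ _ WG WG2)
  (whp_and _ _ _ _ WU (whp_and _ _ _ _ WV WV2)).
pose F := [set w | xi 0%N w < c + e].
have mF : measurable F by exact: measurable_fun_lt_set.
have PF : (0 < P F)%E.
  apply: (lt_le_trans me).
  have := law 1 (fun=> `[c, (c + e)%R[%classic) (fun _ _ => 0) (fun=> measurable_itv _) (fun _ _ => lexx _).
  rewrite big_ord_recl big_ord0 mule1.
  under eq_integral do rewrite big_ord_recl big_ord0 addr0 mulr0 oppr0 expR0.
  rewrite integral_cst// mul1e => <-; apply: le_measure; rewrite ?inE//.
    apply: (measurable_forall_lt 1 (fun j => [set w | `[c, (c + e)%R[%classic (xi j w) /\
      forall i, (i < 1)%N -> 0 < X i j w])) => j.
    apply: measurableI; first exact: preimage_measurable.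
    apply: (measurable_forall_lt 1 (fun i => [set w | 0 < X i j w])) => i.
    exact: measurable_fun_lt_set.
  by move=> w /= /(_ 0%N isT)[]; rewrite /F /= in_itv /= => /andP[].
apply: (whp_limit_ge P typ _ L _ F _ (truncn (K / eta)).+1 limL mtyp Ptyp mF PF W).
move=> n w nn Fw Tw [[hG hG2] [hU [hV hV2]]]; rewrite lppE.
have n0 : 0 < n%:R :> R by rewrite ltr0n (leq_trans _ nn).
have nK : K <= eta * n%:R.
  rewrite mulrC -ler_pdivrMr// ltW// (lt_le_trans (truncnS_gt _))// ler_nat//.
rewrite /K in nK.
rewrite ler_pdivlMl//.
have X00 := typ_X 0%N 0%N w Tw.
have [Uz Vz] := growth_bd_boundary_ge0 z w zc Tw.
have ne := ler_wpM2l (ltW n0) eta_e.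
have ng2 := ler_wpM2l (ltW n0) eta_g2.
have en0 : 0 < eta * n%:R by rewrite mulr_gt0.
rewrite /g2 in ng2.
have sM : 0 <= n%:R * (s * M z) by rewrite !mulr_ge0.
have qz : 0 <= n%:R * (q * z^-1) by rewrite !mulr_ge0.
move: hG hG2 hU hV hV2; rewrite -/(G z n w) -/(G z2 n w) !ler_norml.
move=> /andP[hG _] /andP[_ hG2] /andP[hU hU'] /andP[hV hV'] /andP[hV2 _].
rewrite -/q.
have [] := growth_exit_cases_dominated (U z ^~ w) (V z ^~ w) (fun i => X i.+1 0%N w)
  (fun j => X 0%N j.+1 w) (U z2 ^~ w) (V z2 ^~ w)
  (fun i j => X_bulk X i j w) n (truncn (n%:R * a)) (truncn (n%:R * s))
  Vz (fun i => ltW (typ_X _ _ _ Tw))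
  (fun i => U_ge z i w zc Tw) (fun i => V_mono z z2 i w zz2 z2c Tw).
- rewrite -/(G0 n w) -[X in X <= _ -> _]/(G z n w) => h.
  (* U - X = U (1 - z / xi_0), and xi_0 < c + e on [F]. *)
  have h' : \sum_(i < n) (U z i w - X i.+1 0%N w) <= q * \sum_(i < n) U z i w.
    rewrite mulr_sumr; apply: ler_sum => i _.
    have xi0 : 0 < xi 0%N w by apply: (lt_le_trans c_gt0); exact: typ_xi.
    have XE : X i.+1 0%N w = U z i w * (z / xi 0%N w).
      rewrite /U /U_bd; field.
      by rewrite !gt_eqF.
    rewrite [in leLHS]XE /q mulrBl mul1r lerD2l lerN2 mulrC ler_wpM2l//.
    by rewrite ler_wpM2l ?(ltW z_gt0)// lef_pV2 ?posrE// ltW.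
  move: hU'; rewrite mulr1 natrK mul1r => hU'.
  have hq := ler_wpM2l q0 hU'.
  have qe : q * (eta * n%:R) <= eta * n%:R by rewrite ler_piMl// ltW.
  have qi : q * z^-1 <= z^-1 by rewrite ler_piMl.
  have hq1 : q * (\sum_(i < n) U z i w - n%:R * z^-1) =
             q * (\sum_(i < n) U z i w) - n%:R * (q * z^-1) by ring.
  have hq2 : q * (eta * n%:R + z^-1) = q * (eta * n%:R) + q * z^-1 by ring.
  rewrite hq1 hq2 in hq.
  by clear - h h' hq qe qi hG hG2 hU hU' hV hV' hV2 ne ng2 en0 nK sM qz X00 Mz Mz2 iz; lra.
- rewrite -/(G0 n w) -[X in X <= _ -> _]/(G z n w) => h.
  by clear - h hG hG2 hU hU' hV hV' hV2 ne ng2 en0 nK sM qz X00 Mz Mz2 iz; lra.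
- rewrite sumrB -[X in X <= _ -> _]/(G z n w) -[growth _ _ _ _ _]/(G z2 n w) => h.
  by clear - h hG hG2 hU hU' hV hV' hV2 ne ng2 en0 nK sM qz X00 Mz Mz2 iz; lra.
Qed.

End TimeConstantBounds.

(** * The variational formula *)

Section MeanInverse.
Context {R : realType}.
Variables (m : probability R R) (c : R).
Hypothesis c_gt0 : 0 < c.
Hypothesis m_supp : m (~` `[c, +oo[%classic) = 0%E.

Local Notation M := (mean_inv m c).

(** The derivative of [mean_inv] in z. *)
Definition mean_inv2 (z : R) : R := \int[m]_(x in `[c, +oo[%classic) ((x - z) ^+ 2)^-1.

Lemma integrable_inv2 (z : R) : z < c ->
  m.-integrable `[c, +oo[%classic (EFin \o (fun x => ((x - z) ^+ 2)^-1)).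
Proof.
move=> zc; apply: (integrable_bounded m c _ ((c - z) ^+ 2)^-1).
  by apply: measurable_funV; apply: measurable_funX; exact: measurable_funB.
move=> x cx; have xz : 0 < c - z by rewrite subr_gt0.
have xz' : 0 < x - z by lra.
rewrite ger0_norm ?invr_ge0 ?exprn_ge0 ?(ltW xz')// lef_pV2 ?posrE ?exprn_gt0//.
by rewrite lerXn2r ?nnegrE ?(ltW xz') ?(ltW xz)//; lra.
Qed.

Lemma Rintegral_le_cst (f : R -> R) (K : R) :
  m.-integrable `[c, +oo[%classic (EFin \o f) -> (forall x, c <= x -> f x <= K) ->
  \int[m]_(x in `[c, +oo[%classic) f x <= K.
Proof.
move=> intf fK.
apply: (@le_trans _ _ (\int[m]_(x in `[c, +oo[%classic) K)).
  apply: le_Rintegral => //.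
  - by apply: (integrable_bounded m c _ `|K|).
  - by move=> x; rewrite /= in_itv /= andbT; exact: fK.
rewrite Rintegral_cst//.
rewrite [fine _](_ : _ = 1) ?mulr1//.
exact: (congr1 fine (m_supp1 m c m_supp)).
Qed.

(** The remainder in the first-order expansion of 1 / (x - z) is exactly (y - z)^2 / ((x - z)^2 (x -
    y)). Integrating it gives convexity and a quadratic bound at once, without differentiating under
    the integral. *)
Lemma mean_inv_expand (y z : R) : y < c -> z < c ->
  0 <= M y - M z - (y - z) * mean_inv2 z <= (y - z) ^+ 2 / ((c - z) ^+ 2 * (c - y)).
Proof.
move=> yc zc.
have iy := integrable_inv m c y yc; have iz := integrable_inv m c z zc.
have i2 := integrable_inv2 z zc.
have mC : measurable (`[c, +oo[%classic : set R) by [].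
have i2' : m.-integrable `[c, +oo[%classic (EFin \o (fun x => (y - z) * ((x - z) ^+ 2)^-1)).
  rewrite (_ : _ \o _ = fun x => ((y - z)%:E * (((x - z) ^+ 2)^-1)%:E)%E)//.
  exact: integrableZl.
have iyz : m.-integrable `[c, +oo[%classic (EFin \o (fun x => (x - y)^-1 - (x - z)^-1)).
  exact: (integrableB mC iy iz).
have iall : m.-integrable `[c, +oo[%classic
    (EFin \o (fun x => (x - y)^-1 - (x - z)^-1 - (y - z) * ((x - z) ^+ 2)^-1)).
  exact: (integrableB mC iyz i2').
rewrite /mean_inv /mean_inv2 -RintegralZl// -RintegralB// -RintegralB//.
have e x : c <= x -> (x - y)^-1 - (x - z)^-1 - (y - z) * ((x - z) ^+ 2)^-1 =
    (y - z) ^+ 2 / ((x - z) ^+ 2 * (x - y)).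
  by move=> cx; field; rewrite !gt_eqF; lra.
apply/andP; split.
  apply: Rintegral_ge0 => x /=; rewrite in_itv /= andbT => cx; rewrite e//.
  by rewrite divr_ge0 ?sqr_ge0// mulr_ge0 ?sqr_ge0//; lra.
apply: Rintegral_le_cst => // x cx; rewrite e//.
rewrite ler_wpM2l ?sqr_ge0// lef_pV2 ?posrE ?mulr_gt0 ?exprn_gt0//; try lra.
apply: ler_pM; rewrite ?sqr_ge0//; [by lra| |by lra].
by rewrite lerXn2r ?nnegrE//; lra.
Qed.

Lemma mean_inv2_le (z : R) : z < c -> mean_inv2 z <= ((c - z) ^+ 2)^-1.
Proof.
move=> zc; apply: Rintegral_le_cst; first exact: integrable_inv2.
move=> x cx; rewrite lef_pV2 ?posrE ?exprn_gt0//; try lra.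
by rewrite lerXn2r ?nnegrE//; lra.
Qed.

Lemma mean_inv2_lipschitz (b y z : R) : b < c -> y <= b -> z <= b ->
  `|mean_inv2 y - mean_inv2 z| <= 2 / (c - b) ^+ 3 * `|y - z|.
Proof.
move=> bc.
wlog yz : y z / z <= y.
  move=> h yb zb; have [zy|/ltW yz] := leP z y; first exact: h.
  by rewrite distrC (distrC y); exact: h.
move=> yb zb.
have iy : y < c by lra. have iz : z < c by lra.
have i2y := integrable_inv2 y iy; have i2z := integrable_inv2 z iz.
have mC : measurable (`[c, +oo[%classic : set R) by [].
have iyz : m.-integrable `[c, +oo[%classic
    (EFin \o (fun x => ((x - y) ^+ 2)^-1 - ((x - z) ^+ 2)^-1)).
  exact: (integrableB mC i2y i2z).
rewrite /mean_inv2 -RintegralB//.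
have cb : 0 < c - b by lra.
have e x : c <= x -> ((x - y) ^+ 2)^-1 - ((x - z) ^+ 2)^-1 =
    ((x - y)^-1 * (x - z)^-1 ^+ 2 + (x - y)^-1 ^+ 2 * (x - z)^-1) * (y - z).
  by move=> cx; field; rewrite !gt_eqF; lra.
rewrite !ger0_norm; last 2 first.
- by rewrite subr_ge0.
- apply: Rintegral_ge0 => x /=; rewrite in_itv /= andbT => cx; rewrite e//.
  have h1 : 0 <= (x - y)^-1 by rewrite invr_ge0; lra.
  have h2 : 0 <= (x - z)^-1 by rewrite invr_ge0; lra.
  by rewrite mulr_ge0 ?subr_ge0// addr_ge0// mulr_ge0// exprn_ge0.
apply: Rintegral_le_cst => // x cx; rewrite e// ler_wpM2r ?subr_ge0//.
have h u : u <= b -> 0 <= (x - u)^-1 <= (c - b)^-1.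
  move=> ub; rewrite invr_ge0 lef_pV2 ?posrE; [|lra|lra].
  by apply/andP; split; lra.
have /andP[y0 y1] := h y yb; have /andP[z0 z1] := h z zb.
rewrite -exprVn (_ : 2 * (c - b)^-1 ^+ 3 =
  (c - b)^-1 * (c - b)^-1 ^+ 2 + (c - b)^-1 ^+ 2 * (c - b)^-1); last by ring.
by apply: lerD; apply: ler_pM; rewrite ?exprn_ge0// lerXn2r ?nnegrE// (le_trans _ y1).
Qed.

Lemma continuous_mean_inv2 (z : R) : z < c -> {for z, continuous mean_inv2}.
Proof.
move=> zc; pose b := (z + c) / 2.
have zb : z < b by rewrite /b; lra.
have bc : b < c by rewrite /b; lra.
have K0 : 0 < 2 / (c - b) ^+ 3 by rewrite divr_gt0// exprn_gt0//; lra.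
apply/cvgrPdist_le => e e0; near=> y.
have yb : y <= b.
  by apply: ltW; near: y; exact: lt_nbhsl.
apply: (le_trans (mean_inv2_lipschitz b z y bc (ltW zb) yb)).
rewrite mulrC -ler_pdivlMr//; near: y.
have e1 : 0 < e / (2 / (c - b) ^+ 3) by rewrite divr_gt0.
by apply: filterS (nbhsx_ballx z _ e1) => y /ltW.
Unshelve. all: by end_near. Qed.

(** The derivative of the stationary speed in z. *)
Definition speed_slope (a z : R) : R := - (z ^+ 2)^-1 + a * mean_inv2 z.

(** The condition on y ensures y >= z / 2 and c - y >= (c - z) / 2, whence the factors 2 in the
    constant. *)
Lemma stationary_speed_expand (a y z : R) : 0 <= a -> 0 < z < c ->
  `|y - z| <= Num.min z (c - z) / 2 ->
  stationary_speed m c a y - stationary_speed m c a z <=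
    (y - z) * speed_slope a z + (2 / z ^+ 3 + 2 * a / (c - z) ^+ 3) * (y - z) ^+ 2.
Proof.
move=> a0 /andP[z0 zc] hyz.
have hz : `|y - z| <= z / 2.
  by apply: (le_trans hyz); rewrite ler_pM2r// ge_min lexx.
have hc : `|y - z| <= (c - z) / 2.
  by apply: (le_trans hyz); rewrite ler_pM2r// ge_min lexx orbT.
move: hz hc; rewrite !ler_norml => /andP[hz1 hz2] /andP[hc1 hc2].
have yz : z / 2 <= y by lra.
have y0 : 0 < y by lra.
have yc : (c - z) / 2 <= c - y by lra.
have yc' : y < c by lra.
have /andP[_ h] := mean_inv_expand y z yc' zc.
have cz : 0 < c - z by lra.
have e1 : y^-1 - z^-1 = - (y - z) * (z ^+ 2)^-1 + (y - z) ^+ 2 / (z ^+ 2 * y).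
  by field; rewrite !gt_eqF.
have b1 : (y - z) ^+ 2 / (z ^+ 2 * y) <= (2 / z ^+ 3) * (y - z) ^+ 2.
  rewrite mulrC ler_wpM2r ?sqr_ge0// (_ : 2 / z ^+ 3 = (z ^+ 2 * (z / 2))^-1); last first.
    by field; rewrite gt_eqF.
  rewrite lef_pV2 ?posrE ?mulr_gt0 ?exprn_gt0 ?divr_gt0//.
  by rewrite ler_pM2l ?exprn_gt0.
have b2 : (y - z) ^+ 2 / ((c - z) ^+ 2 * (c - y)) <= (2 / (c - z) ^+ 3) * (y - z) ^+ 2.
  rewrite mulrC ler_wpM2r ?sqr_ge0//.
  rewrite (_ : 2 / (c - z) ^+ 3 = ((c - z) ^+ 2 * ((c - z) / 2))^-1); last first.
    by field; rewrite gt_eqF.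
  rewrite lef_pV2 ?posrE ?mulr_gt0 ?exprn_gt0 ?divr_gt0//; last by lra.
  by rewrite ler_pM2l ?exprn_gt0.
have := ler_wpM2l a0 (le_trans h b2).
rewrite /stationary_speed /speed_slope -/(mean_inv m c); move: e1 b1; lra.
Qed.

Lemma speed_slope_root (a z2 : R) : 0 < a -> 0 < z2 < c -> 0 <= speed_slope a z2 ->
  exists2 z, 0 < z < c & speed_slope a z = 0.
Proof.
move=> a0 /andP[z20 z2c] Dz2.
(* Close enough to 0 for a nonpositive slope: z1^-2 = (1 + a)^2 (c / 2)^-2, while the positive term
   is at most a (c / 2)^-2 because z1 <= c / 2. *)
pose z1 := c / (2 * (1 + a)).
have z10 : 0 < z1 by rewrite divr_gt0// mulr_gt0//; lra.
have z1c : z1 <= c / 2.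
  rewrite /z1 invfM mulrA ler_piMr ?divr_ge0 ?(ltW c_gt0)// invf_le1; lra.
have z1c' : z1 < c by lra.
have Dz1 : speed_slope a z1 <= 0.
  have h := mean_inv2_le z1 z1c'.
  have h2 : ((c - z1) ^+ 2)^-1 <= ((c / 2) ^+ 2)^-1.
    rewrite lef_pV2 ?posrE ?exprn_gt0 ?divr_gt0//; last by lra.
    by rewrite lerXn2r ?nnegrE ?divr_ge0 ?(ltW c_gt0)//; lra.
  have := ler_wpM2l (ltW a0) (le_trans h h2).
  have e : (z1 ^+ 2)^-1 = (1 + a) ^+ 2 * ((c / 2) ^+ 2)^-1.
    by rewrite /z1; field; rewrite !gt_eqF//; lra.
  rewrite /speed_slope e; set q := ((c / 2) ^+ 2)^-1.
  have q0 : 0 <= q by rewrite invr_ge0 sqr_ge0.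
  have : a * q <= (1 + a) ^+ 2 * q by rewrite ler_wpM2r//; nra.
  by lra.
have root (u v : R) : 0 < u -> u <= v -> v < c ->
    Num.min (speed_slope a u) (speed_slope a v) <= 0 <=
    Num.max (speed_slope a u) (speed_slope a v) ->
    exists2 z, 0 < z < c & speed_slope a z = 0.
  move=> u0 uv vc h.
  have [|z zuv Dz] := IVT uv _ h; last first.
    move: zuv; rewrite in_itv /= => /andP[uz zv].
    by exists z => //; apply/andP; split; lra.
  apply: continuous_in_subspaceT => z; rewrite inE /= in_itv /= => /andP[uz zv].
  apply: cvgD; last by apply: cvgMr; apply: continuous_mean_inv2; lra.
  apply: cvgN; apply: cvgV; first by rewrite expf_neq0// gt_eqF//; lra.
  by apply: exprn_continuous.
(* The order of the two points is unknown, so the intermediate value theorem is applied either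
   way. *)
have [z12|/ltW z21] := leP z1 z2.
  apply: (root z1 z2) => //; rewrite ge_min Dz1 /=.
  by rewrite le_max Dz2 orbT.
apply: (root z2 z1) => //; rewrite ge_min Dz1 orbT /=.
by rewrite le_max Dz2.
Qed.

End MeanInverse.

Section Variational.
Context {R : realType} {d : measure_display} {Omega : measurableType d}.
Variables (P : probability Omega R) (m : probability R R).
Variables (xi : nat -> Omega -> R) (X : nat -> nat -> Omega -> R) (c : R).
Hypothesis mxi : forall j, measurable_fun setT (xi j).
Hypothesis mX : forall i j, measurable_fun setT (X i j).
Hypothesis law : joint_law P m xi X.
Hypothesis c_gt0 : 0 < c.
Hypothesis m_supp : m (~` `[c, +oo[%classic) = 0%E.
Hypothesis m_edge : forall e, 0 < e -> (0 < m `[c, (c + e)%R[%classic)%E.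
Variables (a L : R).
Hypothesis a_gt0 : 0 < a.
Hypothesis limL : {ae P, forall w, (fun n : nat =>
         n%:R^-1 * lpp_time (fun i j => X i j w)
                     (truncn (n%:R * (1 : R))) (truncn (n%:R * a))) @ \oo --> L}.

Local Notation M := (mean_inv m c).
Local Notation f := (stationary_speed m c a).
Local Notation D := (speed_slope m c a).

Lemma small_step (C s b : R) : 0 < C -> 0 < s -> 0 < b ->
  exists h, [/\ 0 < h, h <= b & C * h < s].
Proof.
move=> C0 s0 b0; exists (Num.min b (s / (2 * C))); split.
- by rewrite lt_min b0 divr_gt0// mulr_gt0.
- by rewrite ge_min lexx.
apply: (@le_lt_trans _ _ (C * (s / (2 * C)))).
  by rewrite ler_pM2l// ge_min lexx orbT.
rewrite (_ : C * (s / (2 * C)) = s / 2); first by lra.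
by field; rewrite gt_eqF.
Qed.

(** Moving z by h away from a critical point raises the speed by at most C h^2, whereas s n steps on
    an axis gain at least s h z^-2 or s h [mean_inv2], which is linear in h. Hence both gap
    conditions hold for small h, whatever s > 0. *)
Lemma time_constant_ge_char z s : 0 < z < c -> D z = 0 -> 0 < s ->
  f z - s * (z^-1 + M z) <= L.
Proof.
move=> /[dup] zc /andP[z0 z_c] Dz s0.
pose C := 2 / z ^+ 3 + 2 * a / (c - z) ^+ 3.
have cz : 0 < c - z by lra.
have C0 : 0 < C by rewrite addr_gt0// divr_gt0 ?mulr_gt0 ?exprn_gt0.
have b0 : 0 < Num.min z (c - z) / 2 by rewrite divr_gt0// lt_min z0 cz.
have z2 : 0 < (z ^+ 2)^-1 by rewrite invr_gt0 exprn_gt0.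
have az : 0 < mean_inv2 m c z.
  have : a * mean_inv2 m c z = (z ^+ 2)^-1 by move: Dz; rewrite /speed_slope; lra.
  by move=> h; move: z2; rewrite -h pmulr_rgt0.
have t0 : 0 < s * Num.min ((z ^+ 2)^-1) (mean_inv2 m c z).
  by rewrite mulr_gt0// lt_min z2 az.
have [h [h0 hb Ch]] := small_step _ _ _ C0 t0 b0.
have hz : h < z.
  apply: (le_lt_trans hb); rewrite ltr_pdivrMr//.
  by apply: (@le_lt_trans _ _ z); [rewrite ge_min lexx|lra].
have hc : h < c - z.
  apply: (le_lt_trans hb); rewrite ltr_pdivrMr//.
  by apply: (@le_lt_trans _ _ (c - z)); [rewrite ge_min lexx orbT|lra].
have Ch1 : C * h < s * (z ^+ 2)^-1.
  by apply: (lt_le_trans Ch); rewrite ler_pM2l// ge_min lexx.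
have Ch2 : C * h < s * mean_inv2 m c z.
  by apply: (lt_le_trans Ch); rewrite ler_pM2l// ge_min lexx orbT.
apply: (time_constant_ge P m xi X c mxi mX law c_gt0 m_supp a L a_gt0 limL z (z - h) (z + h) s);
  try lra.
- have := stationary_speed_expand m c m_supp a (z - h) z (ltW a_gt0) zc.
  rewrite (_ : z - h - z = - h); last by ring.
  rewrite normrN ger0_norm ?(ltW h0)// => /(_ hb).
  rewrite Dz mulr0 add0r sqrrN -/C => hf.
  have hinv : h * (z ^+ 2)^-1 <= (z - h)^-1 - z^-1.
    rewrite -subr_ge0 (_ : _ - _ = h ^+ 2 / (z ^+ 2 * (z - h))); last first.
      by field; rewrite !gt_eqF//; lra.
    by rewrite divr_ge0 ?sqr_ge0// mulr_ge0 ?sqr_ge0//; lra.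
  have := ler_wpM2l (ltW s0) hinv.
  have : C * h ^+ 2 < s * (h * (z ^+ 2)^-1).
    by rewrite (mulrC h) mulrA expr2 mulrA ltr_pM2r.
  by lra.
- have := stationary_speed_expand m c m_supp a (z + h) z (ltW a_gt0) zc.
  rewrite (_ : z + h - z = h); last by ring.
  rewrite ger0_norm ?(ltW h0)// => /(_ hb).
  rewrite Dz mulr0 add0r -/C => hf.
  have zhc : z + h < c by lra.
  have /andP[hM _] := mean_inv_expand m c m_supp (z + h) z zhc z_c.
  move: hM; rewrite (_ : z + h - z = h); last by ring.
  move=> hM.
  have hM' : h * mean_inv2 m c z <= M (z + h) - M z by lra.
  have := ler_wpM2l (ltW s0) hM'.
  have : C * h ^+ 2 < s * (h * mean_inv2 m c z).
    rewrite (_ : s * (h * _) = s * mean_inv2 m c z * h); last by ring.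
    by rewrite expr2 mulrA ltr_pM2r.
  by lra.
Qed.

(** A negative slope makes the speed at z + h strictly smaller, which settles late vertical exits
    for any s; the horizontal ones are handled through the rate xi_0. *)
Lemma time_constant_ge_negative_slope z s e : 0 < z < c -> D z < 0 -> 0 <= s -> 0 < e ->
  f z - s * M z - (z^-1 - (c + e)^-1) <= L.
Proof.
move=> /[dup] zc /andP[z0 z_c] Dz s0 e0.
pose C := 2 / z ^+ 3 + 2 * a / (c - z) ^+ 3.
have cz : 0 < c - z by lra.
have C0 : 0 < C by rewrite addr_gt0// divr_gt0 ?mulr_gt0 ?exprn_gt0.
have b0 : 0 < Num.min z (c - z) / 2 by rewrite divr_gt0// lt_min z0 cz.
have Dz' : 0 < - D z by lra.
have [h [h0 hb Ch]] := small_step _ _ _ C0 Dz' b0.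
have hc : h < c - z.
  apply: (le_lt_trans hb); rewrite ltr_pdivrMr//.
  by apply: (@le_lt_trans _ _ (c - z)); [rewrite ge_min lexx orbT|lra].
have -> : z^-1 - (c + e)^-1 = (1 - z / (c + e)) * z^-1.
  by field; rewrite !gt_eqF//; lra.
apply: (time_constant_ge_flat P m xi X c mxi mX law c_gt0 m_supp a L a_gt0 limL z (z + h) s e) => //;
  [by lra|by lra|exact: m_edge|].
have := stationary_speed_expand m c m_supp a (z + h) z (ltW a_gt0) zc.
rewrite (_ : z + h - z = h); last by ring.
rewrite ger0_norm ?(ltW h0)// -/C => /(_ hb) hf.
have zhc : z + h < c by lra.
have /andP[hM _] := mean_inv_expand m c m_supp (z + h) z zhc z_c.
move: hM; rewrite (_ : z + h - z = h); last by ring.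
move=> hM.
have M2 : 0 <= mean_inv2 m c z by apply: Rintegral_ge0 => x _; rewrite invr_ge0 sqr_ge0.
have hM2 := mulr_ge0 (ltW h0) M2.
have hM' : 0 <= M (z + h) - M z by lra.
have := mulr_ge0 s0 hM'.
have : C * h ^+ 2 < h * - D z by rewrite expr2 mulrA mulrC ltr_pM2l.
by lra.
Qed.

Lemma time_constant_near_optimal (e : R) : 0 < e ->
  exists2 z, 0 < z < c & f z - e <= L.
Proof.
move=> e0.
have [[z2 z2c Dz2]|noroot] := pselect (exists2 z, 0 < z < c & 0 <= D z).
  have [z zc Dz] := speed_slope_root m c c_gt0 m_supp a z2 a_gt0 z2c Dz2.
  exists z => //; have z0 : 0 < z by case/andP: zc.
  have Mz : 0 <= M z by apply: (mean_inv_ge0 m c); case/andP: zc.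
  have iz : 0 < z^-1 by rewrite invr_gt0.
  have := time_constant_ge_char z (e / (z^-1 + M z)) zc Dz.
  rewrite divfK; last by rewrite gt_eqF//; lra.
  by apply; rewrite divr_gt0//; lra.
(* All slopes being negative, z is taken close to c. The three losses z^-1 - c^-1, c^-1 - (c +
   eps)^-1 and s M z are each at most e / 3. *)
pose z := (c^-1 + e / 3)^-1.
have ic : 0 < c^-1 by rewrite invr_gt0.
have iz : z^-1 = c^-1 + e / 3 by rewrite /z invrK.
have z0 : 0 < z by rewrite invr_gt0; lra.
have z_c : z < c by rewrite -[ltRHS]invrK ltf_pV2 ?posrE; lra.
have zc : 0 < z < c by rewrite z0.
exists z => //.
have Mz : 0 <= M z by exact: (mean_inv_ge0 m c).
have Dz : D z < 0 by rewrite ltNge; apply/negP => h; apply: noroot; exists z.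
pose eps := c ^+ 2 * e / 3.
have eps0 : 0 < eps by rewrite /eps divr_gt0// mulr_gt0// exprn_gt0.
pose s := e / 3 / (M z + 1).
have s0 : 0 <= s by rewrite !divr_ge0//; lra.
have := time_constant_ge_negative_slope z s eps zc Dz s0 eps0.
have : s * M z <= e / 3.
  rewrite /s mulrAC ler_pdivrMr; last by lra.
  by rewrite ler_pM2l; lra.
have : c^-1 - (c + eps)^-1 <= e / 3.
  have -> : c^-1 - (c + eps)^-1 = eps / (c * (c + eps)) by field; rewrite !gt_eqF; lra.
  rewrite ler_pdivrMr; last by rewrite mulr_gt0; lra.
  rewrite /eps; have : 0 <= c * eps by rewrite mulr_ge0; lra.
  rewrite expr2 => h; have := mulr_ge0 (ltW e0) h; rewrite /eps expr2; lra.
rewrite iz; lra.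
Qed.

End Variational.

Lemma integral_is_derive {R : realType} (F f : R -> R) (a b : R) : a < b ->
  (forall x, a <= x <= b -> is_derive x 1 F (f x)) ->
  (forall x, a <= x <= b -> {for x, continuous f}) ->
  (\int[lebesgue_measure]_(x in `]a, b[) (f x)%:E = (F b - F a)%:E)%E.
Proof.
move=> ab dF cf.
have cf' : {within `[a, b], continuous f}.
  by apply: continuous_in_subspaceT => x; rewrite inE /= in_itv /=; exact: cf.
have mf : measurable_fun (`[a, b]%classic : set R) f.
  by apply: subspace_continuous_measurable_fun.
have cF x : a <= x <= b -> {for x, continuous F}.
  by move=> /dF h; apply: differentiable_continuous; apply/derivable1_diffP; exact: ex_derive.
have mo : measurable_fun (`]a, b[%classic : set R) (EFin \o f).
  apply/measurable_EFinP; apply: (measurable_funS _ _ mf) => //.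
  by move=> x /=; rewrite !in_itv /= => /andP[/ltW -> /ltW ->].
have mc : measurable_fun (`[a, b[%classic : set R) (EFin \o f).
  apply/measurable_EFinP; apply: (measurable_funS _ _ mf) => //.
  by move=> x /=; rewrite !in_itv /= => /andP[-> /ltW ->].
rewrite (integral_itv_obnd_cbnd mo) (integral_itv_bndo_bndc mc).
rewrite (@continuous_FTC2 _ _ F _ _ ab cf')//.
- split.
  + move=> x; rewrite in_itv /= => /andP[/ltW ax /ltW xb].
    by apply: ex_derive; apply: dF; rewrite ax.
  + by apply: cvg_at_right_filter; apply: cF; rewrite lexx ltW.
  + by apply: cvg_at_left_filter; apply: cF; rewrite lexx ltW.
- move=> x; rewrite in_itv /= => /andP[/ltW ax /ltW xb].
  by rewrite derive1E; apply: derive_val; apply: dF; rewrite ax.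
Qed.

(** * Behaviour of the mean inverse at the edge *)

Section TailBounds.
Context {R : realType}.
Variables (m : probability R R) (c : R).

Local Notation M := (mean_inv m c).
Local Notation leb := (@lebesgue_measure R).

Definition edge_mass (s : R) : R := fine (m `[c, (c + s)%R[%classic).

(* [u / (x - c + u)] takes values in [(0, 1]], and exceeds [y] exactly when
   [x - c < u (1 - y) / y]. *)
Let ratio_tail (u y : R) : \bar R :=
  m ([set x | y < u / (x - c + u)] `&` `[c, +oo[%classic).

Lemma mean_inv_tail (u : R) : 0 < u ->
  (u * M (c - u))%:E = (\int[leb]_(y in `[0%R, +oo[) ratio_tail u y)%E /\
  measurable_fun (`[0%R, +oo[%classic : set R) (ratio_tail u).
Proof.
move=> u0.
have cu : c - u < c by lra.
have iM := integrable_inv m c _ cu.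
have mf : measurable_fun setT (fun x : R => u / (x - c + u)).
  apply: measurable_funM => //; apply: measurable_funV; apply: measurable_funD => //.
  exact: measurable_funB.
have mC : measurable (`[c, +oo[%classic : set R) by [].
have f0 (x : R) : `[c, +oo[%classic x -> 0 <= u / (x - c + u).
  by rewrite /= in_itv /= andbT => cx; rewrite divr_ge0//; lra.
have [<- h] := integral_tail m _ _ mC mf f0; split => //.
rewrite -RintegralZl// /Rintegral fineK; last first.
  apply: integrable_fin_num => //.
  exact: (integrableZl mC u iM).
by apply: eq_integral => x _; congr (_ / _)%:E; ring.
Qed.

Let ratio_tailE u y : 0 < u -> 0 < y < 1 -> ratio_tail u y = (edge_mass (u * (1 - y) / y))%:E.
Proof.
move=> u0 /andP[y0 y1]; rewrite /edge_mass fineK; last by rewrite fin_num_measure.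
congr (m _); apply/seteqP; split => x /=; rewrite !in_itv /= !andbT.
  move=> [h cx]; rewrite cx /=; move: h; rewrite ltr_pdivlMr; last by lra.
  by move=> h; rewrite -ltrBlDl ltr_pdivlMr//; lra.
move=> /andP[cx h]; split => //; rewrite ltr_pdivlMr; last by lra.
by move: h; rewrite -ltrBlDl ltr_pdivlMr//; lra.
Qed.

Let ratio_tail_ge1 u y : 0 < u -> 1 <= y -> ratio_tail u y = 0%E.
Proof.
move=> u0 y1; rewrite /ratio_tail (_ : _ `&` _ = set0) ?measure0//.
apply/seteqP; split => // x /=; rewrite in_itv /= andbT => -[h cx].
move: h; rewrite ltr_pdivlMr; last by lra.
suff : u <= y * (x - c + u) by lra.
by rewrite (@le_trans _ _ (1 * (x - c + u)))//; [lra|rewrite ler_wpM2r//; lra].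
Qed.

Let ratio_tail_le1 u y : (ratio_tail u y <= 1)%E.
Proof.
rewrite /ratio_tail; apply: probability_le1; apply: measurableI => //.
apply: measurable_fun_lt_set => //; apply: measurable_funM => //.
by apply: measurable_funV; apply: measurable_funD => //; exact: measurable_funB.
Qed.

Lemma mean_inv_tail_ge (u y0 J : R) (phi : R -> R) : 0 < u -> 0 < y0 < 1 ->
  measurable_fun (`]y0, 1[%classic : set R) phi ->
  (forall y, y0 < y < 1 -> 0 <= phi y <= edge_mass (u * (1 - y) / y)) ->
  (\int[leb]_(y in `]y0, 1%R[) (phi y)%:E = J%:E)%E -> J <= u * M (c - u).
Proof.
move=> u0 /andP[y00 y01] mphi hphi JE.
have [h mh] := mean_inv_tail u u0.
have sub : `]y0, 1[%classic `<=` (`[0%R, +oo[%classic : set R).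
  by move=> y /=; rewrite !in_itv /= andbT => /andP[/ltW yy _]; apply: le_trans yy; exact: ltW.
rewrite -lee_fin h -JE.
apply: (@le_trans _ _ (\int[leb]_(y in `]y0, 1%R[) ratio_tail u y)%E).
  apply: ge0_le_integral => //.
  - by move=> y /=; rewrite in_itv /= => /hphi/andP[]; rewrite lee_fin.
  - exact/measurable_EFinP.
  - exact: measurable_funS mh.
  - move=> y /=; rewrite in_itv /= => yy; have /andP[_ hy] := hphi y yy.
    rewrite ratio_tailE ?lee_fin//; move/andP: yy => [yy ->].
    by rewrite andbT (lt_trans y00).
by apply: ge0_subset_integral => //; move=> y _; exact: measure_ge0.
Qed.

(** Below the cut-off [y0] the mass is bounded by 1, which contributes at most [y0]; the edge
    asymptotics enter above it, through [phi]. *)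
Lemma mean_inv_tail_le (u y0 J : R) (phi : R -> R) : 0 < u -> 0 < y0 < 1 ->
  measurable_fun (`]y0, 1[%classic : set R) phi ->
  (forall y, y0 < y < 1 -> edge_mass (u * (1 - y) / y) <= phi y) ->
  (\int[leb]_(y in `]y0, 1%R[) (phi y)%:E = J%:E)%E -> u * M (c - u) <= y0 + J.
Proof.
move=> u0 /andP[y00 y01] mphi hphi JE.
have [h mh] := mean_inv_tail u u0.
have phi0 y : y0 < y < 1 -> 0 <= phi y.
  by move=> /hphi; apply: le_trans; rewrite fine_ge0// measure_ge0.
rewrite -lee_fin h EFinD -JE.
have -> : y0%:E = (\int[leb]_(y in `[0%R, +oo[) (\1_`[0%R, y0] y)%:E)%E.
  rewrite integral_indic// setIidl; last first.
    by move=> y /=; rewrite !in_itv /= andbT => /andP[].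
  by rewrite [RHS]lebesgue_measure_itv /= lte_fin y00 oppr0 adde0.
have sub : `]y0, 1[%classic `<=` (`[0%R, +oo[%classic : set R).
  by move=> y /=; rewrite !in_itv /= andbT => /andP[/ltW yy _]; apply: le_trans yy; exact: ltW.
pose phi' : R -> \bar R := (EFin \o phi) \_ `]y0, 1[%classic.
have mphi' : measurable_fun (`[0%R, +oo[%classic : set R) phi'.
  have mE : measurable_fun (`]y0, 1[%classic : set R) (EFin \o phi) by exact/measurable_EFinP.
  apply: measurable_funTS.
  exact: ((measurable_restrictT (EFin \o phi) (measurable_itv `]y0, 1[)).1 mE).
have -> : (\int[leb]_(y in `]y0, 1%R[) (phi y)%:E =
    \int[leb]_(y in `[0%R, +oo[) phi' y)%E.
  by rewrite -integral_mkcondr setIidr.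
have phi'0 (y : R) : (0 <= phi' y)%E.
  by rewrite /phi' patchE; case: ifPn => //; rewrite inE /= in_itv /= => /phi0; rewrite lee_fin.
have mind : measurable_fun (`[0%R, +oo[%classic : set R) (fun y => (\1_`[0%R, y0] y)%:E : \bar R).
  by apply/measurable_EFinP; exact: measurable_indic.
rewrite -ge0_integralD//.
apply: ge0_le_integral => //; first exact: emeasurable_funD.
move=> y /=; rewrite in_itv /= andbT => y_ge0.
have [yy0|y0y] := leP y y0.
  rewrite (le_trans (ratio_tail_le1 u y))// -[leLHS]adde0; apply: leeD => //.
  by rewrite indicE mem_set//= in_itv /= y_ge0.
have [y1|y1] := ltP y 1; last first.
  by rewrite ratio_tail_ge1// adde_ge0// lee_fin.
rewrite indicE memNset ?add0e; last first.
  by rewrite /= in_itv /= => /andP[_]; rewrite leNgt y0y.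
rewrite /phi' patchE mem_set; last by rewrite /= in_itv /= y0y.
rewrite ratio_tailE//; last by rewrite (lt_trans y00).
by rewrite /= lee_fin; apply: hphi; rewrite y0y.
Qed.

End TailBounds.

(** * The binomial series of (1 - y)^(nu + 1) *)

Section BinomialSeries.
Context {R : realType}.
Variable nu : R.
Hypothesis nu_ge : -1 <= nu.
Hypothesis nu_lt0 : nu < 0.

Local Notation a := (nu + 1).

Let a_ge0 : 0 <= a. Proof. by have := nu_ge; lra. Qed.
Let a_lt1 : a < 1. Proof. by have := nu_lt0; lra. Qed.

(** The Taylor coefficients of (1 - x)^(nu + 1). As the exponent lies in [0, 1), all of them after
    the first are nonpositive, and the estimates rest on this sign. *)
Definition bcoef (k : nat) : R := gbinom a k * (-1) ^+ k.

Lemma bcoef0 : bcoef 0 = 1.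
Proof. by rewrite /bcoef /gbinom big_ord0 fact0 divr1 mulr1. Qed.

Lemma bcoefS k : k.+1%:R * bcoef k.+1 = (k%:R - a) * bcoef k.
Proof.
rewrite /bcoef /gbinom big_ord_recr /= factS natrM exprS.
have k0 : k.+1%:R != 0 :> R by rewrite pnatr_eq0.
have f0 : (k`!)%:R != 0 :> R by rewrite pnatr_eq0 -lt0n fact_gt0.
by move: (k.+1%:R) k0 => K K0; field; rewrite K0 f0.
Qed.

Definition bpoly (n : nat) (x : R) : R := \sum_(k < n.+1) bcoef k * x ^+ k.

Lemma bpoly1E n : a * bpoly n 1 = (a - n%:R) * bcoef n.
Proof.
elim: n => [|n IHn]; first by rewrite /bpoly big_ord_recl big_ord0 bcoef0 expr1n; ring.
rewrite /bpoly big_ord_recr /= mulrDr -/(bpoly n 1) IHn expr1n mulr1.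
have := bcoefS n; rewrite -natr1; lra.
Qed.

(** Thus [bpoly n 1] is the product of the factors 1 - a / k for 1 <= k <= n, nonincreasing in n and
    within [0, 1]. *)
Lemma bpoly1S n : bpoly n.+1 1 = bpoly n 1 * (1 - a / n.+1%:R).
Proof.
rewrite /bpoly big_ord_recr /= -/(bpoly n 1) expr1n mulr1.
have n0 : n.+1%:R != 0 :> R by rewrite pnatr_eq0.
have h1 := bcoefS n; have h2 := bpoly1E n.
have -> : bcoef n.+1 = - (a * bpoly n 1) / n.+1%:R.
  apply: (mulfI n0); rewrite h1 h2.
  by move: (n.+1%:R) n0 => K K0; field; rewrite K0.
by move: (n.+1%:R) n0 => K K0; field; rewrite K0.
Qed.

Lemma bpoly1_bound n : 0 <= bpoly n 1 <= 1.
Proof.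
elim: n => [|n /andP[h0 h1]]; first by rewrite /bpoly big_ord_recl big_ord0 bcoef0 expr1n; lra.
rewrite bpoly1S.
have q0 : 0 <= a / n.+1%:R by rewrite divr_ge0 ?ler0n.
have q1 : a / n.+1%:R <= 1.
  rewrite ler_pdivrMr ?ltr0n// mul1r.
  by apply: (@le_trans _ _ 1); [exact: ltW|rewrite ler1n].
move: (a / n.+1%:R) q0 q1 => q q0 q1.
by apply/andP; split; [rewrite mulr_ge0//; lra|nra].
Qed.

Lemma bcoef_le0 k : bcoef k.+1 <= 0.
Proof.
have k0 : 0 < k.+1%:R :> R by rewrite ltr0n.
have /andP[h _] := bpoly1_bound k.
have := bcoefS k; have := bpoly1E k.
rewrite -(pmulr_rle0 _ k0) => h1 h2.
have : 0 <= a * bpoly k 1 by rewrite mulr_ge0.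
lra.
Qed.

(** Each step uses (1 - q) (1 + S + q) <= 1 + S with q = a / (n + 1). For a > 0 the divergence of
    the harmonic series then drives [bpoly n 1] to 0. *)
Lemma bpoly1_harmonic n : bpoly n 1 * (1 + a * \sum_(k < n) k.+1%:R^-1) <= 1.
Proof.
elim: n => [|n IHn].
  by rewrite /bpoly big_ord_recl !big_ord0 bcoef0 expr1n; lra.
apply: le_trans IHn; rewrite bpoly1S big_ord_recr /= -mulrA.
have /andP[h0 _] := bpoly1_bound n; apply: ler_wpM2l => //.
set H := \sum_(k < n) _; have H0 : 0 <= H by apply: sumr_ge0 => k _; rewrite invr_ge0.
set t := n.+1%:R^-1; have t0 : 0 <= t by rewrite invr_ge0.
have a0 := a_ge0.
have at0 : 0 <= a * t by rewrite mulr_ge0.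
have aH : 0 <= a * H by rewrite mulr_ge0.
nra.
Qed.

Lemma bpoly1_small (e : R) : -1 < nu -> 0 < e -> exists N, forall n, (N <= n)%N -> bpoly n 1 <= e.
Proof.
move=> nu1 e0.
have dec n k : bpoly (n + k) 1 <= bpoly n 1.
  elim: k => [|k IHk]; first by rewrite addn0.
  apply: le_trans IHk; rewrite addnS bpoly1S ler_piMr//.
    by have /andP[] := bpoly1_bound (n + k).
  by rewrite lerBlDr lerDl divr_ge0 ?ler0n.
suff [N hN] : exists N, bpoly N 1 <= e.
  by exists N => n Nn; rewrite -(subnKC Nn) (le_trans (dec _ _)).
apply: contrapT => /forallNP h.
apply: (@dvg_harmonic R); apply: nondecreasing_is_cvgn.
  by apply: nondecreasing_series => i _ _; rewrite invr_ge0.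
exists (e^-1 / a) => _ [n _ <-].
rewrite /series /= big_mkord ler_pdivlMr; last by lra.
have hn : e < bpoly n 1 by rewrite ltNge; apply/negP; exact: h.
have := bpoly1_harmonic n; set H := \sum_(k < n) _ => hH.
have H0 : 0 <= H by apply: sumr_ge0 => k _; rewrite invr_ge0.
have aH : 0 <= a * H by rewrite mulr_ge0.
rewrite -[leRHS]mul1r ler_pdivlMr//.
have : e * (1 + a * H) <= bpoly n 1 * (1 + a * H) by rewrite ler_wpM2r//; lra.
move=> h1; have h2 := le_trans h1 hH.
have -> : H * a * e = e * (a * H) by ring.
lra.
Qed.

Definition bpoly' (n : nat) (x : R) : R := \sum_(k < n.+1) bcoef k * (k%:R * x ^+ k.-1).

Lemma is_derive_bpoly (n : nat) (x : R) : is_derive x 1 (bpoly n) (bpoly' n x).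
Proof.
have -> : bpoly n = \sum_(k < n.+1) (fun x => bcoef k * x ^+ k).
  by apply/funext => y; rewrite fct_sumE.
apply: is_derive_sum => k.
have hX : is_derive x 1 ((id : R -> R) ^+ k) ((k%:R * x ^+ k.-1) *: 1) by exact: is_deriveX.
have hZ := is_deriveZ (bcoef k) hX.
have -> : (fun x => bcoef k * x ^+ k) = bcoef k \*: ((id : R -> R) ^+ k).
  by apply/funext => y; rewrite /= exprfctE.
by apply: is_derive_eq; rewrite /GRing.scale /= mulr1.
Qed.

(** (1 - x)^a solves (1 - x) f' + a f = 0; the truncated series does so up to one explicit term,
    nonnegative for x >= 0. *)
Lemma bpoly_ode (n : nat) (x : R) : (1 - x) * bpoly' n x + a * bpoly n x = a * bpoly n 1 * x ^+ n.
Proof.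
rewrite bpoly1E; elim: n => [|n IHn].
  by rewrite /bpoly /bpoly' !big_ord_recl !big_ord0 /= bcoef0; ring.
rewrite /bpoly /bpoly' big_ord_recr [X in _ + _ * X]big_ord_recr /= -/(bpoly n x) -/(bpoly' n x).
have h := bcoefS n.
have -> : (1 - x) * (bpoly' n x + bcoef n.+1 * (n.+1%:R * x ^+ n)) +
   a * (bpoly n x + bcoef n.+1 * x ^+ n.+1) =
   ((1 - x) * bpoly' n x + a * bpoly n x) + (1 - x) * x ^+ n * (n.+1%:R * bcoef n.+1) +
   a * bcoef n.+1 * x ^+ n.+1 by ring.
rewrite IHn h.
have -> : (a - n.+1%:R) * bcoef n.+1 * x ^+ n.+1 =
   a * bcoef n.+1 * x ^+ n.+1 - (n.+1%:R * bcoef n.+1) * x ^+ n.+1 by ring.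
by rewrite h exprS; ring.
Qed.

Lemma bpoly0 n : bpoly n 0 = 1.
Proof.
rewrite /bpoly big_ord_recl big1 ?addr0 ?expr0 ?mulr1 ?bcoef0// => k _.
by rewrite expr0n /= mulr0.
Qed.

Lemma is_derive_bpoly_quotient (n : nat) (e x : R) : x < 1 ->
  is_derive x 1 (fun y => (1 - y) `^ (- a) * (bpoly n y - e))
    (a * (1 - x) `^ (- a - 1) * (bpoly n 1 * x ^+ n - e)).
Proof.
move=> x1; have x0 : 0 < 1 - x by lra.
have h1 : is_derive x 1 (fun y : R => 1 - y) (-1).
  by have := is_deriveB (is_derive_cst (1 : R) x 1) (is_derive_id x 1); rewrite sub0r.
have h2 : is_derive x 1 (fun y => (1 - y) `^ (- a)) (- a * (1 - x) `^ (- a - 1) * -1).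
  exact: (@is_derive1_comp _ (fun t => t `^ (- a)) (fun y => 1 - y) x _ _
    (is_derive1_powR (- a) x0) h1).
have h3 : is_derive x 1 (fun y => bpoly n y - e) (bpoly' n x).
  have hb := is_derive_bpoly n x.
  by have := is_deriveB hb (is_derive_cst e x 1); rewrite subr0.
have h4 := is_deriveM h2 h3.
refine (is_derive_eq h4 _); rewrite /GRing.scale /=.
have -> : (1 - x) `^ (- a) = (1 - x) `^ (- a - 1) * (1 - x).
  rewrite -[X in _ * X]powRr1 ?(ltW x0)// -powRD ?subrK//.
  by apply/implyP => _; rewrite gt_eqF.
rewrite -[RHS]mulr1; have := bpoly_ode n x.
set w := (1 - x) `^ _ => ode.
have -> : a * w * (bpoly n 1 * x ^+ n - e) * 1 = w * (a * bpoly n 1 * x ^+ n - a * e) by ring.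
by rewrite -ode; ring.
Qed.

(** The quotient of [bpoly n] - e by (1 - x)^a has a derivative with the sign of [bpoly n 1] x^n -
    e: nondecreasing for e = 0, nonincreasing for e = [bpoly n 1]. Comparison with its value at 0
    gives both bounds, uniformly up to x = 1. *)
Lemma bpoly_sandwich (n : nat) (x : R) : 0 <= x < 1 ->
  bpoly n x - bpoly n 1 <= (1 - x) `^ a <= bpoly n x.
Proof.
move=> /andP[x0 x1]; have px : 0 < (1 - x) `^ a by rewrite powR_gt0; lra.
have /andP[b0 b1] := bpoly1_bound n.
pose q (e y : R) : R := (1 - y) `^ (- a) * (bpoly n y - e).
have der (e : R) (y : R) : y < 1 -> is_derive y 1 (q e) _ := @is_derive_bpoly_quotient n e y.
have cont (e : R) : {within `[0, x], continuous (q e)}.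
  apply: continuous_in_subspaceT => y; rewrite inE /= in_itv /= => /andP[_ yx].
  have y1 : y < 1 by lra.
  apply: differentiable_continuous; apply/derivable1_diffP.
  by case: (der e y y1).
have at0 (e : R) : q e 0 = 1 - e.
  by rewrite /q subr0 powR1 mul1r bpoly0.
have drv (e : R) (y : R) : y \in `]0, x[ -> derivable (q e) y 1.
  rewrite in_itv /= => /andP[_ yx]; have y1 : y < 1 by lra.
  by case: (der e y y1).
have dval (e : R) (y : R) : y \in `]0, x[ -> derive1 (q e) y =
    a * (1 - y) `^ (- a - 1) * (bpoly n 1 * y ^+ n - e).
  rewrite in_itv /= => /andP[_ yx]; have y1 : y < 1 by lra.
  by rewrite derive1E; case: (der e y y1).
apply/andP; split.
  have := @ler0_derive1_nincr _ (q (bpoly n 1)) 0 x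
    (drv _) _ (cont _) 0 x (lexx _) x0 (lexx _).
  rewrite at0 /q powRN => h.
  suff : ((1 - x) `^ a)^-1 * (bpoly n x - bpoly n 1) <= 1.
    by rewrite mulrC ler_pdivrMr// mul1r.
  apply: (le_trans (h _)); last by lra.
  move=> y yx; rewrite dval//; move: yx; rewrite in_itv /= => /andP[y0 yx].
  rewrite mulr_ge0_le0 ?mulr_ge0 ?powR_ge0// subr_le0 ler_piMr//.
  by rewrite exprn_ile1// ?ltW//; lra.
have := @ger0_derive1_ndecr _ (q 0) 0 x
    (drv _) _ (cont _) 0 x (lexx _) x0 (lexx _).
rewrite at0 /q powRN !subr0 => h.
have : 1 <= ((1 - x) `^ a)^-1 * bpoly n x.
  apply: h => y yx; rewrite dval//; move: yx; rewrite in_itv /= => /andP[y0 yx].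
  by rewrite subr0 !mulr_ge0 ?powR_ge0// exprn_ge0// ltW.
by rewrite mulrC ler_pdivlMr// mul1r.
Qed.

Definition bsum (t : R) (n : nat) : R := \sum_(0 <= k < n) bcoef k / (k%:R + t).

(** The first term is 1 / t; the others are nonpositive, with coefficients of sum at least -1 and
    denominators at least t + 1. This yields both the convergence of the nonincreasing partial sums
    and the positivity of the limit. *)
Lemma bsum_ge (t : R) (n : nat) : 0 < t -> t^-1 - (t + 1)^-1 <= bsum t n.+1.
Proof.
move=> t0; rewrite /bsum big_nat_recl// bcoef0 add0r div1r; apply: lerD => //.
have t1 : 0 < t + 1 by lra.
apply: (@le_trans _ _ (\sum_(0 <= k < n) bcoef k.+1 / (t + 1))); last first.
  apply: ler_sum_nat => k _; rewrite ler_wnM2l ?bcoef_le0//.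
  have k0 : 0 <= k%:R :> R by rewrite ler0n.
  by rewrite lef_pV2 ?posrE; rewrite -?natr1; lra.
rewrite -mulr_suml -[leLHS]mulN1r ler_pM2r ?invr_gt0//.
have : bpoly n 1 = 1 + \sum_(0 <= k < n) bcoef k.+1.
  rewrite /bpoly big_ord_recl bcoef0 expr0 mulr1 big_mkord; congr (_ + _).
  by apply: eq_bigr => k _; rewrite expr1n mulr1.
by have /andP[h _] := bpoly1_bound n; lra.
Qed.

Lemma bsum_cvg (t : R) : 0 < t -> cvgn (bsum t).
Proof.
move=> t0; suff /cvg_ex[l hl] : cvgn (fun n => bsum t n.+1).
  by apply/cvg_ex; exists l; move: hl; rewrite (cvg_shiftS (bsum t)).
apply: nonincreasing_is_cvgn.
  apply/nonincreasing_seqP => n /=; rewrite /bsum [leLHS]big_nat_recr//= gerDl.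
  rewrite mulr_le0_ge0 ?bcoef_le0// invr_ge0 addr_ge0// ltW//.
by exists (t^-1 - (t + 1)^-1) => _ [n _ <-] /=; exact: bsum_ge.
Qed.

Lemma bsum_lim_gt0 (t : R) : 0 < t -> 0 < limn (bsum t).
Proof.
move=> t0; apply: (@lt_le_trans _ _ (t^-1 - (t + 1)^-1)).
  by rewrite subr_gt0 ltf_pV2 ?posrE; lra.
apply: limr_ge; first exact: bsum_cvg.
by exists 1%N => // -[//|n] _; exact: bsum_ge.
Qed.

Lemma A_nu2E : A_nu2 nu = limn (bsum (- nu)).
Proof. by []. Qed.

Lemma A_nuE : A_nu nu = limn (bsum (1 - nu)).
Proof.
rewrite /A_nu (_ : (fun n => _) = bsum (1 - nu))//; apply/funext => n.
by apply: eq_bigr => k _; congr (_ / _); ring.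
Qed.

Lemma bsum_telescope n :
  - nu * bsum (- nu) n.+1 - 2 * bsum (1 - nu) n.+1 = - (a * bpoly n 1) / (n%:R + 1 - nu).
Proof.
rewrite bpoly1E; have n0 k : 0 <= k%:R :> R by rewrite ler0n.
have nu0 := nu_lt0.
elim: n => [|n IHn].
  by rewrite /bsum !big_nat1 bcoef0; field; rewrite (lt_eqF nu0) gt_eqF; lra.
have bsumS t : bsum t n.+2 = bsum t n.+1 + bcoef n.+1 / (n.+1%:R + t).
  by rewrite /bsum big_nat_recr.
rewrite !bsumS (_ : _ - _ = (- nu * bsum (- nu) n.+1 - 2 * bsum (1 - nu) n.+1) +
  (- nu * (bcoef n.+1 / (n.+1%:R - nu)) - 2 * (bcoef n.+1 / (n.+1%:R + (1 - nu)))));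
  last by ring.
rewrite IHn.
have h := bcoefS n.
have hn := n0 n.
rewrite (_ : - ((a - n%:R) * bcoef n) = n.+1%:R * bcoef n.+1); last by rewrite h; ring.
rewrite -!natr1; move: (n%:R) hn => N hN.
by field; rewrite !gt_eqF//; lra.
Qed.

(** The two constants are the Beta values B(1 - nu, nu + 2) and B(- nu, nu + 2), and the identity is
    B(p + 1, q) = p / (p + q) B(p, q) with p + q = 2. It is read off the partial sums, whose
    discrepancy is explicit and of order 1 / n. *)
Lemma A_nu_relation : 2 * A_nu nu = - nu * A_nu2 nu.
Proof.
have nu0 := nu_lt0.
have t1 : 0 < - nu by lra.
have t2 : 0 < 1 - nu by lra.
have c1 := bsum_cvg _ t1; have c2 := bsum_cvg _ t2.
rewrite A_nuE A_nu2E.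
have h1 : (fun n => - nu * bsum (- nu) n.+1 - 2 * bsum (1 - nu) n.+1) @ \oo -->
   - nu * limn (bsum (- nu)) - 2 * limn (bsum (1 - nu)).
  by apply: cvgB; apply: cvgMr; rewrite (cvg_shiftS (bsum _)).
have h2 : (fun n => - nu * bsum (- nu) n.+1 - 2 * bsum (1 - nu) n.+1) @ \oo --> (0 : R).
  under eq_fun do rewrite bsum_telescope.
  apply: (@squeeze_cvgr _ _ _ _ (fun n => - harmonic n) (fun=> 0)).
  - near=> n; have /andP[b0 b1] := bpoly1_bound n.
    have n0 : 0 <= n%:R :> R by rewrite ler0n.
    have d0 : 0 < n%:R + 1 - nu by lra.
    have ab : 0 <= a * bpoly n 1 <= 1.
      by rewrite mulr_ge0//= mulr_ile1// ltW.
    rewrite mulNr; apply/andP; split; last by rewrite oppr_le0 divr_ge0 ?(ltW d0)//; case/andP: ab.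
    rewrite lerN2 ler_pdivrMr//= (@le_trans _ _ 1)//; first by case/andP: ab.
    rewrite -(ler_pM2l (_ : 0 < n.+1%:R)) ?ltr0n// mulrA mulfV ?pnatr_eq0// mul1r mulr1 -natr1; lra.
  - by rewrite -oppr0; apply: cvgN; exact: cvg_harmonic.
  - exact: cvg_cst.
by apply/eqP; rewrite eq_sym -subr_eq0; apply/eqP; exact: (cvg_unique _ h1 h2).
Unshelve. all: by end_near. Qed.

(** For nu > -1, [r] is [bpoly n 1], which bounds the truncation error and tends to 0. At nu = -1
    the exponent is 0, the polynomial is the constant 1, and r = 0 is exact. *)
Lemma bpoly_approx (e : R) : 0 < e -> exists (n : nat) (r : R), [/\ 0 <= r, r <= e,
  forall x, 0 <= x < 1 -> 0 <= bpoly n x - r <= (1 - x) `^ a,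
  forall x, 0 <= x < 1 -> (1 - x) `^ a <= bpoly n x &
  `|bsum (- nu) n.+1 - A_nu2 nu| <= e].
Proof.
move=> e0; have nu0 := nu_lt0.
have t1 : 0 < - nu by lra.
have /cvgrPdist_le/(_ e e0)[N1 _ hN1] : bsum (- nu) n.+1 @[n --> \oo] --> A_nu2 nu.
  by rewrite (cvg_shiftS (bsum (- nu))) A_nu2E; exact: bsum_cvg.
have dist n : (N1 <= n)%N -> `|bsum (- nu) n.+1 - A_nu2 nu| <= e.
  by move=> Nn; rewrite distrC; exact: hN1.
have decr n x : 0 <= x < 1 -> bpoly n 1 <= bpoly n x.
  move=> /andP[x0 x1]; rewrite /bpoly; apply: ler_sum => -[[|k] hk] _ /=.
    by rewrite !expr0.
  by rewrite expr1n ler_wnM2l ?bcoef_le0// exprn_ile1// ltW.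
have [nu1|nu1] := eqVneq nu (-1).
  exists N1, 0; split => //.
  - exact: ltW.
  - move=> x /andP[x0 x1]; rewrite subr0 nu1 addNr powRr0.
    have -> : bpoly N1 x = 1; last by rewrite ler01 lexx.
    rewrite /bpoly big_ord_recl bcoef0 expr0 mulr1 big1 ?addr0// => k _.
    suff -> : bcoef (lift ord0 k) = 0 by rewrite mul0r.
    have := bpoly1E k.+1; rewrite {1 2}nu1 addNr mul0r add0r mulNr => /esym/eqP.
    by rewrite oppr_eq0 mulf_eq0 pnatr_eq0 /= => /eqP.
  - by move=> x /(bpoly_sandwich N1)/andP[].
  - exact: dist.
have nu1' : -1 < nu by rewrite lt_neqAle eq_sym nu1.
have [N2 hN2] := bpoly1_small e nu1' e0.
pose n := maxn N1 N2.
have /andP[b0 b1] := bpoly1_bound n.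
exists n, (bpoly n 1); split => //.
- exact/hN2/leq_maxr.
- by move=> x hx; have /andP[-> _] := bpoly_sandwich n x hx; rewrite subr_ge0 decr.
- by move=> x /(bpoly_sandwich n)/andP[].
- exact/dist/leq_maxl.
Qed.

End BinomialSeries.

Lemma powR_small {R : realType} (p e : R) : 0 < p -> 0 < e ->
  exists2 delta, 0 < delta & forall u, 0 < u < delta -> u `^ p <= e.
Proof.
move=> p0 e0; exists (e `^ p^-1); first by rewrite powR_gt0.
move=> u /andP[u0 ud].
rewrite [leRHS](_ : _ = (e `^ p^-1) `^ p).
  by apply: ge0_ler_powR; rewrite ?nnegrE ?powR_ge0 ?(ltW p0) ?(ltW u0) ?(ltW ud).
by rewrite -powRrM mulVf ?gt_eqF// powRr1// ltW.
Qed.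

(** * The mean inverse near the edge for positive, zero and negative nu *)

Section EdgeAsymptotics.
Context {R : realType}.
Variables (m : probability R R) (c : R).
Variables (nu kappa : R).
Hypothesis kappa_gt0 : 0 < kappa.
Hypothesis edge : (fun x => fine (m `[c, x[%classic) / (x - c) `^ (nu + 1)) @ c^'+ --> kappa.

Local Notation M := (mean_inv m c).
Local Notation a := (nu + 1).
Local Notation leb := (@lebesgue_measure R).

Lemma edge_mass_asymp (eta : R) : 0 < eta -> exists2 delta, 0 < delta &
  forall s, 0 < s < delta ->
    (kappa - eta) * s `^ a <= edge_mass m c s <= (kappa + eta) * s `^ a.
Proof.
move=> eta0; have /cvgrPdist_le/(_ eta eta0) := edge.
case=> delta /= delta0 hd; exists delta => // s /andP[s0 sd].
have := hd (c + s); rewrite /= opprD addrA subrr add0r normrN (gtr0_norm s0) sd.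
rewrite ltrDl s0 => /(_ isT isT); rewrite addrAC subrr add0r -/(edge_mass m c s).
have sa : 0 < s `^ a by rewrite powR_gt0.
rewrite ler_norml => /andP[h1 h2].
have h3 : kappa - eta <= edge_mass m c s / s `^ a by lra.
have h4 : edge_mass m c s / s `^ a <= kappa + eta by lra.
by move: h3 h4; rewrite ler_pdivlMr// ler_pdivrMr// => -> ->.
Qed.

(** The cut-off u / (u + delta) solves u (1 - y) / y = delta: above it the argument of [edge_mass]
    stays in the range of the asymptotics, and the part below is O(u). *)
Lemma cutoff_bounds (u delta : R) : 0 < u -> 0 < delta ->
  [/\ 0 < u / (u + delta) < 1, u / (u + delta) <= u / delta &
      forall y, u / (u + delta) < y < 1 -> 0 < u * (1 - y) / y < delta].
Proof.
move=> u0 d0; have ud : 0 < u + delta by lra.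
split.
- by rewrite divr_gt0//= ltr_pdivrMr//; lra.
- by rewrite ler_pM2l// lef_pV2 ?posrE//; lra.
- move=> y /andP[]; rewrite ltr_pdivrMr// => h1 h2.
  have y0 : 0 < y.
    by rewrite -(pmulr_lgt0 _ ud); lra.
  rewrite divr_gt0 ?mulr_gt0//=; last by lra.
  by rewrite ltr_pdivrMr//; lra.
Qed.

Lemma powR_ratio (u y : R) : 0 < u -> 0 < y < 1 ->
  (u * (1 - y) / y) `^ a = u `^ a * ((1 - y) `^ a * y `^ (- a)).
Proof.
move=> u0 /andP[y0 y1]; have y1' : 0 <= 1 - y by lra.
rewrite powRM ?mulr_ge0 ?invr_ge0 ?(ltW u0) ?(ltW y0)//.
rewrite powRM ?(ltW u0)// -mulrA; congr (_ * (_ * _)).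
by rewrite -powR_inv1 ?(ltW y0)// -powRrM mulN1r.
Qed.

Lemma measurable_powR_itv (p y0 : R) : measurable_fun (`]y0, 1[%classic : set R) (fun y : R => y `^ p).
Proof. by apply: measurable_funTS; exact: measurable_powR. Qed.

Lemma continuous_powR (p x : R) : 0 < x -> {for x, continuous (fun y : R => y `^ p)}.
Proof.
move=> x0; apply: differentiable_continuous; apply/derivable1_diffP.
by case: (is_derive1_powR p x0).
Qed.

(** With (1 - y)^a <= 1 the integrand y^(- a) has the primitive y^(- nu) / (- nu), and u^a y0^(- nu)
    = u (u + delta)^nu at the cut-off, so the whole bound is of order u. *)
Lemma mean_inv_bounded : 0 < nu -> exists K, forall u, 0 < u <= 1 -> M (c - u) <= K.
Proof.
move=> nu0; have [delta d0 hd] := edge_mass_asymp 1 ltr01.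
pose k := kappa + 1; have k0 : 0 < k by have := kappa_gt0; rewrite /k; lra.
exists (delta^-1 + k * (1 + delta) `^ nu / nu) => u /andP[u0 u1].
have [/andP[y00 y01] y0d hy] := cutoff_bounds u delta u0 d0.
set y0 := u / (u + delta) in y00 y01 y0d hy.
have ud : 0 < u + delta by lra.
pose phi y := k * u `^ a * y `^ (- a).
have ka : 0 <= k * u `^ a by rewrite mulr_ge0 ?powR_ge0// ltW.
have JE : (\int[leb]_(y in `]y0, 1%R[) (phi y)%:E =
    (k * u `^ a * (1 `^ (- nu) / - nu) - k * u `^ a * (y0 `^ (- nu) / - nu))%:E)%E.
  apply: (@integral_is_derive _ (fun y => k * u `^ a * (y `^ (- nu) / - nu)) phi y0 1 y01).
    move=> x /andP[xy _]; have x0 : 0 < x by exact: lt_le_trans xy.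
    have h := is_deriveZ (k * u `^ a / - nu) (is_derive1_powR (- nu) x0).
    have -> : (fun y : R => k * u `^ a * (y `^ (- nu) / - nu)) =
       (k * u `^ a / - nu) \*: (fun y => y `^ (- nu)).
      by apply/funext => y; rewrite /= /GRing.scale /=; ring.
    refine (is_derive_eq h _); rewrite /GRing.scale /= /phi opprD.
    by field; rewrite gt_eqF.
  move=> x /andP[xy _]; have x0 : 0 < x by exact: lt_le_trans xy.
  by apply: cvgMr; exact: continuous_powR.
have y0b : 0 < y0 < 1 by rewrite y00.
have : u * M (c - u) <= y0 + (k * u `^ a * (1 `^ (- nu) / - nu) - k * u `^ a * (y0 `^ (- nu) / - nu)).
  refine (mean_inv_tail_le m c u y0 _ phi u0 y0b _ _ JE).
    by apply: measurable_funM => //; exact: measurable_powR_itv.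
  move=> y /[dup] yy /andP[y0y y1]; have /andP[s0 sd] := hy y yy.
  have /andP[_ h] := hd _ (hy y yy); apply: (le_trans h); rewrite /phi.
  have y_gt0 : 0 < y by exact: lt_trans y0y.
  rewrite powR_ratio ?y_gt0// mulrA ler_wpM2l// ler_piMl ?powR_ge0//.
  rewrite -[leRHS](powRr0 (1 - y)); apply: ger_powR; lra.
rewrite powR1 => h.
have y0nu : y0 `^ (- nu) = u `^ (- nu) * (u + delta) `^ nu.
  rewrite /y0 powRM ?invr_ge0 ?(ltW u0) ?(ltW ud)//; congr (_ * _).
  by rewrite -powR_inv1 ?(ltW ud)// -powRrM mulN1r opprK.
have uu : u `^ a * u `^ (- nu) = u.
  rewrite -powRD; last by apply/implyP => _; rewrite gt_eqF.
  by rewrite (_ : _ + _ = 1) ?powRr1 ?(ltW u0)//; ring.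
have mono : (u + delta) `^ nu <= (1 + delta) `^ nu.
  by apply: ge0_ler_powR; rewrite ?nnegrE; lra.
rewrite -(ler_pM2l u0); apply: (le_trans h).
have e1 : k * u `^ a * (1 / - nu) - k * u `^ a * (y0 `^ (- nu) / - nu) =
   k * u * (u + delta) `^ nu / nu - k * u `^ a / nu.
  rewrite y0nu -[X in _ = k * X * _ / _ - _]uu.
  by field; rewrite gt_eqF.
rewrite e1.
have e2 : 0 <= k * u `^ a / nu by rewrite divr_ge0// ltW.
have e3 : k * u * (u + delta) `^ nu / nu <= u * (k * (1 + delta) `^ nu / nu).
  rewrite (_ : k * u * _ / nu = k * u / nu * (u + delta) `^ nu); last by ring.
  rewrite (_ : u * _ = k * u / nu * (1 + delta) `^ nu); last by ring.
  by rewrite ler_wpM2l// divr_ge0 ?mulr_ge0 ?ltW.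
by rewrite mulrDr; lra.
Qed.

(** The integrand becomes u (1 / y - 1), with primitive u (ln y - y), and ln y0 = ln u - ln (u +
    delta) supplies the logarithm. *)
Lemma mean_inv_log (eta : R) : nu = 0 -> 0 < eta <= kappa ->
  exists delta K, [/\ 0 < delta, 0 <= K & forall u, 0 < u < delta ->
    (kappa - eta) * - ln u - K <= M (c - u) <= (kappa + eta) * - ln u + K].
Proof.
move=> nu0 /andP[eta0 etak]; have [delta d0 hd] := edge_mass_asymp eta eta0.
have k0 := kappa_gt0.
have lnd : 0 <= ln (1 + delta) by rewrite ln_ge0//; lra.
have K10 : 0 <= delta^-1 + (kappa + eta) * ln (1 + delta).
  by rewrite addr_ge0 ?invr_ge0 ?(ltW d0)// mulr_ge0//; lra.
have K20 : 0 <= (kappa - eta) * (1 + `|ln delta|).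
  by rewrite mulr_ge0 ?subr_ge0// addr_ge0.
(* The range of u is (0, 1); the delta of the edge asymptotics goes into the constant. *)
exists 1, (delta^-1 + (kappa + eta) * ln (1 + delta) + (kappa - eta) * (1 + `|ln delta|)).
split => // [|u /andP[u0 u1]]; first by lra.
have [/andP[y00 y01] y0d hy] := cutoff_bounds u delta u0 d0.
set y0 := u / (u + delta) in y00 y01 y0d hy.
have ud : 0 < u + delta by lra.
pose phi (k y : R) := k * u * (y^-1 - 1).
have JE (k : R) : (\int[leb]_(y in `]y0, 1%R[) (phi k y)%:E =
    (k * u * (ln 1 - 1) - k * u * (ln y0 - y0))%:E)%E.
  apply: (@integral_is_derive _ (fun y => k * u * (ln y - y)) (phi k) y0 1 y01).
    move=> x /andP[xy _]; have x0 : 0 < x by exact: lt_le_trans xy.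
    have h := is_deriveZ (k * u) (is_deriveB (is_derive1_ln x0) (is_derive_id x 1)).
    exact: is_derive_eq h _.
  move=> x /andP[xy _]; have x0 : 0 < x by exact: lt_le_trans xy.
  apply: cvgMr; apply: cvgB; last exact: cvg_cst.
  by apply: cvgV; [rewrite gt_eqF|exact: cvg_id].
have y0b : 0 < y0 < 1 by rewrite y00.
have mphi k : measurable_fun (`]y0, 1[%classic : set R) (phi k).
  apply: measurable_funM => //; apply: measurable_funB => //.
  by apply: measurable_funTS; exact: measurable_funV.
have ratio y : y0 < y < 1 -> 0 < u * (1 - y) / y < delta ->
    (u * (1 - y) / y) `^ a = u * (y^-1 - 1).
  move=> /andP[y0y y1] /andP[s0 _]; rewrite nu0 add0r powRr1 ?(ltW s0)//.
  by field; rewrite gt_eqF// (lt_trans _ y0y).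
have up : u * M (c - u) <= y0 + ((kappa + eta) * u * (ln 1 - 1) - (kappa + eta) * u * (ln y0 - y0)).
  refine (mean_inv_tail_le m c u y0 _ _ u0 y0b (mphi _) _ (JE _)).
  move=> y yy; have s := hy y yy; have /andP[_ h] := hd _ s.
  by apply: (le_trans h); rewrite ratio// /phi mulrA.
have lo : (kappa - eta) * u * (ln 1 - 1) - (kappa - eta) * u * (ln y0 - y0) <= u * M (c - u).
  refine (mean_inv_tail_ge m c u y0 _ _ u0 y0b (mphi _) _ (JE _)).
  move=> y yy; have s := hy y yy; have /andP[h _] := hd _ s.
  apply/andP; split; last by apply: le_trans h; rewrite ratio// /phi mulrA.
  rewrite /phi -mulrA -ratio// mulr_ge0 ?powR_ge0//; lra.
have ln0 : ln y0 = ln u - ln (u + delta).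
  by rewrite /y0 ln_div ?posrE.
have l1 : ln (u + delta) <= ln (1 + delta) by rewrite ler_ln ?posrE; lra.
have l2 : ln delta <= ln (u + delta) by rewrite ler_ln ?posrE; lra.
have l3 : - `|ln delta| <= ln delta by rewrite lerNnormlW// ler_normr lexx.
rewrite ln1 ln0 in up lo.
apply/andP; split; rewrite -(ler_pM2l u0).
  apply: le_trans lo.
  rewrite [leRHS](_ : _ = u * ((kappa - eta) * (ln (u + delta) - ln u - 1 + y0))); last by ring.
  rewrite ler_pM2l//.
  have : (kappa - eta) * (- `|ln delta| - ln u - 1) <= (kappa - eta) * (ln (u + delta) - ln u - 1 + y0).
    by apply: ler_wpM2l; lra.
  lra.
apply: (le_trans up).
have : (kappa + eta) * (ln (u + delta) - ln u - 1 + y0) <= (kappa + eta) * (ln (1 + delta) - ln u).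
  by apply: ler_wpM2l; lra.
move=> /(ler_wpM2l (ltW u0)) h1.
have h2 := mulr_ge0 (ltW u0) K20.
rewrite [leLHS](_ : _ = y0 + u * ((kappa + eta) * (ln (u + delta) - ln u - 1 + y0))); last by ring.
rewrite !mulrDr in h2 *; lra.
Qed.

Section NegativeExponent.
Hypothesis nu_ge : -1 <= nu.
Hypothesis nu_lt0 : nu < 0.

Local Notation primitive n := (fun y : R => \sum_(k < n.+1) bcoef nu k / (k%:R - nu) * y `^ (k%:R - nu)).

Lemma is_derive_primitive n (x : R) : 0 < x ->
  is_derive x 1 (primitive n) (bpoly nu n x * x `^ (- a)).
Proof.
move=> x0; have nu0 := nu_lt0.
have -> : primitive n = \sum_(k < n.+1) (fun y : R => bcoef nu k / (k%:R - nu) * y `^ (k%:R - nu)).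
  by apply/funext => y; rewrite fct_sumE.
rewrite /bpoly mulr_suml; apply: is_derive_sum => k.
have h := is_deriveZ (bcoef nu k / (k%:R - nu)) (is_derive1_powR (k%:R - nu) x0).
refine (is_derive_eq h _); rewrite /GRing.scale /=.
have kn : k%:R - nu != 0 by rewrite gt_eqF//; have := ler0n R k; lra.
rewrite mulrA divfK// -mulrA -powR_mulrn ?(ltW x0)// -powRD; last by apply/implyP => _; rewrite gt_eqF.
by rewrite opprD addrA.
Qed.

Lemma primitive1 n : primitive n 1 = bsum nu (- nu) n.+1.
Proof.
by rewrite /bsum big_mkord; apply: eq_bigr => k _; rewrite powR1 mulr1.
Qed.

Lemma primitive_small n (e : R) : 0 < e ->
  exists2 delta, 0 < delta & forall y, 0 < y < delta -> `|primitive n y| <= e.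
Proof.
move=> e0; have nu0 := nu_lt0.
pose G := 1 + \sum_(k < n.+1) `|bcoef nu k / (k%:R - nu)|.
have G0 : 0 < G by rewrite /G ltr_pwDl// sumr_ge0.
have nn0 : 0 < - nu by lra.
have [delta d0 hd] := powR_small (- nu) (e / G) nn0 (divr_gt0 e0 G0).
exists (Num.min delta 1) => [|y /andP[y0]]; first by rewrite lt_min d0 ltr01.
rewrite lt_min => /andP[yd y1].
apply: (le_trans (ler_norm_sum _ _ _)).
apply: (@le_trans _ _ (\sum_(k < n.+1) `|bcoef nu k / (k%:R - nu)| * (e / G))).
  apply: ler_sum => k _; rewrite normrM ler_wpM2l// ger0_norm ?powR_ge0//.
  apply: le_trans (hd y _); last by rewrite y0.
  by apply: ger_powR; rewrite ?y0 ?(ltW y1)// lerDr.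
rewrite -mulr_suml mulrCA ger_pMr//.
by rewrite ler_pdivrMr// mul1r /G lerDr.
Qed.

Lemma integral_bpoly n (K r y0 : R) : 0 < y0 < 1 ->
  (\int[leb]_(y in `]y0, 1%R[) (K * ((bpoly nu n y - r) * y `^ (- a)))%:E =
   (K * (primitive n 1 - r * (1 `^ (- nu) / - nu)) - K * (primitive n y0 - r * (y0 `^ (- nu) / - nu)))%:E)%E.
Proof.
move=> /andP[y00 y01]; have nu0 := nu_lt0.
apply: (@integral_is_derive _ (fun y => K * (primitive n y - r * (y `^ (- nu) / - nu)))
  (fun y => K * ((bpoly nu n y - r) * y `^ (- a))) y0 1 y01).
  move=> x /andP[xy _]; have x0 : 0 < x by exact: lt_le_trans xy.
  have h := is_deriveZ K (is_deriveB (is_derive_primitive n x x0)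
    (is_deriveZ (r / - nu) (is_derive1_powR (- nu) x0))).
  have -> : (fun y => K * (primitive n y - r * (y `^ (- nu) / - nu))) =
     K \*: (primitive n \- (r / - nu) \*: (fun y => y `^ (- nu))).
    by apply/funext => y; rewrite /= /GRing.scale /=; ring.
  refine (is_derive_eq h _); rewrite /GRing.scale /= opprD.
  by field; rewrite lt_eqF.
move=> x /andP[xy _]; have x0 : 0 < x by exact: lt_le_trans xy.
apply: cvgMr; apply: cvgM; last exact: continuous_powR.
apply: cvgB; last exact: cvg_cst.
by apply: differentiable_continuous; apply/derivable1_diffP; case: (is_derive_bpoly nu n x).
Qed.

(** With (1 - y)^a replaced by a polynomial the integral is explicit: its primitive at 1 is a
    partial sum of [A_nu2 nu], and at the cut-off it is small because the exponents k - nu are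
    positive. *)
Lemma mean_inv_powR (eta : R) : 0 < eta -> exists2 delta, 0 < delta &
  forall u, 0 < u < delta ->
    kappa * A_nu2 nu - eta <= u `^ (- nu) * M (c - u) <= kappa * A_nu2 nu + eta.
Proof.
move=> eta0; have nu0 := nu_lt0; have k0 := kappa_gt0.
have nn0 : 0 < - nu by lra.
have A20 : 0 < A_nu2 nu by rewrite A_nu2E; exact: bsum_lim_gt0.
set A2 := A_nu2 nu in A20 *.
(* [Q] collects the coefficients of e in the two final estimates, which then follow from e Q <=
   eta. *)
pose Q := 2 * kappa + A2 + 3 + kappa / - nu.
have kn0 : 0 < kappa / - nu by rewrite divr_gt0.
have Q0 : 0 < Q by rewrite /Q; lra.
pose e := Num.min (Num.min 1 kappa) (eta / Q).
have e0 : 0 < e by rewrite !lt_min ltr01 k0 divr_gt0.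
have e1 : e <= 1 by rewrite !ge_min lexx.
have ek : e <= kappa by rewrite !ge_min lexx orbT.
have eQ : e * Q <= eta by rewrite -ler_pdivlMr// /e ge_min lexx orbT.
have [n [r [r0 re lobp upbp absum]]] := bpoly_approx nu nu_ge nu_lt0 e e0.
have [d1 d10 hd1] := edge_mass_asymp e e0.
have [d2 d20 hd2] := primitive_small n e e0.
have [d3 d30 hd3] := powR_small (- nu) (e * d1) nn0 (mulr_gt0 e0 d10).
(* For u < d1 d2 the cut-off lies below [d2]; for u < d3 it is at most e u^a. *)
exists (Num.min d3 (d1 * d2)); first by rewrite lt_min d30 mulr_gt0.
move=> u /andP[u0]; rewrite lt_min => /andP[ud3 ud2].
have [/andP[y00 y01] y0d hy] := cutoff_bounds u d1 u0 d10.
set y0 := u / (u + d1) in y00 y01 y0d hy.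
have y0b : 0 < y0 < 1 by rewrite y00.
have y0d2 : 0 < y0 < d2.
  by rewrite y00 (le_lt_trans y0d)// ltr_pdivrMr// mulrC.
have small := hd2 y0 y0d2; rewrite ler_norml in small.
have ua : 0 < u `^ a by rewrite powR_gt0.
have uu : u `^ a * u `^ (- nu) = u.
  rewrite -powRD; last by apply/implyP => _; rewrite gt_eqF.
  by rewrite (_ : _ + _ = 1) ?powRr1 ?(ltW u0)//; ring.
have mphi (K r' : R) : measurable_fun (`]y0, 1[%classic : set R)
    (fun y => K * ((bpoly nu n y - r') * y `^ (- a))).
  apply: measurable_funM => //; apply: measurable_funM; last exact: measurable_powR_itv.
  apply: measurable_funB => //; apply: measurable_funTS; apply: continuous_measurable_fun => x.
  by apply: differentiable_continuous; apply/derivable1_diffP; case: (is_derive_bpoly nu n x).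
have split_ratio y : y0 < y < 1 -> (u * (1 - y) / y) `^ a = u `^ a * ((1 - y) `^ a * y `^ (- a)).
  by move=> /andP[y0y y1]; apply: powR_ratio => //; rewrite y1 (lt_trans y00).
have in01 y : y0 < y < 1 -> 0 <= y < 1.
  by move=> /andP[y0y ->]; rewrite ltW// (lt_trans y00).
have up y : y0 < y < 1 -> edge_mass m c (u * (1 - y) / y) <=
    (kappa + e) * u `^ a * ((bpoly nu n y - 0) * y `^ (- a)).
  move=> yy; have /andP[_ h] := hd1 _ (hy y yy); apply: (le_trans h).
  rewrite split_ratio// mulrA ler_wpM2l//; first by rewrite mulr_ge0// ?(ltW ua)//; lra.
  by rewrite subr0 ler_wpM2r ?powR_ge0//; apply: upbp; exact: in01.
have {}up := mean_inv_tail_le m c u y0 _ _ u0 y0b (mphi ((kappa + e) * u `^ a) 0) up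
  (integral_bpoly _ _ _ _ y0b).
have lo y : y0 < y < 1 -> 0 <= (kappa - e) * u `^ a * ((bpoly nu n y - r) * y `^ (- a)) <=
    edge_mass m c (u * (1 - y) / y).
  move=> yy; have /andP[h _] := hd1 _ (hy y yy).
  have /andP[b1 b2] := lobp y (in01 y yy).
  have kk : 0 <= (kappa - e) * u `^ a by rewrite mulr_ge0 ?subr_ge0// ltW.
  apply/andP; split; first by apply: mulr_ge0 => //; apply: mulr_ge0 => //; exact: powR_ge0.
  apply: le_trans h; rewrite split_ratio// [leRHS]mulrA ler_wpM2l// ler_wpM2r ?powR_ge0//.
have {}lo := mean_inv_tail_ge m c u y0 _ _ u0 y0b (mphi ((kappa - e) * u `^ a) r) lo
  (integral_bpoly _ _ _ _ y0b).
have /andP[s1 s2] := small.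
rewrite primitive1 powR1 in up lo.
move: absum; rewrite ler_norml -/A2 => /andP[ab1 ab2].
set S := bsum nu (- nu) n.+1 in up lo ab1 ab2.
set g := primitive n y0 in up lo s1 s2.
have rr : 0 <= r / - nu <= e / - nu.
  by rewrite divr_ge0 ?(ltW nn0)//= ler_wpM2r// invr_ge0 ltW.
have uM : u * M (c - u) = u `^ a * (u `^ (- nu) * M (c - u)) by rewrite mulrA uu.
rewrite uM in up lo.
apply/andP; split; rewrite -(ler_pM2l ua).
  apply: le_trans lo.
  rewrite [leRHS](_ : _ = u `^ a * ((kappa - e) * (S - g - r / - nu + r * (y0 `^ (- nu)) / - nu))); last first.
    by field; rewrite lt_eqF.
  rewrite ler_pM2l//.
  have r3 : 0 <= r * (y0 `^ (- nu)) / - nu by rewrite divr_ge0 ?mulr_ge0 ?powR_ge0// ltW.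
  have : (kappa - e) * (A2 - 2 * e - e / - nu) <= (kappa - e) * (S - g - r / - nu + r * (y0 `^ (- nu)) / - nu).
    by rewrite ler_wpM2l// ?subr_ge0//; lra.
  apply: le_trans.
  have h1 : 0 <= e * (2 * e + e / - nu).
    by apply: mulr_ge0; [exact: ltW|case/andP: rr => r1 r2; lra].
  have h2 : kappa * (e / - nu) = e * (kappa / - nu) by ring.
  move: eQ; rewrite /Q; move: (e / - nu) (kappa / - nu) h1 h2 kn0 => q1 q2 h1 h2 kn0.
  nra.
apply: (le_trans up).
rewrite [leLHS](_ : _ = y0 + u `^ a * ((kappa + e) * (S - g))); last by ring.
have h1 : y0 <= u `^ a * e.
  apply: (le_trans y0d); rewrite ler_pdivrMr// -[leLHS]uu -mulrA ler_pM2l//.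
  by apply: hd3; rewrite u0.
have h2 : u `^ a * ((kappa + e) * (S - g)) <= u `^ a * ((kappa + e) * (A2 + 2 * e)).
  by rewrite ler_pM2l// ler_wpM2l//; lra.
have h3 : u `^ a * (e + (kappa + e) * (A2 + 2 * e)) <= u `^ a * (kappa * A2 + eta).
  rewrite ler_pM2l//; move: eQ; rewrite /Q.
  have h4 : 0 <= e * (kappa / - nu) by rewrite mulr_ge0 ?ltW.
  have h5 : e * e <= e by rewrite ger_pMr.
  by move: (kappa / - nu) h4 => q h4; nra.
by move: h3; rewrite mulrDr; lra.
Qed.

End NegativeExponent.

End EdgeAsymptotics.

(** * The mean inverse at the edge itself *)

Section CriticalIntegral.
Context {R : realType}.
Variables (m : probability R R) (c : R).

Local Notation M := (mean_inv m c).
Local Notation C := (`[c, +oo[%classic : set R).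
Local Notation I1 := (\int[m]_(x in C) inv_shift c x)%E.
Local Notation I2 := (\int[m]_(x in C) inv_shift2 c x)%E.

Let mC : measurable C. Proof. by []. Qed.

Lemma measurable_inv_shift : measurable_fun C (inv_shift c).
Proof.
apply: measurable_funTS; apply: measurable_fun_ifT => //.
- exact: measurable_fun_eqr.
- by apply/measurable_EFinP; apply: measurable_funV; exact: measurable_funB.
Qed.

Lemma measurable_inv_shift2 : measurable_fun C (inv_shift2 c).
Proof.
apply: measurable_funTS; apply: measurable_fun_ifT => //.
- exact: measurable_fun_eqr.
- apply/measurable_EFinP; apply: measurable_funV; apply: measurable_funX.
  exact: measurable_funB.
Qed.

Lemma inv_shift_ge0 x : C x -> (0 <= inv_shift c x)%E.
Proof.
rewrite /= in_itv /= andbT /inv_shift => cx; case: eqP => // _.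
by rewrite lee_fin invr_ge0 subr_ge0.
Qed.

Lemma inv_shift2_ge0 x : (0 <= inv_shift2 c x)%E.
Proof. by rewrite /inv_shift2; case: eqP => // _; rewrite lee_fin invr_ge0 sqr_ge0. Qed.

Lemma mean_invE z : z < c -> (M z)%:E = (\int[m]_(x in C) ((x - z)^-1)%:E)%E.
Proof.
by move=> zc; rewrite /mean_inv /Rintegral fineK// integrable_fin_num//; exact: integrable_inv.
Qed.

Let inv_ge0 (z x : R) : z < c -> C x -> (0 <= ((x - z)^-1)%:E)%E.
Proof. by move=> zc /=; rewrite in_itv /= andbT => cx; rewrite lee_fin invr_ge0; lra. Qed.

Let minv (z : R) : measurable_fun C (fun x : R => ((x - z)^-1)%:E).
Proof.
apply: measurable_funTS; apply/measurable_EFinP; apply: measurable_funV.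
exact: measurable_funB.
Qed.

Lemma mean_inv_le_edge z : z < c -> ((M z)%:E <= I1)%E.
Proof.
move=> zc; rewrite mean_invE//; apply: ge0_le_integral => //.
- by move=> x; exact: inv_ge0.
- exact: measurable_inv_shift.
- move=> x; rewrite /= in_itv /= andbT /inv_shift => cx; case: eqP => [_|/eqP xc]; first exact: leey.
  have xc' : c < x by rewrite lt_neqAle eq_sym xc.
  by rewrite lee_fin lef_pV2 ?posrE; lra.
Qed.

Lemma mean_inv_le z y : z <= y -> y < c -> M z <= M y.
Proof.
move=> zy yc; have zc : z < c by lra.
rewrite -lee_fin !mean_invE//; apply: ge0_le_integral => //.
- by move=> x; exact: inv_ge0.
- move=> x; rewrite /= in_itv /= andbT => cx.
  by rewrite lee_fin lef_pV2 ?posrE; lra.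
Qed.

(** Pointwise, the right side minus the left is (c - z)^2 / ((x - c)^2 (x - z)) for x > c; at x = c
    both sides are infinite. *)
Lemma edge_le_mean_inv z : z < c -> (I1 <= (M z)%:E + (c - z)%:E * I2)%E.
Proof.
move=> zc; rewrite mean_invE// -ge0_integralZl//; first last.
- by rewrite lee_fin; lra.
- by move=> x _; exact: inv_shift2_ge0.
- exact: measurable_inv_shift2.
rewrite -ge0_integralD//; first last.
- by apply: measurable_funeM; exact: measurable_inv_shift2.
- by move=> x _; rewrite mule_ge0 ?inv_shift2_ge0// lee_fin; lra.
- by move=> x; exact: inv_ge0.
apply: ge0_le_integral => //.
- by move=> x; exact: inv_shift_ge0.
- exact: measurable_inv_shift.
- by apply: emeasurable_funD => //; apply: measurable_funeM; exact: measurable_inv_shift2.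
- move=> x; rewrite /= in_itv /= andbT /inv_shift /inv_shift2 => cx.
  case: eqP => [_|/eqP xc].
    by rewrite gt0_muley ?lte_fin ?subr_gt0// addey.
  have xc' : 0 < x - c by rewrite subr_gt0 lt_neqAle eq_sym xc.
  rewrite -EFinM -EFinD lee_fin.
  have xz : 0 < x - z by lra.
  rewrite -subr_ge0.
  rewrite [leRHS](_ : _ = (c - z) ^+ 2 / ((x - c) ^+ 2 * (x - z))); last first.
    by field; rewrite !gt_eqF.
  by rewrite divr_ge0 ?sqr_ge0// mulr_ge0 ?sqr_ge0// ltW.
Qed.

Lemma edge_fin_num : (I2 < +oo)%E -> I1 \is a fin_num.
Proof.
move=> fI2; rewrite ge0_fin_numE; last by apply: integral_ge0 => x; exact: inv_shift_ge0.
have c1 : c - 1 < c by lra.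
apply: (le_lt_trans (edge_le_mean_inv _ c1)).
rewrite (_ : c - (c - 1) = 1); last by ring.
by rewrite mul1e lte_add_pinfty ?ltry.
Qed.

Lemma mean_inv_cvg_edge : (fun n => (M (c - n.+1%:R^-1))%:E) @ \oo --> I1.
Proof.
have n0 n : c - n.+1%:R^-1 < c by rewrite ltrBlDr ltrDl invr_gt0 ltr0n.
rewrite (_ : (fun n => _) = fun n => (\int[m]_(x in C) ((x - (c - n.+1%:R^-1))^-1)%:E)%E); last first.
  by apply/funext => n; rewrite mean_invE.
have E : I1 = (\int[m]_(x in C) (limn (fun n => ((x - (c - n.+1%:R^-1))^-1)%:E)))%E.
  apply: eq_integral => x; rewrite inE /= in_itv /= andbT => cx; apply/esym.
  apply: cvg_lim => //; rewrite /inv_shift; case: eqP => [->|/eqP xc].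
    apply/cvgeyPge => A; exists (truncn A) => // n /= nA.
    rewrite opprB addrC subrK invrK lee_fin.
    apply: (le_trans (ltW (truncnS_gt A))); by rewrite ler_nat.
  have xc' : 0 < x - c by rewrite subr_gt0 lt_neqAle eq_sym xc.
  apply: cvg_EFin; first by near=> n.
  apply: cvgV; first by rewrite gt_eqF.
  rewrite -[X in _ --> x - X]subr0; apply: cvgB; first exact: cvg_cst.
  apply: cvgB; first exact: cvg_cst.
  exact: cvg_harmonic.
rewrite E; apply: cvg_monotone_convergence => //.
- by move=> n x; exact: inv_ge0.
- move=> x; rewrite /= in_itv /= andbT => cx p q pq.
  have := n0 p; have := n0 q => hp hq.
  rewrite lee_fin lef_pV2 ?posrE ?subr_gt0 ?(lt_le_trans _ cx)// lerD2l lerN2 lerD2l lerN2.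
  by rewrite lef_pV2 ?posrE ?ltr0n// ler_nat.
Unshelve. all: by end_near.
Qed.

(** Monotone convergence; this replaces [edge_le_mean_inv] when 0 < nu <= 1, where the integral of
    (x - c)^-2 diverges. *)
Lemma mean_inv_bounded_edge (K : R) : (forall u, 0 < u <= 1 -> M (c - u) <= K) ->
  I1 \is a fin_num /\
  forall e, 0 < e -> exists2 u, 0 < u & fine I1 - e <= M (c - u).
Proof.
move=> hK; have n1 n : 0 < (n.+1%:R^-1 : R) <= 1.
  by rewrite invr_gt0 ltr0n/= invf_le1 ?ltr0n// ler1n.
have fI : I1 \is a fin_num.
  rewrite ge0_fin_numE; last by apply: integral_ge0 => x; exact: inv_shift_ge0.
  apply: (@le_lt_trans _ _ K%:E); last exact: ltry.
  rewrite -(cvg_lim _ mean_inv_cvg_edge)//; apply: lime_le.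
    by apply/cvg_ex; exists I1; exact: mean_inv_cvg_edge.
  by near=> n; rewrite /= lee_fin; exact: hK.
split => // e e0.
have /fine_cvgP[_ /cvgrPdist_le/(_ e e0)[N _ hN]] :
    (fun n => (M (c - n.+1%:R^-1))%:E) @ \oo --> (fine I1)%:E.
  by rewrite fineK//; exact: mean_inv_cvg_edge.
exists N.+1%:R^-1; first by case/andP: (n1 N).
have := hN N (leqnn N); rewrite /= ler_norml => /andP[_]; lra.
Unshelve. all: by end_near.
Qed.

End CriticalIntegral.

Lemma is_littleo_at0 {R : realType} (f h : R -> R) :
  (forall e, 0 < e -> exists2 delta, 0 < delta &
     forall a, 0 < a < delta -> `|f a| <= e * `|h a|) ->
  is_littleo 0^'+ f h.
Proof.
move=> H e /H[delta d0 hd]; near=> a; apply: hd; apply/andP; split; near: a.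
- exact: nbhs_right_gt.
- exact: nbhs_right_lt.
Unshelve. all: by end_near.
Qed.

Lemma ln_tangent {R : realType} (x b : R) : 0 < x -> 0 < b -> ln x <= ln b + x / b - 1.
Proof.
move=> x0 b0; have xb : 0 < x / b by rewrite divr_gt0.
have : ln (1 + (x / b - 1)) <= x / b - 1 by rewrite le_ln1Dx//; lra.
by rewrite addrC subrK ln_div ?posrE//; lra.
Qed.

(** Convexity of w^nu, from exp y >= 1 + y and the tangent of the logarithm at 1. *)
Lemma powR_tangent {R : realType} (nu w b : R) : 0 < w -> 0 < b ->
  nu <= 0 -> b `^ nu * (1 + nu * (w / b - 1)) <= w `^ nu.
Proof.
move=> w0 b0 nu0; have wb : 0 < w / b by rewrite divr_gt0.
have -> : w `^ nu = b `^ nu * (w / b) `^ nu.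
  by rewrite -powRM ?(ltW b0) ?(ltW wb)// mulrC divfK// gt_eqF.
rewrite ler_wpM2l ?powR_ge0// /powR gt_eqF//.
apply: (le_trans _ (expR_ge1Dx _)); rewrite lerD2l.
rewrite ler_wnM2l//; have := ln_tangent (w / b) 1 wb ltr01.
by rewrite ln1 divr1; lra.
Qed.

Lemma xlnx_small {R : realType} (e : R) : 0 < e ->
  exists2 delta, 0 < delta & forall a, 0 < a < delta -> a * - ln a <= e.
Proof.
move=> e0; pose s := e / 2; have s0 : 0 < s by rewrite divr_gt0.
pose D := 1 + `|ln s|; have D0 : 0 < D by rewrite ltr_pwDl.
exists (s / D); first by rewrite divr_gt0.
move=> a /andP[a0]; rewrite ltr_pdivlMr// => ad.
(* The tangent at 1 / s gives a (- ln a) <= a |ln s| + s, with s = e / 2. *)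
have := ln_tangent a^-1 s^-1; rewrite !invr_gt0 !lnV ?posrE// => /(_ a0 s0).
rewrite invrK => /(ler_wpM2l (ltW a0)); rewrite mulrBr mulrDr mulrA mulfV ?gt_eqF// mul1r => h.
have : a * - ln s <= a * `|ln s| by rewrite ler_pM2l// -normrN ler_norm.
by move: ad; rewrite /D /s in h *; lra.
Qed.

(** * Expansions of the time constant *)

Section VariationalAsymptotics.
Context {R : realType}.
Variables (m : probability R R) (c : R) (psi : R -> R).
Hypothesis c_gt0 : 0 < c.
Hypothesis psi_le : forall a z, 0 < a -> 0 < z < c -> psi a <= stationary_speed m c a z.
Hypothesis psi_near : forall a e, 0 < a -> 0 < e ->
  exists2 z, 0 < z < c & stationary_speed m c a z - e <= psi a.

Local Notation M := (mean_inv m c).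
Local Notation C := (`[c, +oo[%classic : set R).
Local Notation I1 := (\int[m]_(x in C) inv_shift c x)%E.
Local Notation I2 := (\int[m]_(x in C) inv_shift2 c x)%E.

(** With z = c - u, convexity gives z^-1 >= c^-1 + u / c^2, so the speed may be linearised at the
    edge in lower bounds. [psi_le_edge] is the matching upper bound, with relative error 2 u / c. *)
Lemma psi_ge a g : 0 < a ->
  (forall u, 0 < u < c -> g <= c^-1 + u / c ^+ 2 + a * M (c - u)) -> g <= psi a.
Proof.
move=> a0 hg; apply/ler_addgt0Pr => e e0.
have c0 := c_gt0.
have [z /andP[z0 zc] hz] := psi_near a e a0 e0.
have ub : 0 < c - z < c by lra.
have := hg _ ub; rewrite (_ : c - (c - z) = z); last by ring.
have h : c^-1 + (c - z) / c ^+ 2 <= z^-1.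
  rewrite -subr_ge0 [leRHS](_ : _ = (c - z) ^+ 2 / (z * c ^+ 2)); last first.
    by field; rewrite !gt_eqF.
  by rewrite divr_ge0 ?sqr_ge0// mulr_ge0 ?sqr_ge0 ?(ltW z0).
by move: hz; rewrite /stationary_speed; lra.
Qed.

Lemma psi_le_edge a u : 0 < a -> 0 < u <= c / 2 ->
  psi a <= c^-1 + u / c ^+ 2 * (1 + 2 * u / c) + a * M (c - u).
Proof.
move=> a0 /andP[u0 uc]; have c0 := c_gt0.
have zb : 0 < c - u < c by lra.
apply: (le_trans (psi_le a (c - u) a0 zb)); rewrite /stationary_speed lerD2r.
have cu : 0 < c - u by lra.
rewrite -subr_ge0 [leRHS](_ : _ = u ^+ 2 * (c - 2 * u) / (c ^+ 3 * (c - u))); last first.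
  by field; rewrite !gt_eqF.
by rewrite divr_ge0 ?mulr_ge0 ?sqr_ge0 ?exprn_ge0//; lra.
Qed.

Lemma psi_le_affine a : 0 < a -> I1 \is a fin_num -> psi a <= c^-1 + a * fine I1.
Proof.
move=> a0 fI; have c0 := c_gt0; apply/ler_addgt0Pr => e e0.
have ec : 0 < e * c ^+ 2 / 2 by rewrite divr_gt0// mulr_gt0// exprn_gt0.
pose u := Num.min (c / 2) (e * c ^+ 2 / 2).
have u0 : 0 < u by rewrite lt_min ec andbT; lra.
have uc : u <= c / 2 by rewrite ge_min lexx.
have ue : u <= e * c ^+ 2 / 2 by rewrite ge_min lexx orbT.
have ub : 0 < u <= c / 2 by rewrite u0.
have cu : c - u < c by lra.
apply: (le_trans (psi_le_edge a u a0 ub)).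
have h1 : M (c - u) <= fine I1.
  by rewrite -lee_fin [leRHS]fineK//; exact: mean_inv_le_edge.
have h2 : u / c ^+ 2 <= e / 2 by rewrite ler_pdivrMr ?exprn_gt0//; lra.
have h3 : 2 * u / c <= 1 by rewrite ler_pdivrMr//; lra.
have h4 : u / c ^+ 2 * (1 + 2 * u / c) <= e / 2 * 2.
  apply: ler_pM => //.
  - by rewrite divr_ge0 ?sqr_ge0// ltW.
  - by rewrite addr_ge0// divr_ge0 ?mulr_ge0// ltW.
  - by lra.
have : a * M (c - u) <= a * fine I1 by rewrite ler_pM2l.
lra.
Qed.

(** Moving away from the edge by u costs u / c^2 and saves at most a u [fine I2]. For a <= 1 / (c^2
    (fine I2 + 1)) the cost wins and the infimum is the limit at the edge. *)
Lemma psi_affine : (I2 < +oo)%E ->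
  exists2 a0 : R, 0 < a0 & forall a, 0 < a <= a0 -> psi a = c^-1 + a * fine I1.
Proof.
move=> fI2; have c0 := c_gt0; have fI := edge_fin_num m c fI2.
have I20 : (0 <= I2)%E by apply: integral_ge0 => x _; exact: inv_shift2_ge0.
have fI2' : I2 \is a fin_num by rewrite ge0_fin_numE.
have S0 : 0 <= fine I2 by exact: fine_ge0.
have c2 : 0 < c ^+ 2 by rewrite exprn_gt0.
have D0 : 0 < c ^+ 2 * (fine I2 + 1) by rewrite mulr_gt0//; lra.
exists (c ^+ 2 * (fine I2 + 1))^-1; first by rewrite invr_gt0.
move=> a /andP[a0 ale]; apply/eqP; rewrite eq_le psi_le_affine//=.
apply: psi_ge => // u /andP[u0 uc].
have cu : c - u < c by lra.
have : fine I1 <= M (c - u) + u * fine I2.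
  have := edge_le_mean_inv m c _ cu; rewrite (_ : c - (c - u) = u); last by ring.
  by rewrite -[X in (X <= _)%E -> _]fineK// -[X in (_ <= _ + _ * X)%E -> _]fineK// -EFinM -EFinD lee_fin.
move=> /(ler_wpM2l (ltW a0)) h.
have h2 : a * (c ^+ 2 * (fine I2 + 1)) <= 1.
  by rewrite -ler_pdivlMr// div1r.
have h3 : u * (a * fine I2) <= u / c ^+ 2.
  rewrite ler_pM2l// -[leRHS]div1r ler_pdivlMr//.
  have : 0 <= a * c ^+ 2 by rewrite mulr_ge0 ?ltW.
  lra.
lra.
Qed.

(** For u <= u0 the mean inverse is at least its edge value minus e; for u > u0 and small a the cost
    u / c^2 alone exceeds a times the edge value. *)
Lemma psi_bounded_asymp (K : R) : (forall u, 0 < u <= 1 -> M (c - u) <= K) ->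
  is_littleo 0^'+ (fun a => psi a - (c^-1 + a * fine I1)) (fun a => a).
Proof.
move=> hK; have c0 := c_gt0; have [fI hu] := mean_inv_bounded_edge m c K hK.
apply: is_littleo_at0 => e e0; have [u0 u00 hu0] := hu e e0.
have c2 : 0 < c ^+ 2 by rewrite exprn_gt0.
have F0 : 0 <= fine I1.
  by apply/fine_ge0; apply: integral_ge0 => x; exact: inv_shift_ge0.
have D0 : 0 < c ^+ 2 * (fine I1 + 1) by rewrite mulr_gt0//; lra.
exists (u0 / (c ^+ 2 * (fine I1 + 1))); first by rewrite divr_gt0.
move=> a /andP[a0 ad]; rewrite (gtr0_norm a0) ler_norml.
have up := psi_le_affine a a0 fI.
apply/andP; split; last by have := mulr_gt0 e0 a0; lra.
suff : c^-1 + a * (fine I1 - e) <= psi a by lra.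
apply: psi_ge => // u /andP[u0' uc].
have cu : c - u < c by lra.
have q0 : 0 < u / c ^+ 2 by rewrite divr_gt0.
case: (leP u u0) => uu0.
  have : M (c - u0) <= M (c - u) by apply: mean_inv_le => //; lra.
  move=> h; have : a * (fine I1 - e) <= a * M (c - u) by rewrite ler_pM2l//; lra.
  lra.
have h1 : 0 <= a * M (c - u) by rewrite mulr_ge0 ?(ltW a0)//; exact: mean_inv_ge0.
have h2 : a * (fine I1 - e) <= u / c ^+ 2.
  rewrite ler_pdivlMr//; move: ad; rewrite ltr_pdivlMr// => ad.
  have : 0 <= a * c ^+ 2 * (1 + e) by rewrite !mulr_ge0 ?ltW//; lra.
  lra.
lra.
Qed.

Lemma psi_log_asymp (kappa : R) : 0 < kappa ->
  (forall eta, 0 < eta <= kappa -> exists delta K, [/\ 0 < delta, 0 <= K &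
    forall u, 0 < u < delta ->
    (kappa - eta) * - ln u - K <= M (c - u) <= (kappa + eta) * - ln u + K]) ->
  is_littleo 0^'+ (fun a => psi a - (c^-1 - kappa * a * ln a)) (fun a => a * ln a).
Proof.
move=> k0 hM; have c0 := c_gt0; apply: is_littleo_at0 => e e0.
have c2 : 0 < c ^+ 2 by rewrite exprn_gt0.
pose eta := Num.min (kappa / 2) (e / 2).
have eta0 : 0 < eta by rewrite lt_min !divr_gt0.
have etak : eta <= kappa / 2 by rewrite ge_min lexx.
have etae : eta <= e / 2 by rewrite ge_min lexx orbT.
have etab : 0 < eta <= kappa by rewrite eta0/=; lra.
have [delta [K [d0 K0 hd]]] := hM eta etab.
(* a t is the minimiser of u / c^2 - a (kappa - eta) ln u. *)
pose t := (kappa - eta) * c ^+ 2.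
have t0 : 0 < t by rewrite mulr_gt0//; lra.
(* Once - ln a >= T, the bounded terms together are at most e / 2 times - ln a; the other half of e
   is left for eta. *)
pose T := (2 / c ^+ 2 + K + (kappa - eta) * `|ln t|) / (e / 2).
have [d1 d10 hd1] := xlnx_small (delta / (c ^+ 2 * kappa)) (divr_gt0 d0 (mulr_gt0 c2 k0)).
have cc0 : 0 < 2 / c ^+ 2 by rewrite divr_gt0.
have lt0 : 0 <= (kappa - eta) * `|ln t| by rewrite mulr_ge0//; lra.
exists (Num.min (Num.min (c / 2) (expR (- T))) (Num.min d1 (Num.min delta 1))).
  by rewrite !lt_min divr_gt0//= expR_gt0 d10 d0 ltr01.
move=> a /andP[a0]; rewrite !lt_min => /andP[/andP[ac aT] /andP[ad1 /andP[ad a1]]].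
pose L := - ln a.
have LT : T <= L.
  by rewrite /L lerNr -[leRHS]expRK ler_ln ?posrE ?expR_gt0// ltW.
have T0 : 0 <= T by rewrite /T divr_ge0//; lra.
have L0 : 0 <= L by exact: le_trans LT.
have eL : 2 / c ^+ 2 + K + (kappa - eta) * `|ln t| <= e / 2 * L.
  by rewrite [leRHS]mulrC -ler_pdivrMr// divr_gt0.
have -> : `|a * ln a| = a * L.
  by rewrite normrM (gtr0_norm a0) ler0_norm//; move: L0; rewrite /L; lra.
have -> : psi a - (c^-1 - kappa * a * ln a) = psi a - (c^-1 + a * (kappa * L)).
  by rewrite /L; ring.
have eaL := ler_wpM2l (ltW a0) eL.
have etaL : a * (eta * L) <= a * (e / 2 * L).
  by rewrite ler_pM2l// ler_wpM2r.
rewrite ler_norml; apply/andP; split; last first.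
  have ub : 0 < a <= c / 2 by rewrite a0 ltW.
  (* The trial point u = a already has the right leading term. *)
  have := psi_le_edge a a a0 ub.
  have ab : 0 < a < delta by rewrite a0.
  have /andP[_ /(ler_wpM2l (ltW a0)) h] := hd a ab; rewrite -/L in h.
  have h3 : 2 * a / c <= 1 by rewrite ler_pdivrMr//; lra.
  have h4 : a / c ^+ 2 * (1 + 2 * a / c) <= a * (2 / c ^+ 2).
    rewrite [leRHS](_ : _ = a / c ^+ 2 * 2); last by ring.
    by rewrite ler_wpM2l ?divr_ge0 ?sqr_ge0 ?(ltW a0)//; lra.
  have h5 : 0 <= a * ((kappa - eta) * `|ln t|) by rewrite mulr_ge0// ltW.
  by rewrite !mulrDr in h eaL; lra.
suff : c^-1 + a * (kappa * L - e * L) <= psi a by lra.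
apply: psi_ge => // u /andP[u0 uc].
have cu : c - u < c by lra.
have eL0 : 0 <= a * (e * L) by rewrite !mulr_ge0// ltW.
case: (ltP u delta) => ud.
  have ub : 0 < u < delta by rewrite u0.
  have /andP[/(ler_wpM2l (ltW a0)) h _] := hd u ub.
  have at0 : 0 < a * t by rewrite mulr_gt0.
  have /(ler_wpM2l (ltW (mulr_gt0 a0 (_ : 0 < kappa - eta)))) tg := ln_tangent u (a * t) u0 at0.
  have {}tg : a * (kappa - eta) * ln u <= a * (kappa - eta) * (ln (a * t) + u / (a * t) - 1).
    by apply: tg; lra.
  have e1 : a * (kappa - eta) * (u / (a * t)) = u / c ^+ 2.
    by rewrite /t; field; rewrite !gt_eqF//; lra.
  have e2 : ln (a * t) = - L + ln t by rewrite lnM ?posrE// /L opprK.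
  have e3 : a * ((kappa - eta) * ln t) <= a * ((kappa - eta) * `|ln t|).
    by rewrite ler_pM2l// ler_wpM2l ?ler_norm//; lra.
  have e4 : 0 <= a * (2 / c ^+ 2) by rewrite mulr_ge0// ltW.
  have e5 : 0 <= a * (kappa - eta) by rewrite mulr_ge0 ?(ltW a0)//; lra.
  move: (u / (a * t)) e1 tg => q e1; rewrite e2 => tg.
  lra.
(* For u >= delta the cost u / c^2 alone beats the leading term, because a kappa (- ln a) <= delta /
   c^2 by the choice of [d1]. *)
have h1 : 0 <= a * M (c - u) by rewrite mulr_ge0 ?(ltW a0)//; exact: mean_inv_ge0.
have ab : 0 < a < d1 by rewrite a0.
have := hd1 a ab; rewrite -/L ler_pdivlMr ?mulr_gt0// => h2.
have h3 : a * (kappa * L) <= u / c ^+ 2 by rewrite ler_pdivlMr//; lra.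
lra.
Qed.

(** The scaling u = b w with b = a^(1 / (1 - nu)) makes both terms proportional to b, since a b^nu =
    b. What is left is the minimum of w / c^2 + D w^nu, attained at [B0] with value [B]. *)
Lemma psi_powR_asymp (nu D : R) : nu < 0 -> 0 < D ->
  (forall eta, 0 < eta -> exists2 delta, 0 < delta & forall u, 0 < u < delta ->
    D - eta <= u `^ (- nu) * M (c - u) <= D + eta) ->
  let B0 := (- nu * D * c ^+ 2) `^ (1 - nu)^-1 in
  let B := B0 / c ^+ 2 + D * B0 `^ nu in
  is_littleo 0^'+ (fun a => psi a - (c^-1 + B * a `^ (1 - nu)^-1)) (fun a => a `^ (1 - nu)^-1).
Proof.
move=> nu0 D0 hM B0 B; have c0 := c_gt0; apply: is_littleo_at0 => e e0.
have c2 : 0 < c ^+ 2 by rewrite exprn_gt0.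
have n1 : 0 < 1 - nu by lra.
have base0 : 0 < - nu * D * c ^+ 2 by rewrite !mulr_gt0// oppr_gt0.
have B00 : 0 < B0 by rewrite powR_gt0.
have Bnu0 : 0 < B0 `^ nu by rewrite powR_gt0.
have B0c : 0 < B0 / c ^+ 2 by rewrite divr_gt0.
have B_gt0 : 0 < B by rewrite /B addr_gt0// mulr_gt0.
(* The derivative of w / c^2 + D w^nu vanishes at [B0]; by [powR_tangent] this makes [B0] a global
   minimiser. *)
have critical : - nu * D * B0 `^ nu / B0 = (c ^+ 2)^-1.
  have B0n : B0 `^ (1 - nu) = - nu * D * c ^+ 2.
    by rewrite /B0 -powRrM mulVf ?gt_eqF// powRr1// ltW.
  have BB : B0 `^ nu * B0 `^ (1 - nu) = B0.
    rewrite -powRD; last by apply/implyP => _; rewrite gt_eqF.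
    by rewrite addrC subrK powRr1// ltW.
  rewrite B0n in BB; rewrite -[X in _ / X = _]BB.
  by field; rewrite (lt_eqF nu0) !gt_eqF.
have g_min w : 0 < w -> B <= w / c ^+ 2 + D * w `^ nu.
  move=> w0; have /(ler_wpM2l (ltW D0)) h := powR_tangent nu w B0 w0 B00 (ltW nu0).
  apply: le_trans (lerD (lexx _) h); rewrite -critical /B -critical.
  by rewrite le_eqVlt; apply/orP; left; apply/eqP; field; rewrite gt_eqF.
(* A relative error: the factor 1 - et costs at most et B <= e in the lower bound, uniformly in
   w. *)
pose et := Num.min 1 (e / B).
have et0 : 0 < et by rewrite lt_min ltr01 divr_gt0.
have et1 : et <= 1 by rewrite ge_min lexx.
have etB : et * B <= e by rewrite -ler_pdivlMr// ge_min lexx orbT.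
have [d1 d10 hd1] := hM (et * D) (mulr_gt0 et0 D0).
pose eta2 := e / 2 / B0 `^ nu.
have eta20 : 0 < eta2 by rewrite !divr_gt0.
have [d2 d20 hd2] := hM eta2 eta20.
(* Four conditions on b: the trial point B0 b is at most c / 2 and below [d2], the quadratic
   correction of [psi_le_edge] is at most e / 2 relative to b, and b B <= d1 / c^2, which settles u
   >= [d1]. *)
pose b0 := Num.min (Num.min (c / 2 / B0) (e / 2 * c ^+ 3 / (2 * B0 ^+ 2)))
   (Num.min (d2 / 2 / B0) (d1 / c ^+ 2 / B)).
have b00 : 0 < b0.
  by rewrite !lt_min !divr_gt0 ?mulr_gt0 ?exprn_gt0 ?divr_gt0.
have beta0 : 0 < (1 - nu)^-1 by rewrite invr_gt0.
have [da da0 hda] := powR_small (1 - nu)^-1 b0 beta0 b00.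
exists da => // a /[dup] ab /andP[a0 _]; have := hda a ab.
set b := a `^ (1 - nu)^-1; rewrite !le_min => /andP[/andP[b1 b2] /andP[b3 b4]].
have b_gt0 : 0 < b by rewrite powR_gt0.
have bn : a * b `^ nu = b.
  have -> : a = b `^ (1 - nu) by rewrite /b -powRrM mulVf ?gt_eqF// powRr1// ltW.
  rewrite -powRD; last by apply/implyP => _; rewrite gt_eqF.
  by rewrite subrK powRr1// ltW.
have aM u : 0 < u -> a * M (c - u) = b * (u / b) `^ nu * (u `^ (- nu) * M (c - u)).
  move=> u0; have ub : 0 < u / b by rewrite divr_gt0.
  have uE : u `^ nu = (u / b) `^ nu * b `^ nu.
    by rewrite -powRM ?(ltW ub) ?(ltW b_gt0)// divfK// gt_eqF.
  have u1 : u `^ nu * u `^ (- nu) = 1.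
    rewrite -powRD; last by apply/implyP => _; rewrite gt_eqF.
    by rewrite subrr powRr0.
  rewrite -[X in X * (_ / b) `^ nu]bn -[in LHS](mulr1 a) -u1 uE; ring.
rewrite (gtr0_norm b_gt0) ler_norml; apply/andP; split; last first.
  have u0 : 0 < B0 * b by rewrite mulr_gt0.
  have uc : 0 < B0 * b <= c / 2 by rewrite u0/= mulrC -ler_pdivlMr.
  have ud : 0 < B0 * b < d2.
    rewrite u0/= mulrC (@le_lt_trans _ _ (d2 / 2))//; last by rewrite gtr_pMr// invf_lt1// ltr1n.
    by rewrite -ler_pdivlMr.
  have := psi_le_edge a _ a0 uc.
  have /andP[_ h] := hd2 _ ud.
  rewrite (aM _ u0) mulfK ?gt_eqF// => h2.
  have h3 : b * B0 `^ nu * ((B0 * b) `^ (- nu) * M (c - B0 * b)) <= b * B0 `^ nu * (D + eta2).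
    by rewrite ler_pM2l// mulr_gt0.
  have h4 : b * B0 `^ nu * (D + eta2) = b * (D * B0 `^ nu) + b * (e / 2).
    by rewrite /eta2; field; rewrite gt_eqF.
  have h5 : 2 * B0 ^+ 2 / c ^+ 3 * b <= e / 2.
    rewrite mulrAC ler_pdivrMr ?exprn_gt0// mulrC -ler_pdivlMr// ?mulr_gt0 ?exprn_gt0//.
  have h6 : B0 * b / c ^+ 2 * (1 + 2 * (B0 * b) / c) =
      b * (B0 / c ^+ 2) + b * (2 * B0 ^+ 2 / c ^+ 3 * b).
    by field; rewrite gt_eqF.
  have h7 : b * (2 * B0 ^+ 2 / c ^+ 3 * b) <= b * (e / 2) by rewrite ler_pM2l.
  by move: h2 h3 h4 h6 h7; rewrite /B; clear; lra.
suff : c^-1 + b * (B - e) <= psi a by clear; lra.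
apply: psi_ge => // u /andP[u0 uc].
have cu : c - u < c by rewrite gtrBl.
case: (ltP u d1) => ud.
  have ub : 0 < u < d1 by rewrite u0.
  have /andP[h _] := hd1 u ub.
  have w0 : 0 < u / b by rewrite divr_gt0.
  have wn : 0 < (u / b) `^ nu by rewrite powR_gt0.
  have h1 : b * (u / b) `^ nu * (D - et * D) <= a * M (c - u).
    by rewrite (aM _ u0) ler_pM2l// mulr_gt0.
  have et1' : 0 <= 1 - et by rewrite subr_ge0.
  have h2 := ler_wpM2l (mulr_ge0 (ltW b_gt0) et1') (g_min _ w0).
  have h3 : b * (1 - et) * (u / b / c ^+ 2) = u / c ^+ 2 - et * (u / c ^+ 2).
    by field; rewrite !gt_eqF.
  have h4 : 0 <= et * (u / c ^+ 2) by rewrite mulr_ge0 ?divr_ge0 ?ltW.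
  have h5 : b * (et * B) <= b * e by rewrite ler_pM2l.
  by move: h1 h2 h3 h4 h5; clear; lra.
have h1 : 0 <= a * M (c - u) by rewrite mulr_ge0 ?(ltW a0)//; exact: mean_inv_ge0.
have h2 : b * B <= d1 / c ^+ 2 by rewrite -ler_pdivlMr.
have h3 : d1 / c ^+ 2 <= u / c ^+ 2 by rewrite ler_wpM2r// invr_ge0 ltW.
have h4 : 0 < b * e by rewrite mulr_gt0.
by move: h1 h2 h3 h4; clear; lra.
Qed.

End VariationalAsymptotics.

Theorem theorem2p4 (R : realType) (d : measure_display) (Omega : measurableType d)
  (P : probability Omega R) (m : probability R R)
  (xi : nat -> Omega -> R) (X : nat -> nat -> Omega -> R) (c : R)
  (Psi : R -> R -> R) :
  (* measurability of the environment and the weights *)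
  (forall j, measurable_fun setT (xi j)) ->
  (forall i j, measurable_fun setT (X i j)) ->
  (* joint law: xi_j i.i.d. with law m, and given {xi_j} the X(i,j) are
     independent, X(i,j) exponential with rate xi_j *)
  (forall (n : nat) (A : nat -> set R) (t : nat -> nat -> R),
      (forall j, measurable (A j)) -> (forall i j, 0 <= t i j) ->
      P [set w | forall j, (j < n)%N ->
                   A j (xi j w) /\ forall i, (i < n)%N -> t i j < X i j w] =
      (\prod_(j < n) \int[m]_(x in A j)
           (expR (- (x * \sum_(i < n) t i j)))%:E)%E) ->
  (* assumptions on m *)
  0 < c ->
  m (~` `[c, +oo[%classic) = 0%E ->
  (forall e, 0 < e -> (0 < m `[c, (c + e)%R[%classic)%E) ->
  (* Psi is the (deterministic) almost sure last-passage time constant *)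
  (forall x y, 0 < x -> 0 < y ->
     {ae P, forall w, (fun n : nat =>
         n%:R^-1 * lpp_time (fun i j => X i j w)
                     (truncn (n%:R * x)) (truncn (n%:R * y))) @ \oo --> Psi x y}) ->
  (* Case 1 *)
  ((\int[m]_(x in `[c, +oo[%classic) inv_shift2 c x < +oo)%E ->
     exists2 a0 : R, 0 < a0 & (forall a, 0 < a <= a0 ->
       Psi 1 a = c^-1 + a * fine (\int[m]_(x in `[c, +oo[%classic) inv_shift c x)%E))
  /\
  (* Case 2 *)
  (forall nu kappa : R, -1 <= nu <= 1 -> 0 < kappa ->
     (fun x => fine (m `[c, x[%classic) / (x - c) `^ (nu + 1)) @ c^'+ --> kappa ->
     [/\ 0 < nu ->
           is_littleo 0^'+
             (fun a => Psi 1 a - (c^-1 + a * fine (\int[m]_(x in `[c, +oo[%classic) inv_shift c x)%E))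
             (fun a => a),
         nu = 0 ->
           is_littleo 0^'+ (fun a => Psi 1 a - (c^-1 - kappa * a * ln a))
             (fun a => a * ln a)
       & nu < 0 ->
           let B0 := (2 * kappa * c ^+ 2 * A_nu nu) `^ (1 - nu)^-1 in
           let B := B0 / c ^+ 2 + kappa * B0 `^ nu * A_nu2 nu in
           is_littleo 0^'+ (fun a => Psi 1 a - (c^-1 + B * a `^ (1 - nu)^-1))
             (fun a => a `^ (1 - nu)^-1)]).
Proof.
move=> mxi mX law c_gt0 m_supp m_edge limPsi.
have psi_le a z : 0 < a -> 0 < z < c -> Psi 1 a <= stationary_speed m c a z.
  move=> a0; exact: (time_constant_le P m xi X c mxi mX law c_gt0 m_supp a _ a0 (limPsi 1 a ltr01 a0)).
have psi_near a e : 0 < a -> 0 < e ->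
    exists2 z, 0 < z < c & stationary_speed m c a z - e <= Psi 1 a.
  move=> a0; exact: (time_constant_near_optimal P m xi X c mxi mX law c_gt0 m_supp m_edge a _ a0
    (limPsi 1 a ltr01 a0)).
split=> [|nu kappa /andP[nu_ge _] kappa_gt0 edge].
  exact: (psi_affine m c (Psi 1) c_gt0 psi_le psi_near).
split=> [nu_gt0|nu0|nu_lt0].
- have [K hK] := mean_inv_bounded m c nu kappa kappa_gt0 edge nu_gt0.
  exact: (psi_bounded_asymp m c (Psi 1) c_gt0 psi_le psi_near K hK).
- apply: (psi_log_asymp m c (Psi 1) c_gt0 psi_le psi_near kappa kappa_gt0) => eta.
  exact: (mean_inv_log m c nu kappa kappa_gt0 edge eta nu0).
- move=> B0 B.
  have A2_gt0 : 0 < A_nu2 nu by rewrite A_nu2E; apply: bsum_lim_gt0 => //; rewrite oppr_gt0.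
  have := psi_powR_asymp m c (Psi 1) c_gt0 psi_le psi_near nu (kappa * A_nu2 nu) nu_lt0
    (mulr_gt0 kappa_gt0 A2_gt0) (mean_inv_powR m c nu kappa kappa_gt0 edge nu_ge nu_lt0).
  (* The minimiser is stated with [A_nu] while the asymptotics of M produce [A_nu2]; the Beta
     identity converts one into the other. *)
  have -> : - nu * (kappa * A_nu2 nu) * c ^+ 2 = 2 * kappa * c ^+ 2 * A_nu nu.
    transitivity (kappa * c ^+ 2 * (- nu * A_nu2 nu)); first by ring.
    by rewrite -(A_nu_relation nu nu_ge nu_lt0); ring.
  by rewrite /= -/B0 /B (mulrAC kappa (B0 `^ nu)).
Qed.
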